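(* Let $\varepsilon\in(0,1)$, let $(G,u)$ be a connected rooted graph on which the noisy voter model with noise $\varepsilon$ is run and observed at $u$, and let $d\in\mathbb N$. 1. If $\frac{\ln t}{t^2}=o\big(\mathrm{Var}\,S^{(d)}_t\big)$ as $t\to\infty$, then there exists a finite limit $\lim_{t\to\infty}t\,\mathrm{Var}\,S^{(d)}_t$ and $$\frac{S^{(d)}_t-\mathsf E S^{(d)}_t}{\sqrt{\mathrm{Var}\,S^{(d)}_t}}\stackrel{d}{\to}\eta\sim\mathcal N(0,1),\quad t\to\infty.$$ 2. There exists a finite limit $\lim_{t\to\infty}t\,\mathrm{Var}\,\tilde S^{(d)}_t$ and $$\frac{\tilde S^{(d)}_t-\mathsf E\tilde S^{(d)}_t}{\sqrt{\mathrm{Var}\,\tilde S^{(d)}_t}}\stackrel{d}{\to}\eta\sim\mathcal N(0,1),\quad t\to\infty.$$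
   Context: Noisy voter model (NVM) with noise $\varepsilon\in(0,1)$ on a connected (locally finite, with at least two vertices) graph $G$: let $N_G(u)$ be the set of neighbors of $u$. At time $0$, $X_0(u)\sim\mathrm{Bern}(1/2)$ independently over all $u\in V(G)$. For every $t\ge 1$ and $u\in V(G)$, $$X_t(u)=\xi_t(u)Y_t(u)+(1-\xi_t(u))\sum_{v\in N_G(u)}I(\eta_t(u)=v)X_{t-1}(v),$$ where $\xi_t(u)\sim\mathrm{Bern}(\varepsilon)$, $Y_t(u)\sim\mathrm{Bern}(1/2)$, $\eta_t(u)$ is uniform on $N_G(u)$, and all the variables $\xi_t(u),Y_t(u),\eta_t(u)$ ($t\ge1$, $u\in V(G)$) and $X_0(u)$ ($u\in V(G)$) are independent. For the fixed observed vertex $u$ write $X_t=X_t(u)$. Repetition statistic: for $t>d$, $S^{(d)}_t=\frac1{t-d}\sum_{i=1}^{t-d}I(X_i=X_{i+d})$. The quantity $p_d$: let $\mathcal D_G$ be the random directed graph on $V(G)\times\mathbb Z_+$ whose edges are exactly $((w,t),(v,t-1))$ with $t\ge1$, $\xi_t(w)=0$, $\eta_t(w)=v$. Let $\pi_t$ be the longest directed path in $\mathcal D_G$ starting at $(u,t)$; let $p_{t;d}$ be the probability that $\pi_t$ and $\pi_{t+d}$ have a common vertex. It is non-decreasing in $t$, and $p_d=\lim_{t\to\infty}p_{t;d}$. Modified statistic: fix an integer $\kappa$ so large that $$4(1-\varepsilon)^{\kappa-d}<(1-(1-\varepsilon)^{\kappa})(1+p_d)\Big(1-\tfrac12(1+p_d)\Big),$$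 and for $t>d$ put $\tilde S^{(d)}_t=\frac1{t-d}\sum_{i=1}^{t-d}I(X_{\kappa i}=X_{\kappa i+d})$. *)

(* Defs.v *)
From HB Require Import structures.
From mathcomp Require Import all_boot all_order all_algebra finmap.
From mathcomp Require Import all_classical all_reals all_analysis.

Set Implicit Arguments.
Unset Strict Implicit.
Unset Printing Implicit Defensive.

Import Order.TTheory GRing.Theory Num.Theory.
Import numFieldNormedType.Exports.

Local Open Scope classical_set_scope.
Local Open Scope ring_scope.

(* Locally finite simple graphs *)

Record lfgraph := LFGraph {
  vertex :> choiceType;
  nbr : vertex -> {fset vertex};
  nbr_sym : forall v w : vertex, (v \in nbr w) = (w \in nbr v);
  nbr_irr : forall v : vertex, v \notin nbr v
}.

Definition connected_graph (G : lfgraph) : Prop :=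
  forall v w : G,
    exists2 p : seq G, path (fun x y => y \in nbr x) v p & last v p = w.

Section Probability.
Context {R : realType} {disp : measure_display} {Omega : measurableType disp}.
Variable P : probability Omega R.

(* For families whose values carry the discrete sigma-algebra: every set of
   values is an admissible test set. *)
Definition mutually_independent (I : Type) (T : I -> Type)
    (Z : forall i : I, Omega -> T i) : Prop :=
  forall (n : nat) (i : 'I_n -> I), injective i ->
  forall A : forall k : 'I_n, set (T (i k)),
    P [set w | forall k, A k (Z (i k) w)] =
    (\prod_(k < n) P (Z (i k) @^-1` A k))%E.

Definition mean (Z : Omega -> R) : R := fine ('E_P[Z])%E.

Definition var (Z : Omega -> R) : R := fine ('V_P[Z])%E.

Definition standardized (Z : Omega -> R) : Omega -> R :=
  fun w => (Z w - mean Z) / Num.sqrt (var Z).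

(* The points with mu [set x] = 0 are the continuity points of the limiting
   distribution function. *)
Definition cvg_in_distribution (Z : nat -> Omega -> R)
    (mu : probability (measurableTypeR R) R) : Prop :=
  forall x : R, mu [set x] = 0%E ->
    P [set w | Z n w <= x] @[n --> \oo] --> mu `]-oo, x]%classic.

End Probability.

(* Names of the random inputs; [dXi t v], [dY t v] and [dEta t v] stand for the
   variables at time t.+1. *)
Variant driver (V : Type) : Type :=
  | dX0 of V
  | dXi of nat & V
  | dY of nat & V
  | dEta of nat & V.

Definition driver_val (V : Type) (i : driver V) : Type :=
  match i with
  | dX0 _ | dXi _ _ | dY _ _ => bool
  | dEta _ _ => V
  end.

Definition driver_rv (Omega V : Type) (X0 : V -> Omega -> bool)
    (xi Y : nat -> V -> Omega -> bool) (eta : nat -> V -> Omega -> V)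
    (i : driver V) : Omega -> driver_val i :=
  match i with
  | dX0 v => X0 v
  | dXi t v => xi t.+1 v
  | dY t v => Y t.+1 v
  | dEta t v => eta t.+1 v
  end.

(* [xi], [Y] and [eta] are only constrained, and only used, at times t >= 1. *)
Record nvm_input (R : realType) (disp : measure_display)
    (Omega : measurableType disp) (P : probability Omega R) (G : lfgraph)
    (eps : R) := NVMInput {
  nvm_X0 : G -> {RV P >-> bool};
  nvm_xi : nat -> G -> {RV P >-> bool};
  nvm_Y : nat -> G -> {RV P >-> bool};
  nvm_eta : nat -> G -> Omega -> G;
  nvm_X0_law : forall v (A : set bool),
    distribution P (nvm_X0 v) A = bernoulli_prob 2^-1 A;
  nvm_xi_law : forall t v (A : set bool), (1 <= t)%N ->
    distribution P (nvm_xi t v) A = bernoulli_prob eps A;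
  nvm_Y_law : forall t v (A : set bool), (1 <= t)%N ->
    distribution P (nvm_Y t v) A = bernoulli_prob 2^-1 A;
  nvm_eta_measurable : forall t v (A : set G), (1 <= t)%N ->
    measurable (nvm_eta t v @^-1` A);
  nvm_eta_law : forall t v w, (1 <= t)%N ->
    P (nvm_eta t v @^-1` [set w]) =
    ((w \in nbr v)%:R / #|` nbr v|%:R)%:E;
  nvm_indep : mutually_independent P
    (driver_rv (fun v => nvm_X0 v : Omega -> bool)
       (fun t v => nvm_xi t v : Omega -> bool)
       (fun t v => nvm_Y t v : Omega -> bool) nvm_eta)
}.

Section NoisyVoterModel.
Context {R : realType} {disp : measure_display} {Omega : measurableType disp}.
Context {P : probability Omega R} {G : lfgraph} {eps : R}.
Variable M : nvm_input P G eps.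

Fixpoint nvm (t : nat) (v : G) (w : Omega) : R :=
  match t with
  | 0%N => (nvm_X0 M v w)%:R
  | s.+1 =>
      (nvm_xi M t v w)%:R * (nvm_Y M t v w)%:R +
      (1 - (nvm_xi M t v w)%:R) *
        \sum_(z <- nbr v) (nvm_eta M t v w == z)%:R * nvm s z w
  end.

Variable u : G.

Definition rep_stat (d t : nat) (w : Omega) : R :=
  (t - d)%:R^-1 *
  \sum_(1 <= i < (t - d).+1) (nvm i u w == nvm (i + d) u w)%:R.

Definition mod_rep_stat (kappa d t : nat) (w : Omega) : R :=
  (t - d)%:R^-1 *
  \sum_(1 <= i < (t - d).+1)
    (nvm (kappa * i) u w == nvm (kappa * i + d) u w)%:R.

Definition dedge (w : Omega) : rel (G * nat) :=
  fun a b => [&& a.2 == b.2.+1, ~~ nvm_xi M a.2 a.1 w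
               & nvm_eta M a.2 a.1 w == b.1].

(* The path visits the vertices a :: p.  Out-degrees are at most 1 and time
   decreases along edges, so exactly one p satisfies this for each a. *)
Definition longest_path (w : Omega) (a : G * nat) (p : seq (G * nat)) : Prop :=
  path (dedge w) a p /\
  forall q, path (dedge w) a q -> (size q <= size p)%N.

Definition paths_meet (t d : nat) : set Omega :=
  [set w | exists p q : seq (G * nat),
     [/\ longest_path w (u, t) p, longest_path w (u, (t + d)%N) q
       & exists a : G * nat, a \in (u, t) :: p /\ a \in (u, (t + d)%N) :: q]].

Definition p_td (t d : nat) : R := fine (P (paths_meet t d)).

Definition p_d (d : nat) : R := limn (fun t => p_td t d).

(* The exponent kappa - d is an integer one, not a truncated difference. *)
Definition admissible_kappa (kappa d : nat) : Prop :=
  4 * (1 - eps) ^ (kappa%:Z - d%:Z) <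
  (1 - (1 - eps) ^+ kappa) * (1 + p_d d) * (1 - 2^-1 * (1 + p_d d)).

End NoisyVoterModel.

(* Main.v *)
(* The observed bit is read off the backward path of its vertex: the path stops
   at the first refreshed step or at time 0.  Hence X_t is a function of the inputs
   after time s up to an event of probability (1 - eps)^(t - s), which makes the
   covariances of the agreement indicators I(X_t = X_{t+d}) decay geometrically
   in the lag and become stationary at a geometric rate; so N^2 times the
   variance of the statistic is l N + O(1).

   If l > 0, replace each indicator by its version restarted at the beginning of
   a polylogarithmic block and drop the first logarithmically many indicators
   of each block.  This makes the blocks independent at negligible cost, and Lindeberg's
   replacement method gives the Gaussian limit.  Test functions are the
   distribution functions of Gaussian smoothings, for which a replacement step
   is a Taylor expansion and the Gaussian side is the heat equation.

   In part 1, l = 0 would leave N^2 Var bounded, against ln t / t^2 = o(Var).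
   In part 2, with e = lim P(X_t = X_{t+d}), coalescence of backward paths gives
   e = (1 + p_d) / 2, and l >= e(1 - e) - 2 (1 - eps)^(kappa - d) /
   (1 - (1 - eps)^kappa), which the choice of kappa makes positive. *)

Require Import Defs.
From HB Require Import structures.
From mathcomp Require Import all_boot all_order all_algebra finmap.
From mathcomp Require Import all_classical all_reals all_analysis.
From mathcomp Require Import measurable_realfun.
From mathcomp Require Import ring lra zify.

Set Implicit Arguments.
Unset Strict Implicit.
Unset Printing Implicit Defensive.

Import Order.TTheory GRing.Theory Num.Theory.
Import numFieldNormedType.Exports.

Local Open Scope classical_set_scope.
Local Open Scope ring_scope.

(** * Independence and expectations of finitely-valued functions *)

(** The graph may be infinite, and the inputs form an infinite family whose independence is stated
    for finite subfamilies. Hence every quantity of the model is a finitely-valued function on the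
    space of input configurations, recorded with a set of input indices that determines it.
    Independence then reduces to disjointness of index sets, time shifts become reindexings of the
    inputs, and expectations are finite sums over level sets.

    Restarting from the configuration 0, rather than conditioning, makes the dependence on a time
    window exact: the approximating indicator is a function of the inputs in the window, and the
    error is dominated by survival indicators of backward paths.

    The link between e and p_d is a duality: the correlation of two signs 2X - 1 and the probability
    that the two backward paths meet satisfy the same one-step recursion with the same boundary
    values.

    The smoothing has a variance delta > 0, which keeps the derivatives bounded at every replacement
    step; it is removed only afterwards, by squeezing a distribution function between shifted
    smoothed ones. *)

Section BoundedMeasurable.
Context {R : realType} {disp : measure_display} {Omega : measurableType disp}.
Variable P : probability Omega R.
Implicit Types f g : Omega -> R.

Definition bounded_measurable f :=
  measurable_fun setT f /\ exists C, forall x, `|f x| <= C.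

Lemma meanE f : mean P f = \int[P]_x f x.
Proof. by rewrite /mean unlock. Qed.

Lemma varE f : var P f = mean P (fun x => (f x - mean P f) ^+ 2).
Proof.
by rewrite /var /variance unlock /mean; congr (fine (expectation P _)).
Qed.

Lemma bounded_measurable_integrable f :
  bounded_measurable f -> P.-integrable setT (EFin \o f).
Proof.
move=> [mf [C fC]]; apply: measurable_bounded_integrable => //.
  by rewrite (le_lt_trans (probability_le1 _ _))// ltry.
exists C; split; first exact: num_real.
by move=> y Cy x _; apply: le_trans (fC x) (ltW Cy).
Qed.

Lemma bounded_measurableD f g : bounded_measurable f -> bounded_measurable g ->
  bounded_measurable (fun x => f x + g x).
Proof.
move=> [mf [C fC]] [mg [D gD]]; split; first exact: measurable_funD.
by exists (C + D) => x; rewrite (le_trans (ler_normD _ _))// lerD.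
Qed.

Lemma bounded_measurable_cst c : bounded_measurable (fun _ : Omega => c).
Proof. by split; [exact: measurable_cst | exists `|c|]. Qed.

Lemma bounded_measurableM f g : bounded_measurable f -> bounded_measurable g ->
  bounded_measurable (fun x => f x * g x).
Proof.
move=> [mf [C fC]] [mg [D gD]]; split; first exact: measurable_funM.
by exists (C * D) => x; rewrite normrM ler_pM.
Qed.

Lemma bounded_measurable_sum (I : Type) (r : seq I) (F : I -> Omega -> R) :
  (forall i, bounded_measurable (F i)) ->
  bounded_measurable (fun x => \sum_(i <- r) F i x).
Proof.
move=> bF; elim: r => [|i r IH].
  under eq_fun do rewrite big_nil; exact: bounded_measurable_cst.
under eq_fun do rewrite big_cons; exact: bounded_measurableD.
Qed.

Lemma bounded_measurable_indic (A : set Omega) (c : R) : measurable A ->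
  bounded_measurable (fun x => c * \1_A x).
Proof.
move=> mA; apply: bounded_measurableM; first exact: bounded_measurable_cst.
split; first exact: measurable_indic.
by exists 1 => x; rewrite indicE; case: (_ \in _); rewrite ?normr1 ?normr0.
Qed.

Lemma mean_cst c : mean P (fun _ => c) = c.
Proof. by rewrite /mean [X in fine X](expectation_cst P c). Qed.

Lemma meanD f g : bounded_measurable f -> bounded_measurable g ->
  mean P (fun x => f x + g x) = mean P f + mean P g.
Proof.
by move=> bf bg; rewrite !meanE RintegralD//; exact: bounded_measurable_integrable.
Qed.

Lemma meanZ c f : bounded_measurable f ->
  mean P (fun x => c * f x) = c * mean P f.
Proof.
by move=> bf; rewrite !meanE RintegralZl//; exact: bounded_measurable_integrable.
Qed.

Lemma mean_le f g : bounded_measurable f -> bounded_measurable g ->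
  (forall x, f x <= g x) -> mean P f <= mean P g.
Proof.
move=> bf bg fg; rewrite !meanE le_Rintegral//;
 exact: bounded_measurable_integrable.
Qed.

Lemma mean_indic (A : set Omega) : measurable A -> mean P (\1_A) = fine (P A).
Proof. by move=> mA; rewrite /mean expectation_indic. Qed.

End BoundedMeasurable.

(** * Cylinder events over an index set and the pi-lambda theorem *)

Section Boxes.
Context {R : realType} {disp : measure_display} {Omega : measurableType disp}.
Variable P : probability Omega R.
Variables (I : choiceType) (T : I -> Type).
Implicit Types (s : seq I) (A : forall i, set (T i)) (J K : set I).

(** The sides are arbitrary sets of values, as in [mutually_independent]: each [T i] carries the
    discrete sigma-algebra. *)
Definition box s A : set (forall i, T i) :=
  [set x | forall i, i \in s -> A i (x i)].

Definition boxes J : set (set (forall i, T i)) :=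
  [set C | exists s A, [/\ uniq s, forall i, i \in s -> J i & C = box s A]].

(** The sigma-algebra lives on configurations rather than on [Omega], so that one event can be
    evaluated along two families of inputs, such as a family and its time shift. *)
Definition sig J : set (set (forall i, T i)) := <<s boxes J>>.

Definition tup (Z : forall i, Omega -> T i) (w : Omega) : forall i, T i :=
  fun i => Z i w.

Lemma sig_sigma_algebra J : sigma_algebra setT (sig J).
Proof. exact: smallest_sigma_algebra. Qed.

Lemma sig_sub J K : J `<=` K -> sig J `<=` sig K.
Proof.
move=> JK; apply: sub_sigma_algebra2 => C [s [A [us sJ ->]]].
by exists s, A; split => // i /sJ /JK.
Qed.

Lemma boxes_setI J : setI_closed (boxes J).
Proof.
move=> _ _ [s [A [us sJ ->]]] [s' [A' [us' sJ' ->]]].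
exists (undup (s ++ s')),
  (fun i => [set y | (i \in s -> A i y) /\ (i \in s' -> A' i y)]); split.
- exact: undup_uniq.
- by move=> i; rewrite mem_undup mem_cat => /orP[/sJ|/sJ'].
- apply/seteqP; split => x /=.
    by move=> [xA xA'] i _; split; [exact: xA | exact: xA'].
  move=> H; split => i si.
    have /H[h _] : i \in undup (s ++ s') by rewrite mem_undup mem_cat si.
    exact: h.
  have /H[_ h] : i \in undup (s ++ s') by rewrite mem_undup mem_cat si orbT.
  exact: h.
Qed.

Lemma sig_coord J i (B : set (T i)) : J i -> sig J [set x | B (x i)].
Proof.
move=> Ji; apply: sub_sigma_algebra.
(* A box needs a side at every index: [B] is transported along [j = i], and the other sides are
   full. *)
have [A AE] : exists A : forall j, set (T j), A i = B.
  exists (fun j => if pselect (j = i) is left e then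
                     eq_rect_r (fun k => set (T k)) B e else setT).
  by case: pselect => // e; rewrite (Prop_irrelevance e erefl).
exists [:: i], A; split => //.
  by move=> j; rewrite inE => /eqP ->.
apply/seteqP; split => x /=.
  by move=> Bx j; rewrite inE => /eqP ->; rewrite AE.
by move=> /(_ i); rewrite inE eqxx AE; apply.
Qed.

Variable Z : forall i, Omega -> T i.
Hypothesis mZ : forall i (A : set (T i)), measurable (Z i @^-1` A).
Hypothesis iZ : mutually_independent P Z.

Lemma tup_measurable J C : sig J C -> measurable (tup Z @^-1` C).
Proof.
move=> JC.
suff : sig J `<=` [set C | measurable (tup Z @^-1` C)] by apply.
apply: smallest_sub.
  split => /=.
  - by rewrite preimage_set0.
  - by move=> A mA; rewrite setTD preimage_setC; exact: measurableC.
  - move=> F mF; rewrite preimage_bigcup; exact: bigcup_measurable.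
move=> _ [s [A [us sJ ->]]] /=.
rewrite (_ : _ @^-1` _ = \big[setI/setT]_(i <- s) (Z i @^-1` A i)).
  exact: bigsetI_measurable.
rewrite -bigcap_seq; apply/seteqP; split => w /= H i /= si; exact: H.
Qed.

Lemma P_box s A : uniq s ->
  P (tup Z @^-1` box s A) = (\prod_(i <- s) P (Z i @^-1` A i))%E.
Proof.
move=> us.
have inj : injective (tnth (in_tuple s)) by exact/tuple_uniqP.
rewrite [RHS](big_tnth _ _ s).
have /= <- := iZ inj (fun k => A (tnth (in_tuple s) k)); congr (P _); apply/seteqP; split => w /=.
  by move=> H k; apply: H; exact: mem_tnth.
move=> H i si; have /tnthP[k ->] : i \in in_tuple s by [].
exact: H.
Qed.

Lemma box_indep J K s A s' A' : uniq s -> uniq s' ->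
  (forall i, i \in s -> J i) -> (forall i, i \in s' -> K i) ->
  J `&` K = set0 ->
  P (tup Z @^-1` (box s A `&` box s' A')) =
  (P (tup Z @^-1` box s A) * P (tup Z @^-1` box s' A'))%E.
Proof.
move=> us us' sJ sK JK.
have dis i : i \in s -> i \in s' -> False.
  by move=> /sJ Ji /sK Ki; suff : set0 i by []; rewrite -JK.
pose A'' i := if i \in s then A i else A' i.
have uss : uniq (s ++ s').
  rewrite cat_uniq us us' andbT /=; apply/hasPn => i si'; apply/negP => si.
  exact: dis si si'.
rewrite (_ : _ `&` _ = box (s ++ s') A'').
  rewrite !P_box// big_cat; congr (_ * _)%E; apply: eq_big_seq => i si.
    by rewrite /A'' si.
  by rewrite /A''; case: ifPn => // si'; case: (dis i).
apply/seteqP; split => x /=.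
  move=> [xs xs'] i; rewrite mem_cat /A''; case: ifP => //= si; last exact: xs'.
  by move=> _; exact: xs.
move=> H; split => i si.
  by have := H i; rewrite mem_cat si /A'' si; apply.
have := H i; rewrite mem_cat si orbT /A''; case: ifPn => [si'|_]; last exact.
by case: (dis i).
Qed.

(** The lambda half of the pi-lambda argument, with one event fixed. Membership in [sig J] is
    carried along because it supplies the measurability of the preimages. *)
Lemma dynkin_indep (J : set I) B : measurable B ->
  dynkin
   [set A | sig J A /\ P (tup Z @^-1` A `&` B) = (P (tup Z @^-1` A) * P B)%E].
Proof.
move=> mB; have [s0 sD sU] := sig_sigma_algebra J; split.
- split; first by rewrite -(setD0 setT); exact: sD.
  by rewrite preimage_setT setTI probability_setT mul1e.
- move=> A [sA PA]; have mA := tup_measurable sA.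
  split; first by rewrite -setTD; exact: sD.
  rewrite preimage_setC setIC -setDE measureD//; last first.
    by rewrite (le_lt_trans (probability_le1 _ _))// ltry.
  transitivity (P B - P (tup Z @^-1` A `&` B))%E; first by rewrite setIC.
  rewrite PA; transitivity (P (~` (tup Z @^-1` A)) * P B)%E; last by [].
  rewrite probability_setC// muleBl ?mul1e ?fin_num_measure//.
- move=> F tF H; split; first by apply: sU => n; case: (H n).
  have mF n : measurable (tup Z @^-1` F n) by have [/tup_measurable] := H n.
  rewrite preimage_bigcup setI_bigcupl.
  have tF1 : trivIset setT (fun n => tup Z @^-1` F n).
    by move=> i j _ _ [x [Fi Fj]]; apply: tF => //; exists (tup Z x).
  rewrite !measure_bigcup//=; last first.
  + by apply: trivIset_setIr.
  + by move=> n _; exact: measurableI.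
  rewrite -[P B]fineK ?fin_num_measure// muleC -nneseriesZl//.
  apply: eq_eseriesr => n _; case: (H n) => _ ->; rewrite muleC fineK// fin_num_measure//.
Qed.

(** Two passes of the pi-lambda theorem: [box_step] extends the first event from boxes to [sig J]
    against a fixed box, and then the second event is extended against a fixed element of
    [sig J]. *)
Lemma sig_indep J K (A B : set (forall i, T i)) : J `&` K = set0 -> sig J A -> sig K B ->
  P (tup Z @^-1` (A `&` B)) = (P (tup Z @^-1` A) * P (tup Z @^-1` B))%E.
Proof.
move=> JK sA sB.
have box_step C : boxes K C -> sig J `<=`
    [set A | sig J A /\
      P (tup Z @^-1` A `&` tup Z @^-1` C) = (P (tup Z @^-1` A) * P (tup Z @^-1` C))%E].
  move=> KC; apply: lambda_system_subset => //; first exact: boxes_setI.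
    apply/dynkin_lambda_system/dynkin_indep/(@tup_measurable K).
    exact: sub_sigma_algebra.
  move=> D JD; split; first exact: sub_sigma_algebra.
  move: JD KC => [s [A' [us sJ ->]]] [s' [B' [us' sK ->]]].
  by rewrite -preimage_setI (@box_indep J K).
suff : sig K `<=`
    [set B | sig K B /\
      P (tup Z @^-1` B `&` tup Z @^-1` A) = (P (tup Z @^-1` B) * P (tup Z @^-1` A))%E].
  by move=> /(_ _ sB)[_]; rewrite preimage_setI setIC muleC.
apply: lambda_system_subset => //; first exact: boxes_setI.
  by apply/dynkin_lambda_system/dynkin_indep/(tup_measurable sA).
move=> D KD; split; first exact: sub_sigma_algebra.
by have [_] := box_step _ KD _ sA; rewrite setIC muleC.
Qed.

End Boxes.

Section SameLaw.
Context {R : realType} {disp : measure_display} {Omega : measurableType disp}.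
Variable P : probability Omega R.
Variables (I : choiceType) (T : I -> Type) (Z Z' : forall i : I, Omega -> T i).
Hypothesis mZ : forall i (A : set (T i)), measurable (Z i @^-1` A).
Hypothesis mZ' : forall i (A : set (T i)), measurable (Z' i @^-1` A).
Hypothesis iZ : mutually_independent P Z.
Hypothesis iZ' : mutually_independent P Z'.
Hypothesis ZZ' : forall i (A : set (T i)), P (Z i @^-1` A) = P (Z' i @^-1` A).

Lemma sig_same_law J C : sig J C -> P (tup Z @^-1` C) = P (tup Z' @^-1` C).
Proof.
move=> sC.
suff : sig J `<=` [set C | sig J C /\ P (tup Z @^-1` C) = P (tup Z' @^-1` C)].
  by move=> /(_ _ sC)[].
apply: lambda_system_subset => //; first exact: boxes_setI.
  apply/dynkin_lambda_system; have [s0 sD sU] := @sig_sigma_algebra I T J; split.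
  - split; first by rewrite -(setD0 setT); exact: sD.
    by rewrite !preimage_setT.
  - move=> A [sA PA]; split; first by rewrite -setTD; exact: sD.
    transitivity (P (~` (tup Z @^-1` A))); first by [].
    transitivity (P (~` (tup Z' @^-1` A))); last by [].
    by rewrite !probability_setC ?PA//; exact: tup_measurable sA.
  - move=> F tF H; split; first by apply: sU => n; case: (H n).
    have mF n : measurable (tup Z @^-1` F n).
      by have [sF _] := H n; exact: tup_measurable sF.
    have mF' n : measurable (tup Z' @^-1` F n).
      by have [sF _] := H n; exact: tup_measurable sF.
    rewrite !preimage_bigcup.
    have tF1 (Y : forall i : I, Omega -> T i) :
        trivIset setT (fun n => tup Y @^-1` F n).
      by move=> i j _ _ [x [Fi Fj]]; apply: tF => //; exists (tup Y x).
    rewrite !measure_bigcup//=.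
    by apply: eq_eseriesr => n _; case: (H n).
move=> D JD; split; first exact: sub_sigma_algebra.
move: JD => [s [A [us sJ ->]]]; rewrite !P_box//.
by apply: eq_bigr => i _; exact: ZZ'.
Qed.

End SameLaw.

(** * Finitely-valued functions of a set of inputs *)

Section FiniteValued.
Context {R : realType}.
Variables (I : choiceType) (T : I -> Type).
Implicit Types (J K : set I) (f g : (forall i, T i) -> R).

(** Finitely many values replace the approximation by simple functions: whatever holds for events of
    [sig J] passes to [f] by a finite sum over its level sets. *)
Definition fin_valued J f :=
  (exists r : seq R, forall x, f x \in r) /\
  forall a, sig J (f @^-1` [set a]).

Lemma sig0 J : sig J (set0 : set (forall i, T i)).
Proof. by have [] := @sig_sigma_algebra I T J. Qed.

Lemma sigC J (A : set (forall i, T i)) : sig J A -> sig J (~` A).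
Proof.
have [_ sD _] := @sig_sigma_algebra I T J.
by rewrite -setTD; exact: sD.
Qed.

Lemma sig_bigcup J (A : (set (forall i, T i))^nat) :
  (forall n, sig J (A n)) -> sig J (\bigcup_n A n).
Proof. by have [_ _] := @sig_sigma_algebra I T J; exact. Qed.

Lemma sig_setT J : sig J (setT : set (forall i, T i)).
Proof. by rewrite -setC0; apply: sigC; exact: sig0. Qed.

Lemma sigU J (A B : set (forall i, T i)) :
  sig J A -> sig J B -> sig J (A `|` B).
Proof.
move=> sA sB; rewrite -bigcup2E; apply: sig_bigcup => -[|[|n]] //=.
exact: sig0.
Qed.

Lemma sigI J (A B : set (forall i, T i)) :
  sig J A -> sig J B -> sig J (A `&` B).
Proof.
move=> sA sB; rewrite -(setCK (A `&` B)) setCI.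
by apply: sigC; apply: sigU; exact: sigC.
Qed.

Lemma sig_setU_seq J (S : Type) (s : seq S) (F : S -> set (forall i, T i)) :
  (forall a, sig J (F a)) -> sig J (\big[setU/set0]_(a <- s) F a).
Proof.
move=> sF; elim: s => [|a s IH]; first by rewrite big_nil; exact: sig0.
by rewrite big_cons; exact: sigU.
Qed.

Lemma fin_valued_cst J c : fin_valued J (fun=> c).
Proof.
split; first by exists [:: c] => x; rewrite inE.
move=> a; have [->|ca] := eqVneq a c.
  rewrite (_ : _ @^-1` _ = setT); first exact: sig_setT.
  by apply/seteqP; split => x.
rewrite (_ : _ @^-1` _ = set0); first exact: sig0.
by apply/seteqP; split => x //= /esym /eqP; rewrite (negbTE ca).
Qed.

(** A level set of the result is a finite union over pairs of values, so [h] can be any function,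
    for instance an equality test or a Gaussian distribution function. *)
Lemma fin_valued_op2 J f g (h : R -> R -> R) : fin_valued J f ->
  fin_valued J g -> fin_valued J (fun x => h (f x) (g x)).
Proof.
move=> [[r fr] sf] [[q gq] sg]; split.
  exists [seq h a b | a <- r, b <- q] => x; exact/allpairs_f.
move=> c.
rewrite (_ : _ @^-1` _ = \big[setU/set0]_(ab <- [seq (a, b) | a <- r, b <- q])
   ((f @^-1` [set ab.1] `&` g @^-1` [set ab.2]) `&`
    (if h ab.1 ab.2 == c then setT else set0))).
  apply: sig_setU_seq => -[a b] /=; apply: sigI; first exact: sigI.
  by case: ifP => _; [exact: sig_setT | exact: sig0].
rewrite -bigcup_seq; apply/seteqP; split => x /=.
  move=> hc; exists (f x, g x); first exact/allpairs_f.
  by split => //=; rewrite hc eqxx.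
by move=> [[a b] /= _ [[-> ->]]]; case: ifP => // /eqP.
Qed.

Lemma fin_valued_op1 J f (h : R -> R) : fin_valued J f ->
  fin_valued J (fun x => h (f x)).
Proof. by move=> vf; exact: (fin_valued_op2 (fun a _ => h a) vf vf). Qed.

Lemma fin_valuedD J f g : fin_valued J f -> fin_valued J g ->
  fin_valued J (fun x => f x + g x).
Proof. exact: fin_valued_op2. Qed.

Lemma fin_valuedB J f g : fin_valued J f -> fin_valued J g ->
  fin_valued J (fun x => f x - g x).
Proof. exact: (fin_valued_op2 (fun a b => a - b)). Qed.

Lemma fin_valuedM J f g : fin_valued J f -> fin_valued J g ->
  fin_valued J (fun x => f x * g x).
Proof. exact: fin_valued_op2. Qed.

Lemma fin_valued_sum J (S : Type) (s : seq S) (p : pred S)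
    (F : S -> (forall i, T i) -> R) :
  (forall a, fin_valued J (F a)) ->
  fin_valued J (fun x => \sum_(a <- s | p a) F a x).
Proof.
move=> vF; elim: s => [|a s IH].
  under eq_fun do rewrite big_nil; exact: fin_valued_cst.
under eq_fun do rewrite big_cons.
by case: (p a) => //; exact: fin_valuedD.
Qed.

Lemma fin_valued_sub J K f : J `<=` K -> fin_valued J f -> fin_valued K f.
Proof. by move=> JK [rf sf]; split => // a; exact: (sig_sub JK). Qed.

Lemma fin_valued_indic J A : sig J A -> fin_valued J (\1_A).
Proof.
move=> sA; split.
  by exists [:: 0; 1] => x; rewrite indicE !inE; case: (_ \in _); rewrite eqxx ?orbT.
move=> a; rewrite (_ : _ @^-1` _ =
    (A `&` (if a == 1 then setT else set0)) `|`
    (~` A `&` (if a == 0 then setT else set0))).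
  apply: sigU; apply: sigI => //; try exact: sigC;
    by case: ifP => _; [exact: sig_setT | exact: sig0].
apply/seteqP; split => x /=.
  rewrite indicE; have [/set_mem Ax|/negP nAx] := boolP (x \in A) => <-.
    by left; rewrite eqxx.
  by right; rewrite eqxx; split => // Ax; apply: nAx; rewrite inE.
move=> [[Ax]|[Ax]]; case: eqP => // ->.
  by rewrite indicE mem_set.
by rewrite indicE memNset.
Qed.

Lemma fin_valued_coord J i (B : set (T i)) : J i ->
  fin_valued J (\1_[set x | B (x i)]).
Proof. by move=> Ji; apply: fin_valued_indic; exact: sig_coord. Qed.

(** [undup] ensures that exactly one level-set indicator is 1 at each point. The second argument of
    [h] stays free, so that [f] can be frozen while another function still varies. *)
Lemma fin_valued_decomp f (r : seq R) (h : R -> (forall i, T i) -> R) :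
  (forall x, f x \in r) -> (fun x => h (f x) x) =
  (fun x => \sum_(a <- undup r) \1_(f @^-1` [set a]) x * h a x).
Proof.
move=> fr; apply/funext => x.
have fxr : f x \in undup r by rewrite mem_undup.
rewrite (bigD1_seq (f x)) ?undup_uniq//= [X in _ + X]big1 ?addr0.
  by rewrite indicE mem_set// mul1r.
move=> a; rewrite indicE => aE; rewrite memNset ?mul0r//= => fa.
by rewrite fa eqxx in aE.
Qed.

End FiniteValued.

(** * Expectation as a functional on configurations *)

Section Expectation.
Context {R : realType} {disp : measure_display} {Omega : measurableType disp}.
Variable P : probability Omega R.
Variables (I : choiceType) (T : I -> Type) (Z : forall i : I, Omega -> T i).
Hypothesis mZ : forall i (A : set (T i)), measurable (Z i @^-1` A).
Hypothesis iZ : mutually_independent P Z.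
Implicit Types (J K : set I) (f g : (forall i, T i) -> R).

Definition E f : R := mean P (fun w => f (tup Z w)).

Lemma fin_valued_bounded J f : fin_valued J f ->
  bounded_measurable (fun w => f (tup Z w)).
Proof.
move=> [[r fr] sf].
have := fin_valued_decomp (fun a _ => a) fr => /= fE.
rewrite (_ : (fun w => _) = (fun w => \sum_(a <- undup r)
    a * \1_(tup Z @^-1` (f @^-1` [set a])) w)); last first.
  apply/funext => w; rewrite [LHS](congr1 (@^~ (tup Z w)) fE); apply: eq_bigr => a _; rewrite mulrC.
  by rewrite !indicE.
apply: bounded_measurable_sum => a; apply: bounded_measurable_indic.
exact: tup_measurable (sf a).
Qed.

Lemma E_cst c : E (fun=> c) = c.
Proof. exact: mean_cst. Qed.

Lemma E_add J K f g : fin_valued J f -> fin_valued K g ->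
  E (fun x => f x + g x) = E f + E g.
Proof.
move=> vf vg; rewrite /E meanD//; first exact: fin_valued_bounded vf.
exact: fin_valued_bounded vg.
Qed.

Lemma E_scale J c f : fin_valued J f -> E (fun x => c * f x) = c * E f.
Proof. by move=> vf; rewrite /E meanZ//; exact: fin_valued_bounded vf. Qed.

Lemma E_sub J K f g : fin_valued J f -> fin_valued K g ->
  E (fun x => f x - g x) = E f - E g.
Proof.
move=> vf vg; rewrite (_ : (fun x => _) = (fun x => f x + (-1) * g x)).
  rewrite (E_add vf (K := K)) ?(E_scale _ vg) ?mulN1r//.
  by apply: fin_valuedM => //; exact: fin_valued_cst.
by apply/funext => x; rewrite mulN1r.
Qed.

Lemma E_sum J (S : Type) (s : seq S) (p : pred S)
    (F : S -> (forall i, T i) -> R) :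
  (forall a, fin_valued J (F a)) ->
  E (fun x => \sum_(a <- s | p a) F a x) = \sum_(a <- s | p a) E (F a).
Proof.
move=> vF; elim: s => [|a s IH].
  by under eq_fun do rewrite big_nil; rewrite big_nil E_cst.
under eq_fun do rewrite big_cons; rewrite big_cons.
by case: (p a) => //; rewrite (E_add (vF a) (K := J)) ?IH//; exact: fin_valued_sum.
Qed.

Lemma E_le J K f g : fin_valued J f -> fin_valued K g ->
  (forall x, f x <= g x) -> E f <= E g.
Proof.
move=> vf vg fg; apply: mean_le => //; first exact: fin_valued_bounded vf.
exact: fin_valued_bounded vg.
Qed.

Lemma E_ge0 J f : fin_valued J f -> (forall x, 0 <= f x) -> 0 <= E f.
Proof.
move=> vf f0; rewrite -(E_cst 0); apply: (E_le (J := J) (K := J)) => //.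
exact: fin_valued_cst.
Qed.

Lemma E_norm J f : fin_valued J f -> `|E f| <= E (fun x => `|f x|).
Proof.
move=> vf; have va := fin_valued_op1 (fun a => `|a|) vf.
rewrite ler_norml -mulN1r -(E_scale _ va); apply/andP; split.
  apply: (E_le (J := J) (K := J)) => //.
    by apply: fin_valuedM => //; exact: fin_valued_cst.
  by move=> x; rewrite mulN1r lerNl -normrN ler_norm.
by apply: (E_le (J := J) (K := J)) => // x; exact: ler_norm.
Qed.

Lemma E_indic J A : sig J A -> E (\1_A) = fine (P (tup Z @^-1` A)).
Proof.
move=> sA; rewrite -mean_indic; first by congr mean; apply/funext => w; rewrite !indicE.
exact: tup_measurable sA.
Qed.

Lemma E_indicM J K A B : J `&` K = set0 -> sig J A -> sig K B ->
  E (fun x => \1_A x * \1_B x) = E (\1_A) * E (\1_B).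
Proof.
move=> JK sA sB; rewrite (E_indic sA) (E_indic sB).
rewrite (_ : (fun x => _) = \1_(A `&` B)); last first.
  by apply/funext => x; rewrite indicI.
rewrite (@E_indic setT); last by apply: sigI; [move: sA|move: sB]; exact: sig_sub.
rewrite (sig_indep mZ iZ JK sA sB) fineM//.
  by apply: fin_num_measure; exact: tup_measurable sA.
by apply: fin_num_measure; exact: tup_measurable sB.
Qed.

Lemma E_mul J K f g : J `&` K = set0 -> fin_valued J f -> fin_valued K g ->
  E (fun x => f x * g x) = E f * E g.
Proof.
move=> JK vf vg.
have indic_mul A : sig J A -> E (fun x => \1_A x * g x) = E (\1_A) * E g.
  move=> sA; case: (vg) => -[r gr] sg.
  have vA b : fin_valued K (fun x => \1_(g @^-1` [set b]) x * b).
    by apply: fin_valuedM; [exact: fin_valued_indic | exact: fin_valued_cst].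
  have gE := fin_valued_decomp (fun b _ => b) gr; rewrite /= in gE.
  rewrite [in RHS](_ : g = fun x => g x)// gE (E_sum _ _ vA) mulr_sumr.
  rewrite (_ : (fun x => _) = (fun x => \sum_(b <- undup r)
     (b * (\1_A x * \1_(g @^-1` [set b]) x)))); last first.
    apply/funext => x; rewrite [X in _ * X](congr1 (@^~ x) gE) mulr_sumr.
    by apply: eq_bigr => b _; rewrite [RHS]mulrC -mulrA.
  have vAb (b : R) : fin_valued setT (fun x => \1_A x * \1_(g @^-1` [set b]) x : R).
    apply: fin_valuedM; apply: fin_valued_indic; first exact: sig_sub sA.
    exact: sig_sub (sg b).
  rewrite (E_sum (J := setT)).
    apply: eq_bigr => b _; rewrite (E_scale _ (vAb b)) (E_indicM JK sA (sg b)).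
    rewrite mulrCA; congr (_ * _); rewrite -(E_scale (J := K)).
      by congr E; apply/funext => x; rewrite mulrC.
    exact: fin_valued_indic.
  by move=> b; apply: fin_valuedM => //; exact: fin_valued_cst.
case: (vf) => -[r fr] sf.
have fE := fin_valued_decomp (fun b _ => b) fr; rewrite /= in fE.
have vA b : fin_valued J (fun x => \1_(f @^-1` [set b]) x * b).
  by apply: fin_valuedM; [exact: fin_valued_indic | exact: fin_valued_cst].
rewrite [in RHS](_ : f = fun x => f x)// fE (E_sum _ _ vA) mulr_suml.
have := fin_valued_decomp (fun b x => b * g x) fr => /= ->.
have vAb b : fin_valued setT (fun x => \1_(f @^-1` [set b]) x * g x).
  apply: fin_valuedM; last exact: fin_valued_sub vg.
  by apply: fin_valued_indic; exact: sig_sub (sf b).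
rewrite (_ : (fun x => _) = (fun x => \sum_(b <- undup r)
     (b * (\1_(f @^-1` [set b]) x * g x)))); last first.
  by apply/funext => x; apply: eq_bigr => b _; rewrite mulrCA.
rewrite (E_sum (J := setT)).
  apply: eq_bigr => b _; rewrite (E_scale _ (vAb b)) (indic_mul _ (sf b)).
  rewrite mulrA; congr (_ * _); rewrite -(E_scale (J := J)).
    by congr E; apply/funext => x; rewrite mulrC.
  exact: fin_valued_indic.
by move=> b; apply: fin_valuedM => //; exact: fin_valued_cst.
Qed.

Lemma E_replace J K f g (h : R -> R -> R) (k : R -> R) c : J `&` K = set0 ->
  fin_valued J f -> fin_valued K g ->
  (forall a, `|E (fun x => h a (g x)) - k a| <= c) ->
  `|E (fun x => h (f x) (g x)) - E (fun x => k (f x))| <= c.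
Proof.
move=> JK vf vg H.
have fv1 (L : set I) e : fin_valued L e -> fin_valued setT e by exact: fin_valued_sub.
case: (vf) => -[r fr] sf.
have vI b : fin_valued J (\1_(f @^-1` [set b]) : _ -> R) by exact: fin_valued_indic.
have vh b : fin_valued K (fun x => h b (g x)) by exact: fin_valued_op1.
have := fin_valued_decomp (fun b x => h b (g x)) fr => /= ->.
have := fin_valued_decomp (fun b x => k b) fr => /= ->.
rewrite (E_sum (J := setT)); last by move=> b; apply: fin_valuedM; exact: fv1.
rewrite (E_sum (J := J)); last first.
  by move=> b; apply: fin_valuedM => //; exact: fin_valued_cst.
have sum1 : \sum_(b <- undup r) E (\1_(f @^-1` [set b])) = 1.
  rewrite -(E_sum _ _ vI) -[RHS](E_cst 1); congr E.
  have := fin_valued_decomp (fun b _ => 1) fr => /= ->.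
  by apply/funext => x; apply: eq_bigr => b _; rewrite mulr1.
rewrite -sumrB.
apply: (le_trans (ler_norm_sum _ _ _)).
rewrite -[leRHS]mul1r -sum1 mulr_suml; apply: ler_sum => b _.
rewrite (E_mul JK (vI b) (vh b)).
rewrite (_ : E (fun x => _ x * k b) = E (\1_(f @^-1` [set b])) * k b); last first.
  rewrite mulrC -(E_scale (J := J))//.
  by congr E; apply/funext => x; rewrite mulrC.
rewrite -mulrBr normrM ger0_norm; last first.
  by apply: (E_ge0 (vI b)) => x; rewrite indicE.
apply: ler_wpM2l => //.
by apply: (E_ge0 (vI b)) => x; rewrite indicE.
Qed.

End Expectation.

Section ExpectationSameLaw.
Context {R : realType} {disp : measure_display} {Omega : measurableType disp}.
Variable P : probability Omega R.
Variables (I : choiceType) (T : I -> Type) (Z Z' : forall i : I, Omega -> T i).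
Hypothesis mZ : forall i (A : set (T i)), measurable (Z i @^-1` A).
Hypothesis mZ' : forall i (A : set (T i)), measurable (Z' i @^-1` A).
Hypothesis iZ : mutually_independent P Z.
Hypothesis iZ' : mutually_independent P Z'.
Hypothesis ZZ' : forall i (A : set (T i)), P (Z i @^-1` A) = P (Z' i @^-1` A).

Lemma E_same_law (J : set I) (f : (forall i, T i) -> R) :
  fin_valued J f -> E P Z f = E P Z' f.
Proof.
move=> [[r fr] sf].
have vI b : fin_valued J (fun x => b * (\1_(f @^-1` [set b]) x : R)).
  by apply: fin_valuedM; [exact: fin_valued_cst | exact: fin_valued_indic].
have fE : f = (fun x => \sum_(b <- undup r) b * \1_(f @^-1` [set b]) x).
  rewrite -[LHS]/(fun x => f x); have := fin_valued_decomp (fun a _ => a) fr => /= ->.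
  by apply/funext => x; apply: eq_bigr => b _; rewrite mulrC.
rewrite fE (@E_sum _ _ _ P _ _ _ mZ J)// (@E_sum _ _ _ P _ _ _ mZ' J)//.
apply: eq_bigr => b _.
have v1 : fin_valued J (\1_(f @^-1` [set b]) : _ -> R) by exact: fin_valued_indic.
rewrite (E_scale _ mZ _ v1) (E_scale _ mZ' _ v1).
rewrite (E_indic P mZ (sf b)) (E_indic P mZ' (sf b)); congr (_ * fine _).
exact: sig_same_law (sf b).
Qed.

End ExpectationSameLaw.

(** * The standard normal distribution function *)

Section TaylorBounds.
Context {R : realType}.
Implicit Types (f df ddf dddf g : R -> R) (K x z k : R).

(** The mean value theorem loses the factor 1/(n+1) that integration would give. Constants are
    immaterial here, and iterating on remainders yields the Taylor bounds. *)
Lemma norm_le_pow_of_derive g dg K n :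
  (forall x, is_derive x (1 : R) g (dg x)) -> g 0 = 0 ->
  (forall x, `|dg x| <= K * `|x| ^+ n) -> forall x, `|g x| <= K * `|x| ^+ n.+1.
Proof.
move=> gD g0 dgK x.
have cg : continuous g.
  by move=> y; apply/differentiable_continuous/derivable1_diffP; case: (gD y).
have K0 : 0 <= K.
  by have := le_trans (normr_ge0 _) (dgK 1); rewrite normr1 expr1n mulr1.
have bound c : `|c| <= `|x| -> `|dg c * x| <= K * `|x| ^+ n.+1.
  move=> cx; rewrite normrM exprSr mulrA ler_wpM2r//.
  by rewrite (le_trans (dgK c))// ler_wpM2l// lerXn2r// nnegrE.
have [x0|x0] := leP 0 x.
  have [c] := MVT_segment x0 (fun y _ => gD y) (continuous_subspaceT cg).
  rewrite in_itv/= g0 !subr0 => /andP[c0 cx] ->.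
  by apply: bound; rewrite !ger0_norm.
have [c] := MVT_segment (ltW x0) (fun y _ => gD y) (continuous_subspaceT cg).
rewrite in_itv/= g0 sub0r => /andP[xc c0] /eqP; rewrite eqr_oppLR => /eqP ->.
rewrite sub0r mulrN opprK; apply: bound.
by rewrite !ler0_norm ?lerN2// ltW.
Qed.

Lemma is_derive_shift f df z x : (forall y, is_derive y (1 : R) f (df y)) ->
  is_derive x (1 : R) (fun k => f (z + k)) (df (z + x)).
Proof.
move=> fD.
have zD : is_derive x (1 : R) (fun k : R => z + k) 1.
  by apply: is_derive_eq; rewrite add0r mulr1.
have fz := fD (z + x).
have := @is_derive1_comp R f (fun k => z + k) x _ _ fz zD.
by rewrite mulr1.
Qed.

Lemma taylor2 f df ddf K : (forall x, is_derive x (1 : R) f (df x)) ->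
  (forall x, is_derive x (1 : R) df (ddf x)) -> (forall x, `|ddf x| <= K) ->
  forall z k, `|f (z + k) - f z - df z * k| <= K * `|k| ^+ 2.
Proof.
move=> fD dfD dK z k.
have H1 y : `|df (z + y) - df z| <= K * `|y| ^+ 1.
  apply: (@norm_le_pow_of_derive (fun y => df (z + y) - df z)
    (fun y => ddf (z + y)) K 0) => [x||x].
  - have D := is_derive_shift z x dfD.
    by apply: is_derive_eq; rewrite subr0.
  - by rewrite addr0 subrr.
  - by rewrite expr0 mulr1.
apply: (@norm_le_pow_of_derive (fun y => f (z + y) - f z - df z * y)
  (fun y => df (z + y) - df z) K 1) => [x||//].
- have D := is_derive_shift z x fD.
  by apply: is_derive_eq; rewrite subr0 /GRing.scale/= mulr1.
- by rewrite addr0 subrr mulr0 subr0.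
Qed.

Lemma taylor3 f df ddf dddf K : (forall x, is_derive x (1 : R) f (df x)) ->
  (forall x, is_derive x (1 : R) df (ddf x)) ->
  (forall x, is_derive x (1 : R) ddf (dddf x)) -> (forall x, `|dddf x| <= K) ->
  forall z k,
    `|f (z + k) - f z - df z * k - 2^-1 * ddf z * k ^+ 2| <= K * `|k| ^+ 3.
Proof.
move=> fD dfD ddfD dK z k.
apply: (@norm_le_pow_of_derive
  (fun y => f (z + y) - f z - df z * y - 2^-1 * ddf z * y ^+ 2)
  (fun y => df (z + y) - df z - ddf z * y) K 2) => [x||x].
- have D := is_derive_shift z x fD.
  by apply: is_derive_eq; rewrite /GRing.scale/=; field.
- by rewrite addr0 subrr !mulr0 expr0n mulr0 !subr0.
- exact: taylor2.
Qed.

End TaylorBounds.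

Section StandardNormal.
Context {R : realType}.
Implicit Types (x y z k : R).

Definition stdphi x : R := normal_peak 1 * expR (- 2^-1 * x ^+ 2).

Definition stdPhi x : R := fine (@normal_prob R 0 1 `]-oo, x]).

Lemma stdphiE : @normal_pdf R 0 1 = stdphi.
Proof.
apply/funext => x; rewrite normal_pdfE ?oner_neq0// /normal_fun /stdphi.
by congr (_ * expR _); rewrite subr0 expr1n; field.
Qed.

Lemma stdPhiE x : (stdPhi x)%:E = @normal_prob R 0 1 `]-oo, x].
Proof. by rewrite fineK// fin_num_measure. Qed.

Lemma stdphi_ge0 x : 0 <= stdphi x.
Proof. by rewrite mulr_ge0 ?normal_peak_ge0 ?expR_ge0. Qed.

Lemma normal_peak1_le1 : normal_peak 1 <= 1 :> R.
Proof.
rewrite invf_le1 ?sqrtr_gt0.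
  rewrite -{1}[1]sqrtr1 ler_wsqrtr// expr1n mul1r.
  by have := pihalf_ge1 R; lra.
by rewrite mulrn_wgt0// mulr_gt0 ?pi_gt0// exprn_even_gt0.
Qed.

Lemma is_derive_stdPhi x : is_derive x (1 : R) stdPhi (stdphi x).
Proof.
have int u : lebesgue_measure.-integrable [set` Interval -oo%O (BRight u)]
    (EFin \o stdphi).
  apply: (@integrableS _ _ _ _ setT) => //.
  by rewrite -stdphiE; exact: integrable_normal_pdf.
have [|||D1 D2] := @continuous_FTC1 R stdphi -oo%O x (x + 1) _ (int _).
- by rewrite ltrDl.
- by rewrite ltNyr.
- by rewrite -stdphiE; apply: continuous_normal_pdf; rewrite oner_neq0.
have -> : stdPhi = (fun x => \int[lebesgue_measure]_(t in [set` `]-oo, x]]) stdphi t)%R.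
  by apply/funext => y; rewrite /stdPhi /normal_prob -stdphiE.
by rewrite derive1E in D2; exact: DeriveDef D1 D2.
Qed.

Lemma is_derive_stdphi x : is_derive x (1 : R) stdphi (- x * stdphi x).
Proof.
have D : is_derive x (1 : R) (fun y : R => - 2^-1 * y ^+ 2) (- x).
  by apply: is_derive_eq; rewrite /GRing.scale/=; field.
have := @is_derive1_comp R expR (fun y => - 2^-1 * y ^+ 2) x _ _ (is_derive_expR _) D.
move=> D2; have D3 := @is_deriveZ R _ _ _ (normal_peak 1) x 1 _ D2.
by apply: is_derive_eq D3 _; rewrite /GRing.scale/= /stdphi; ring.
Qed.

Lemma is_derive_Nstdphi x :
  is_derive x (1 : R) (fun x => - x * stdphi x) ((x ^+ 2 - 1) * stdphi x).
Proof.
have D := is_derive_stdphi x.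
by apply: is_derive_eq; rewrite /GRing.scale/=; ring.
Qed.

Lemma poly4_stdphi_le x : (1 + x ^+ 4) * stdphi x <= 8.
Proof.
(* From exp h >= 1 + h^2/2 at h = x^2/2, whose quadratic term is x^4/8. *)
have e1 : 1 + x ^+ 4 <= 8 * expR (2^-1 * x ^+ 2).
  have h : 0 <= 2^-1 * x ^+ 2 by rewrite mulr_ge0// sqr_ge0.
  have := expR_ge1Dxn 1 h; rewrite (_ : 2`! = 2)%N// exprMn -exprM => H.
  have := exprn_even_ge0 x (isT : ~~ odd 4); lra.
have e2 : stdphi x <= (expR (2^-1 * x ^+ 2))^-1.
  by rewrite /stdphi mulNr expRN ler_piMl ?normal_peak1_le1// invr_ge0 expR_ge0.
have e0 : 0 < expR (2^-1 * x ^+ 2) by exact: expR_gt0.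
apply: (@le_trans _ _ (8 * expR (2^-1 * x ^+ 2) * (expR (2^-1 * x ^+ 2))^-1)).
  by rewrite ler_pM// ?stdphi_ge0// addr_ge0// exprn_even_ge0.
by rewrite mulfK// gt_eqF.
Qed.

(** The common source of the constant 16: the derivatives that have to be bounded are polynomials of
    degree at most 3 times the density. *)
Lemma poly_stdphi_bound (p : R -> R) x : `|p x| <= 2 * (1 + x ^+ 4) ->
  `|p x * stdphi x| <= 16.
Proof.
move=> px; rewrite normrM (ger0_norm (stdphi_ge0 x)).
have := poly4_stdphi_le x; have := stdphi_ge0 x; have := normr_ge0 (p x).
nra.
Qed.

Lemma stdPhi_taylor z k :
  `|stdPhi (z + k) - stdPhi z - stdphi z * k + 2^-1 * (z * stdphi z) * k ^+ 2|
  <= 16 * `|k| ^+ 3.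
Proof.
have := @taylor3 R stdPhi stdphi (fun x => - x * stdphi x)
  (fun x => (x ^+ 2 - 1) * stdphi x) 16 is_derive_stdPhi is_derive_stdphi
  is_derive_Nstdphi _ z k.
rewrite !mulNr mulrN mulNr opprK; apply => x.
apply: (poly_stdphi_bound (p := fun x => x ^+ 2 - 1)).
rewrite (_ : x ^+ 4 = (x ^+ 2) ^+ 2); last by rewrite -exprM.
have := sqr_ge0 x; set t := x ^+ 2; move=> t0.
by rewrite ler_norml; apply/andP; split; nra.
Qed.

(** Logarithmic coordinates for the standard deviation: along w = a exp(-t) one has w' = -w, so the
    first two derivatives in t are -w and w - w^3 times the density at w. They are bounded uniformly
    in [a], which would fail for derivatives in the variance itself. *)
Lemma stdPhi_heat a t r :
  `|stdPhi (a * expR (- (t + r))) - stdPhi (a * expR (- t))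
    + (a * expR (- t)) * stdphi (a * expR (- t)) * r| <= 16 * `|r| ^+ 2.
Proof.
have De s : is_derive s (1 : R) (fun s : R => a * expR (- s)) (- (a * expR (- s))).
  have D0 : is_derive s (1 : R) (fun s : R => - s) (-1) by apply: is_derive_eq.
  have := @is_derive1_comp R expR (fun s => - s) s _ _ (is_derive_expR _) D0.
  move=> D1; have D2 := @is_deriveZ R _ _ _ a s 1 _ D1.
  by apply: is_derive_eq D2 _; rewrite /GRing.scale/=; ring.
have D1 s : is_derive s (1 : R) (fun s : R => stdPhi (a * expR (- s)))
    (- (a * expR (- s)) * stdphi (a * expR (- s))).
  have := @is_derive1_comp R stdPhi (fun s => a * expR (- s)) s _ _
    (is_derive_stdPhi _) (De s).
  by move=> D; apply: is_derive_eq D _; rewrite mulrC.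
have D2 s : is_derive s (1 : R)
   (fun s : R => - (a * expR (- s)) * stdphi (a * expR (- s)))
   ((a * expR (- s) - (a * expR (- s)) ^+ 3) * stdphi (a * expR (- s))).
  have := @is_derive1_comp R (fun x => - x * stdphi x) (fun s => a * expR (- s)) s _ _
    (is_derive_Nstdphi _) (De s).
  by move=> D; apply: is_derive_eq D _; ring.
have := taylor2 D1 D2 (K := 16) _ t r.
rewrite !mulNr opprK; apply => x; set w := a * expR (- x).
apply: (poly_stdphi_bound (p := fun w => w - w ^+ 3)).
have h : 0 <= (w ^+ 2 - 1) ^+ 2 by exact: sqr_ge0.
have h1 : 0 <= (w ^+ 2 - w) ^+ 2 by exact: sqr_ge0.
have h2 : 0 <= (w ^+ 2 + w) ^+ 2 by exact: sqr_ge0.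
have h3 : 0 <= (w - 1) ^+ 2 by exact: sqr_ge0.
have h4 : 0 <= (w + 1) ^+ 2 by exact: sqr_ge0.
by rewrite ler_norml; apply/andP; split; nra.
Qed.

(* The probability that [x] plus a centred Gaussian of variance [V] is at most
   [y]: it solves the heat equation [dV = dxx / 2]. *)
Definition gauss_below V y x : R := stdPhi ((y - x) / Num.sqrt V).

Lemma gauss_below_taylor (V y x h : R) : 0 < V ->
  forall z, z = (y - x) / Num.sqrt V ->
  `|gauss_below V y (x + h) - gauss_below V y x + stdphi z / Num.sqrt V * h
    + 2^-1 * (z * stdphi z) / V * h ^+ 2| <= 16 / Num.sqrt V ^+ 3 * `|h| ^+ 3.
Proof.
move=> V0 z zE; have sV : 0 < Num.sqrt V by rewrite sqrtr_gt0.
have := stdPhi_taylor z (- h / Num.sqrt V).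
rewrite /gauss_below (_ : (y - (x + h)) / Num.sqrt V = z + (- h / Num.sqrt V)); last first.
  by rewrite zE; field; rewrite gt_eqF.
rewrite -zE expr_div_n sqrrN sqr_sqrtr ?(ltW V0)//.
rewrite normrM normrN normfV (ger0_norm (ltW sV)) exprMn exprVn.
rewrite (_ : stdPhi _ - _ - _ + _ = stdPhi (z + - h / Num.sqrt V) - stdPhi z +
    stdphi z / Num.sqrt V * h + 2^-1 * (z * stdphi z) / V * h ^+ 2); last by ring.
by move/le_trans; apply; rewrite mulrA mulrAC.
Qed.

Lemma gauss_below_heat (V v y x : R) : 0 < V -> 0 <= v ->
  forall z, z = (y - x) / Num.sqrt V ->
  `|gauss_below (V + v) y x - gauss_below V y x + 2^-1 * (z * stdphi z) / V * v|
  <= 12 * (v / V) ^+ 2.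
Proof.
move=> V0 v0 z zE.
(* In logarithmic coordinates the passage from V to V + v is the translation from t to t + r. *)
pose t := 2^-1 * ln V; pose r := 2^-1 * ln (1 + v / V).
have vV0 : 0 <= v / V by rewrite divr_ge0// ltW.
have sqrtE (W : R) : 0 < W -> (Num.sqrt W)^-1 = expR (- (2^-1 * ln W)).
  move=> W0; rewrite expRN; congr _^-1.
  apply/eqP; rewrite -(@eqrXn2 _ 2)// ?sqrtr_ge0 ?expR_ge0//.
  rewrite sqr_sqrtr ?(ltW W0)// expr2 -expRD -[W in X in X == _]lnK ?posrE//.
  by apply/eqP; congr expR; field.
have VvE : V + v = V * (1 + v / V) by field; rewrite gt_eqF.
have e1 : (Num.sqrt (V + v))^-1 = expR (- (t + r)).
  by rewrite sqrtE ?VvE ?lnM ?posrE ?ltr_wpDr// -?mulrDr// mulr_gt0 ?ltr_wpDr.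
have e2 : (Num.sqrt V)^-1 = expR (- t) by rewrite sqrtE.
have := stdPhi_heat (y - x) t r.
rewrite /gauss_below e1 -e2 -zE => H.
have zb : `|z * stdphi z| <= 16.
  apply: (poly_stdphi_bound (p := id)).
  have h : 0 <= (z ^+ 2 - 1) ^+ 2 by exact: sqr_ge0.
  have h3 : 0 <= (z - 1) ^+ 2 by exact: sqr_ge0.
  have h4 : 0 <= (z + 1) ^+ 2 by exact: sqr_ge0.
  by rewrite ler_norml; apply/andP; split; nra.
have rle : 0 <= r <= 2^-1 * (v / V).
  rewrite /r; apply/andP; split; first by rewrite mulr_ge0// ln_ge0// lerDl.
  by rewrite ler_wpM2l// le_ln1Dx// (lt_le_trans _ vV0)// ltrN10.
(* With q = v / V: ln (1 + q) >= 1 - 1/(1 + q) >= q - q^2. *)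
have rge : 2^-1 * (v / V) - r <= 2^-1 * (v / V) ^+ 2.
  have h1 : 0 < 1 + v / V by rewrite ltr_wpDr.
  have : ln (1 + v / V)^-1 <= (1 + v / V)^-1 - 1.
    rewrite -[X in ln X](subrK 1) addrC le_ln1Dx// ltrBrDr addNr invr_gt0//.
  rewrite lnV ?posrE// => H2.
  have H3 : v / V - (v / V) ^+ 2 <= 1 - (1 + v / V)^-1.
    rewrite -subr_ge0 (_ : _ - _ = (v / V) ^+ 3 / (1 + v / V)).
      by rewrite divr_ge0 ?exprn_ge0// ltW.
    by move: (v / V) h1 => q h1; field; rewrite gt_eqF.
  by rewrite /r; lra.
set q := v / V in vV0 rle rge *.
rewrite (_ : 2^-1 * (z * stdphi z) / V * v = (z * stdphi z) * (2^-1 * q)); last first.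
  by rewrite /q; ring.
rewrite [X in `|X|](_ : _ = (stdPhi ((y - x) * expR (- (t + r))) - stdPhi z +
    z * stdphi z * r) + z * stdphi z * (2^-1 * q - r)); last by ring.
apply: (le_trans (ler_normD _ _)).
(* The first part is the quadratic remainder with r <= q/2; the second pays for replacing r by q/2
   in the linear term. *)
have -> : 12 * q ^+ 2 = 16 * (2^-1 * q) ^+ 2 + 16 * (2^-1 * q ^+ 2) by field.
case/andP: rle => r0 rq; apply: lerD.
  apply: (le_trans H); rewrite ler_wpM2l// ger0_norm// lerXn2r// nnegrE//.
  by rewrite mulr_ge0.
rewrite normrM ler_pM//.
by rewrite ger0_norm// subr_ge0.
Qed.

Lemma stdPhi_ge0 x : 0 <= stdPhi x.
Proof. exact: fine_ge0. Qed.

Lemma stdPhi_le1 x : stdPhi x <= 1.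
Proof. by rewrite -lee_fin stdPhiE probability_le1. Qed.

Lemma stdPhi_nd x y : x <= y -> stdPhi x <= stdPhi y.
Proof.
move=> xy; rewrite -lee_fin !stdPhiE; apply: le_measure; rewrite ?inE//.
by move=> z /=; rewrite !in_itv/= => /le_trans; exact.
Qed.

Lemma continuous_stdPhi : continuous (stdPhi : R -> R).
Proof.
move=> y; apply/differentiable_continuous/derivable1_diffP.
by case: (is_derive_stdPhi y).
Qed.

Lemma stdPhi_lipschitz x y : `|stdPhi x - stdPhi y| <= 16 * `|x - y|.
Proof.
have c k : `|stdPhi (y + k) - stdPhi y| <= 16 * `|k| ^+ 1.
  apply: (@norm_le_pow_of_derive _ (fun k => stdPhi (y + k) - stdPhi y)
    (fun k => stdphi (y + k)) 16 0) => [z||z].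
  - have D := is_derive_shift y z is_derive_stdPhi.
    by apply: is_derive_eq; rewrite subr0.
  - by rewrite addr0 subrr.
  - rewrite expr0 mulr1 -[X in `|X|]mul1r.
    apply: (poly_stdphi_bound (p := fun=> 1)); rewrite normr1.
    have := exprn_even_ge0 (y + z) (isT : ~~ odd 4); lra.
by have := c (x - y); rewrite expr1 [y + _]addrC subrK.
Qed.

Let idR : measurableTypeR R -> R := idfun.

#[local] HB.instance Definition _ :=
  @isMeasurableFun.Build _ _ _ _ idR (@measurable_id _ _ setT).

Lemma stdPhi_cdf : stdPhi = fine \o cdf (idR : {RV (@normal_prob R 0 1) >-> R}).
Proof. by []. Qed.

Lemma cvg_stdPhi_y : stdPhi x @[x --> +oo] --> (1 : R).
Proof.
by rewrite stdPhi_cdf; apply: fine_cvg; exact: cvg_cdfy1.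
Qed.

Lemma cvg_stdPhi_Ny : stdPhi x @[x --> -oo] --> (0 : R).
Proof.
by rewrite stdPhi_cdf; apply: fine_cvg; exact: cvg_cdfNy0.
Qed.

End StandardNormal.

(** * Removal of the Gaussian smoothing *)

Section Smoothing.
Context {R : realType} {disp : measure_display} {Omega : measurableType disp}.
Variable P : probability Omega R.
Variable W : nat -> Omega -> R.
Hypothesis mW : forall n, measurable_fun setT (W n).
Hypothesis smoothed : forall y s : R, 0 < s ->
  mean P (fun w => stdPhi ((y - W n w) / s)) @[n --> \oo]
    --> stdPhi (y / Num.sqrt (1 + s ^+ 2)).

Let bm_smoothed n y s : bounded_measurable (fun w => stdPhi ((y - W n w) / s)).
Proof.
split.
  apply: measurableT_comp.
    by apply: nondecreasing_measurable => // a b; exact: stdPhi_nd.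
  apply: measurable_funM => //; exact: measurable_funB.
by exists 1 => w; rewrite ger0_norm ?stdPhi_ge0 ?stdPhi_le1.
Qed.

Let mle n x : measurable [set w | W n w <= x].
Proof.
rewrite (_ : [set _ | _] = setT `&` W n @^-1` `]-oo, x]); first exact: mW.
by rewrite setTI; apply/seteqP; split => w /=; rewrite in_itv.
Qed.

Let bm_indic n x : bounded_measurable (\1_[set w | W n w <= x] : _ -> R).
Proof.
rewrite (_ : \1_ _ = fun w => 1 * \1_[set w | W n w <= x] w).
  exact: bounded_measurable_indic.
by apply/funext => w; rewrite mul1r.
Qed.

(** On the event the smoothed value is at least Phi(eta/s), so 1 - Phi(eta/s) completes it to 1. The
    bound [lower] is the mirror image: off the event the smoothed value is at most Phi(-eta/s). *)
Let upper n x eta s : 0 < s ->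
  fine (P [set w | W n w <= x]) <=
  mean P (fun w => stdPhi ((x + eta - W n w) / s)) + (1 - stdPhi (eta / s)).
Proof.
move=> s0; rewrite -mean_indic// -[X in _ + X](mean_cst P) -meanD//; last first.
  exact: bounded_measurable_cst.
apply: mean_le => //.
  by apply: bounded_measurableD; [exact: bm_smoothed | exact: bounded_measurable_cst].
move=> w; rewrite indicE; have [Wx|_] := boolP (w \in _); last first.
  by rewrite addr_ge0 ?stdPhi_ge0// subr_ge0 stdPhi_le1.
rewrite addrCA lerDl subr_ge0; apply: stdPhi_nd.
by rewrite ler_pM2r ?invr_gt0//; move: Wx; rewrite inE/=; lra.
Qed.

Let lower n x eta s : 0 < s ->
  mean P (fun w => stdPhi ((x - eta - W n w) / s)) - stdPhi (- eta / s) <=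
  fine (P [set w | W n w <= x]).
Proof.
move=> s0; rewrite lerBlDr -mean_indic// -[stdPhi (- eta / s)](mean_cst P) -meanD//; last first.
  exact: bounded_measurable_cst.
apply: mean_le => //.
  by apply: bounded_measurableD => //; exact: bounded_measurable_cst.
move=> w; rewrite indicE; have [Wx|] := boolP (w \in _).
  by rewrite ler_wpDr ?stdPhi_ge0 ?stdPhi_le1.
rewrite notin_setE/= => /negP; rewrite -ltNge => Wx.
rewrite add0r; apply: stdPhi_nd.
by rewrite ler_pM2r ?invr_gt0//; lra.
Qed.

Lemma cvg_cdf_of_smoothed x :
  P [set w | W n w <= x] @[n --> \oo] --> @normal_prob R 0 1 `]-oo, x].
Proof.
rewrite -stdPhiE.
rewrite (_ : (fun n => _) = EFin \o (fun n => fine (P [set w | W n w <= x]))); last first.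
  by apply/funext => n /=; rewrite fineK// fin_num_measure.
apply: cvg_EFin; first by apply: nearW => n.
apply/cvgrPdist_le => e e0.
have e4 : 0 < e / 4 by rewrite divr_gt0.
have cu (sg : R) : stdPhi ((x + sg * h) / Num.sqrt (1 + (h ^+ 2) ^+ 2))
    @[h --> 0^'+] --> stdPhi x.
  apply: cvg_at_right_filter.
  rewrite [X in _ --> X](_ : _ =
    stdPhi ((x + sg * 0) / Num.sqrt (1 + (0 ^+ 2) ^+ 2))); last first.
    by rewrite mulr0 addr0 !expr0n/= addr0 sqrtr1 divr1.
  apply: (continuous_comp (f := fun h => (x + sg * h) / Num.sqrt (1 + (h ^+ 2) ^+ 2))
    (g := stdPhi)); last exact: continuous_stdPhi.
  apply: cvgM.
    by apply: cvgD; [exact: cvg_cst | apply: cvgM; [exact: cvg_cst | exact: cvg_id]].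
  apply: cvgV; first by rewrite !expr0n/= addr0 sqrtr1 oner_neq0.
  apply: (continuous_comp (f := fun h : R => 1 + (h ^+ 2) ^+ 2) (g := Num.sqrt)).
    apply: cvgD; first exact: cvg_cst.
    apply: (@continuous_comp _ _ _ (fun h : R => h ^+ 2) (fun h : R => h ^+ 2));
      exact: exprn_continuous.
  exact: sqrt_continuous.
have [M [_ HM]] : \forall z \near +oo, `|1 - stdPhi z| <= e / 4.
  by have /cvgrPdist_le := @cvg_stdPhi_y R; apply.
have [M' [_ HM']] : \forall z \near -oo, `|0 - stdPhi z| <= e / 4.
  by have /cvgrPdist_le := @cvg_stdPhi_Ny R; apply.
have /cvgrPdist_le /(_ _ e4) cu1 := cu 1.
have /cvgrPdist_le /(_ _ e4) cu2 := cu (-1).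
have [eta [eta0 U1 U2 etaM]] : exists eta : R, [/\ 0 < eta,
    `|stdPhi x - stdPhi ((x + 1 * eta) / Num.sqrt (1 + (eta ^+ 2) ^+ 2))| <= e / 4,
    `|stdPhi x - stdPhi ((x + -1 * eta) / Num.sqrt (1 + (eta ^+ 2) ^+ 2))| <= e / 4 &
    eta < (1 + `|M| + `|M'|)^-1].
  near (0 : R)^'+ => h; exists h; split.
  - by near: h; exact: nbhs_right_gt.
  - by near: h.
  - by near: h.
  - by near: h; apply: nbhs_right_lt; rewrite invr_gt0 ltr_pwDl// addr_gt0.
(* With s = eta^2 the shift and the smoothing both vanish while eta/s = 1/eta tends to infinity. The
   last condition on [eta] pushes 1/eta beyond both tail thresholds [M] and [M']. *)
pose s := eta ^+ 2; have s0 : 0 < s by rewrite exprn_gt0.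
have es : eta / s = eta^-1 by rewrite /s; field; rewrite gt_eqF.
have eM : 1 + `|M| + `|M'| < eta^-1.
  by rewrite -[ltLHS]invrK ltf_pV2 ?posrE// invr_gt0 -addrA ltr_pwDl// addr_ge0.
have T1 : 1 - stdPhi (eta / s) <= e / 4.
  rewrite es; apply: le_trans (HM eta^-1 _); first exact: ler_norm.
  by have := ler_norm M; have := normr_ge0 M'; lra.
have T2 : stdPhi (- eta / s) <= e / 4.
  rewrite mulNr es; apply: le_trans (HM' (- eta^-1) _).
    by rewrite sub0r normrN ler_norm.
  by have := ler_norm (- M'); rewrite normrN; have := normr_ge0 M; lra.
have /cvgrPdist_le /(_ _ e4) S1 := @smoothed (x + eta) s s0.
have /cvgrPdist_le /(_ _ e4) S2 := @smoothed (x - eta) s s0.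
near=> n.
have u := upper n x eta s0; have l := lower n x eta s0.
have A1 : `|stdPhi ((x + eta) / Num.sqrt (1 + s ^+ 2)) -
    mean P (fun w => stdPhi ((x + eta - W n w) / s))| <= e / 4 by near: n.
have A2 : `|stdPhi ((x - eta) / Num.sqrt (1 + s ^+ 2)) -
    mean P (fun w => stdPhi ((x - eta - W n w) / s))| <= e / 4 by near: n.
rewrite /=; move: u l U1 U2 A1 A2 T1 T2; rewrite mul1r mulN1r -/s.
move: (fine _) (mean P _) (mean P _) (stdPhi (_ / Num.sqrt _))
  (stdPhi (_ / Num.sqrt _)) (stdPhi (eta / s)) (stdPhi (- eta / s)) (stdPhi x).
move=> p m1 m2 q1 q2 t1 t2 q u l; rewrite !ler_norml.
move=> /andP[? ?] /andP[? ?] /andP[? ?] /andP[? ?] ? ?.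
by apply/andP; split; lra.
Unshelve. all: by end_near. Qed.

End Smoothing.

Lemma mem_set_bool (T : Type) (f : T -> bool) (y : T) : (y \in [set z | f z]) = f y.
Proof. by apply/idP/idP; rewrite inE. Qed.

(** * The voter model as a function of its inputs *)

Section Model.
Context {R : realType} {disp : measure_display} {Omega : measurableType disp}.
Context {P : probability Omega R} {G : lfgraph} {eps : R}.
Variable M : nvm_input P G eps.

(** Boxes range over lists of indices and need a [choiceType]; the classical structure provides it
    for drivers. *)
Local Notation D := {classic (driver G)}.
Local Notation input := (forall i : D, driver_val (i : driver G)).
Implicit Types (x : input) (u v z : G) (s t k d : nat) (J K : set D).

Definition nvm_rv : forall i : D, Omega -> driver_val (i : driver G) :=
  driver_rv (fun v => nvm_X0 M v : Omega -> bool)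
    (fun t v => nvm_xi M t v : Omega -> bool)
    (fun t v => nvm_Y M t v : Omega -> bool) (nvm_eta M).

Local Notation Z := nvm_rv.
Local Notation EE := (E P Z).

Lemma measurable_nvm_rv (i : D) (A : set (driver_val (i : driver G))) :
  measurable (Z i @^-1` A).
Proof.
case: i A => [v|t v|t v|t v] A; last exact: nvm_eta_measurable.
- rewrite -[X in measurable X]setTI.
  exact: (@measurable_funP _ _ _ _ setT (nvm_X0 M v)).
- rewrite -[X in measurable X]setTI.
  exact: (@measurable_funP _ _ _ _ setT (nvm_xi M t.+1 v)).
- rewrite -[X in measurable X]setTI.
  exact: (@measurable_funP _ _ _ _ setT (nvm_Y M t.+1 v)).
Qed.

Lemma indep_nvm_rv : mutually_independent P Z.
Proof. exact: nvm_indep. Qed.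

Local Notation mZ := measurable_nvm_rv.
Local Notation iZ := indep_nvm_rv.

Definition xi_ t v x : R := (x (dXi t v) : bool)%:R.
Definition Y_ t v x : R := (x (dY t v) : bool)%:R.
Definition X0_ v x : R := (x (dX0 v) : bool)%:R.
Definition eta_ t v z x : R := ((x (dEta t v) : G) == z)%:R.

(** Refreshed values enter with weight [y]. The model ([y] = 1) and the survival indicator ([y] = 0,
    start 1) thus share one recursion and the lemmas on values, composition and dependence. *)
Fixpoint proc (f0 : G -> input -> R) (y : R) s k v x : R :=
  match k with
  | 0 => f0 v x
  | k'.+1 => y * (xi_ (s + k') v x * Y_ (s + k') v x) +
      (1 - xi_ (s + k') v x) *
        \sum_(z <- nbr v) eta_ (s + k') v z x * proc f0 y s k' z x
  end.

Definition state := proc X0_ 1 0.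

(* The process restarted at time [s] from the configuration 0. *)
Definition restart := proc (fun _ _ => 0) 1.

(* The indicator that the backward path from [(v, s + k)] reaches time [s]. *)
Definition survival := proc (fun _ _ => 1) 0.

Lemma nvm_state t v w : nvm M t v w = state t v (tup Z w).
Proof.
elim: t v => [//|t IH] v; rewrite /state /= mul1r; congr (_ + _ * _).
by apply: eq_bigr => z _; rewrite IH.
Qed.

Lemma proc_cat f0 y s k l v x :
  proc f0 y s (k + l) v x = proc (proc f0 y s k) y (s + k) l v x.
Proof.
elim: l v => [|l IH] v; first by rewrite addn0.
rewrite addnS /= addnA; congr (_ + _ * _).
by apply: eq_bigr => z _; rewrite IH.
Qed.

(** When [eta] misses the neighbourhood, a null event, the sum takes the default value 0; pointwise
    comparisons have to account for it. *)
Lemma sum_eta_ t v x (F : G -> R) :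
  \sum_(z <- nbr v) eta_ t v z x * F z =
  if (x (dEta t v) : G) \in nbr v then F (x (dEta t v) : G) else 0.
Proof.
case: ifPn => [e|e].
  rewrite (bigD1_seq (x (dEta t v) : G)) ?fset_uniq//= /eta_ eqxx mul1r.
  by rewrite big1 ?addr0// => z /negbTE; rewrite eq_sym => ->; rewrite mul0r.
rewrite big_seq big1// => z zv; rewrite /eta_; case: eqP => [ez|_]; last by rewrite mul0r.
by rewrite ez zv in e.
Qed.

Lemma xi_01 t v x : xi_ t v x = 0 \/ xi_ t v x = 1.
Proof. by rewrite /xi_; case: (x _); [right|left]. Qed.

Lemma proc_01 f0 y s k v x : y = 0 \/ y = 1 ->
  (forall z, f0 z x = 0 \/ f0 z x = 1) ->
  proc f0 y s k v x = 0 \/ proc f0 y s k v x = 1.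
Proof.
move=> y01 f01; elim: k v => [|k IH] v /=; first exact: f01.
rewrite sum_eta_; case: (xi_01 (s + k) v x) => ->.
  rewrite mul0r mulr0 add0r subr0 mul1r; case: ifP => _; [exact: IH | by left].
rewrite subrr mul0r addr0 mul1r /Y_.
case: y01 => ->; first by left; rewrite mul0r.
by rewrite mul1r; case: (x _); [right|left].
Qed.

Lemma survival_01 s k v x : survival s k v x = 0 \/ survival s k v x = 1.
Proof. by apply: proc_01; [left | right]. Qed.

Lemma survival_ge0 s k v x : 0 <= survival s k v x.
Proof. by case: (survival_01 s k v x) => ->. Qed.

Lemma state_01 t v x : state t v x = 0 \/ state t v x = 1.
Proof.
apply: proc_01 => [|z]; first by right.
by rewrite /X0_; case: (x _); [right | left].
Qed.

(** Coupling: both runs read the same inputs, so their difference is copied along the backward path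
    and vanishes at a refreshed step. *)
Lemma proc_diff f0 g0 s k v x : (forall z, `|f0 z x - g0 z x| <= 1) ->
  `|proc f0 1 s k v x - proc g0 1 s k v x| <= survival s k v x.
Proof.
move=> fg; elim: k v => [|k IH] v; first exact: fg.
rewrite /survival /= mul0r add0r opprD addrACA subrr add0r -mulrBr !sum_eta_.
case: (xi_01 (s + k) v x) => ->; last by rewrite subrr !mul0r normr0.
rewrite subr0 !mul1r; case: ifP => _; first exact: IH.
by rewrite subr0 normr0.
Qed.

Lemma state_restart s k v x :
  `|state (s + k) v x - restart s k v x| <= survival s k v x.
Proof.
rewrite /state proc_cat add0n; apply: proc_diff => z.
by case: (state_01 s z x); rewrite /state => ->; rewrite ?subrr ?subr0 ?normr0 ?normr1.
Qed.

(* Index [t] of a driver stands for the model time [t.+1]. *)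
Definition window s t : set D := fun i => match i with
  | dX0 _ => False
  | dXi k _ | dY k _ | dEta k _ => (s <= k < t)%N
  end.

Definition past t : set D := fun i => match i with
  | dX0 _ => True
  | dXi k _ | dY k _ | dEta k _ => (k < t)%N
  end.

Lemma past_window s s' t : (s <= s')%N -> past s `&` window s' t = set0.
Proof.
move=> ss; apply/seteqP; split => // -[v|k v|k v|k v] /= [] //; lia.
Qed.

Lemma window_window s t s' t' : (t <= s')%N -> window s t `&` window s' t' = set0.
Proof.
move=> ss; apply/seteqP; split => // -[v|k v|k v|k v] /= [] //; lia.
Qed.

Lemma window_sub s s' t t' : (s' <= s)%N -> (t <= t')%N -> window s t `<=` window s' t'.
Proof. by move=> ss tt [v|k v|k v|k v] //=; lia. Qed.

Lemma past_sub t t' : (t <= t')%N -> past t `<=` past t'.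
Proof. by move=> tt [v|k v|k v|k v] //=; lia. Qed.

Lemma window_past s t t' : (t <= t')%N -> window s t `<=` past t'.
Proof. by move=> tt [v|k v|k v|k v] //=; lia. Qed.

Local Notation fv := (@fin_valued R D (fun i : D => driver_val (i : driver G))).

Lemma fv_bool J (i : D) (f : driver_val (i : driver G) -> bool) : J i ->
  fv J (fun x => (f (x i))%:R).
Proof.
move=> Ji; have := fin_valued_coord (R := R) (T := fun i : D => driver_val (i : driver G))
  (J := J) (i := i) [set y | f y] Ji.
congr (fin_valued _ _); apply/funext => x; rewrite indicE; congr ((nat_of_bool _)%:R).
exact: (mem_set_bool (fun x => f (x i))).
Qed.

Lemma fv_xi J t v : J (dXi t v) -> fv J (xi_ t v).
Proof. exact: (@fv_bool J (dXi t v) id). Qed.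

Lemma fv_Y J t v : J (dY t v) -> fv J (Y_ t v).
Proof. exact: (@fv_bool J (dY t v) id). Qed.

Lemma fv_X0 J v : J (dX0 v) -> fv J (X0_ v).
Proof. exact: (@fv_bool J (dX0 v) id). Qed.

Lemma fv_eta J t v z : J (dEta t v) -> fv J (eta_ t v z).
Proof. exact: (@fv_bool J (dEta t v) (fun y : G => y == z)). Qed.

Lemma fv_proc J f0 y s k v : (forall z, fv J (f0 z)) ->
  (window s (s + k) `<=` J) -> fv J (proc f0 y s k v).
Proof.
move=> vf; elim: k v => [|k IH] v sJ /=; first exact: vf.
have wJ : window s (s + k) `<=` J.
  by apply: subset_trans sJ; apply: window_sub => //; lia.
have Jk (i : D) : i = dXi (s + k) v \/ i = dY (s + k) v \/ i = dEta (s + k) v -> J i.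
  by move=> Hi; apply: sJ; case: Hi => [|[|]] -> /=; lia.
apply: fin_valuedD.
  apply: fin_valuedM; first exact: fin_valued_cst.
  by apply: fin_valuedM; [apply: fv_xi | apply: fv_Y]; apply: Jk; tauto.
apply: fin_valuedM.
  by apply: fin_valuedB; [exact: fin_valued_cst | apply: fv_xi; apply: Jk; tauto].
apply: fin_valued_sum => z; apply: fin_valuedM; last exact: IH.
by apply: fv_eta; apply: Jk; tauto.
Qed.

Lemma fv_restart J s k v : (window s (s + k) `<=` J) -> fv J (restart s k v).
Proof. by move=> sJ; apply: fv_proc => // z; exact: fin_valued_cst. Qed.

Lemma fv_survival J s k v : (window s (s + k) `<=` J) -> fv J (survival s k v).
Proof. by move=> sJ; apply: fv_proc => // z; exact: fin_valued_cst. Qed.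

Lemma fv_state J t v : past t `<=` J -> fv J (state t v).
Proof.
move=> sJ; apply: fv_proc => [z|]; first by apply: fv_X0; exact: sJ.
by apply: subset_trans sJ; exact: window_past.
Qed.

Section AgreementIndicator.
Variables (u : G) (d : nat).

Definition agree t x : R := (state t u x == state (t + d) u x)%:R.

Definition agree_from s t x : R :=
  (restart s (t - s) u x == restart s (t + d - s) u x)%:R.

Lemma fv_eqb J (f g : input -> R) : fv J f -> fv J g ->
  fv J (fun x => (f x == g x)%:R).
Proof. exact: (fin_valued_op2 (fun a b => (a == b)%:R)). Qed.

Lemma fv_agree t : fv (past (t + d)) (agree t).
Proof.
apply: fv_eqb; apply: fv_state => //.
by apply: past_sub; rewrite leq_addr.
Qed.

Lemma fv_agree_from s t : (s <= t)%N ->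
  fv (window s (t + d)) (agree_from s t).
Proof. by move=> st; apply: fv_eqb; apply: fv_restart; apply: window_sub; lia. Qed.

Lemma agree_bound t x : 0 <= agree t x <= 1.
Proof. by rewrite /agree; case: (_ == _); rewrite ?lexx ?ler01. Qed.

Lemma agree_from_bound s t x : 0 <= agree_from s t x <= 1.
Proof. by rewrite /agree_from; case: (_ == _); rewrite ?lexx ?ler01. Qed.

Definition lost s t x : R := survival s (t - s) u x + survival s (t + d - s) u x.

Lemma fv_lost s t : (s <= t)%N -> fv (window s (t + d)) (lost s t).
Proof.
by move=> st; apply: fin_valuedD; apply: fv_survival; apply: window_sub; lia.
Qed.

Lemma lost_ge0 s t x : 0 <= lost s t x.
Proof. by rewrite addr_ge0// survival_ge0. Qed.

(** If neither path survives back to [s], both states equal their restarted versions and so do the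
    indicators; otherwise [lost] is at least 1, which dominates any difference of indicators. *)
Lemma agree_from_near s t x : (s <= t)%N ->
  `|agree t x - agree_from s t x| <= lost s t x.
Proof.
move=> st; have h1 := state_restart s (t - s) u x.
have h2 := state_restart s (t + d - s) u x.
rewrite subnKC// in h1; rewrite subnKC in h2; last by lia.
have one : `|agree t x - agree_from s t x| <= 1.
  have := agree_bound t x; have := agree_from_bound s t x.
  by rewrite ler_norml; lra.
rewrite /lost; case: (survival_01 s (t - s) u x) h1 => ->; last first.
  by move=> _; apply: (le_trans one); rewrite lerDl survival_ge0.
case: (survival_01 s (t + d - s) u x) h2 => ->; last by rewrite add0r.
rewrite !normr_le0 !subr_eq0 => /eqP e1 /eqP e2.
by rewrite /agree /agree_from e1 e2 subrr normr0 addr0.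
Qed.

End AgreementIndicator.

Hypothesis eps01 : 0 < eps < 1.
Hypothesis nbr_n0 : forall v : G, nbr v != fset0.

Lemma E_bool (i : D) (f : driver_val (i : driver G) -> bool) :
  EE (fun x => (f (x i))%:R) = fine (P (Z i @^-1` [set y | f y])).
Proof.
rewrite -(@E_indic _ _ _ P _ _ _ mZ setT [set x | f (x i)]).
  congr (EE _); apply/funext => x; rewrite indicE; congr ((nat_of_bool _)%:R).
  exact/esym/(mem_set_bool (fun x => f (x i))).
exact: (@sig_coord D (fun i : D => driver_val (i : driver G)) setT i [set y | f y]).
Qed.

Lemma bern_true (p : R) : 0 <= p <= 1 -> bernoulli_prob p [set y : bool | y] = p%:E.
Proof.
move=> p01; rewrite bernoulli_probE// !diracE mem_set//= memNset//=.
by rewrite mule1 mule0 adde0.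
Qed.

Lemma E_xi t v : EE (xi_ t v) = eps.
Proof.
rewrite /xi_ (@E_bool (dXi t v) id) /=.
have := @nvm_xi_law _ _ _ _ _ _ M t.+1 v [set y | y] isT.
by rewrite bern_true /distribution /pushforward => [->//|]; case/andP: eps01 => /ltW -> /ltW ->.
Qed.

Lemma E_Y t v : EE (Y_ t v) = 2^-1.
Proof.
rewrite /Y_ (@E_bool (dY t v) id) /=.
have := @nvm_Y_law _ _ _ _ _ _ M t.+1 v [set y | y] isT.
rewrite bern_true /distribution /pushforward => [->//|].
by rewrite invr_ge0 ler0n/= invf_le1 ?ler1n.
Qed.

Lemma E_X0 v : EE (X0_ v) = 2^-1.
Proof.
rewrite /X0_ (@E_bool (dX0 v) id) /=.
have := @nvm_X0_law _ _ _ _ _ _ M v [set y | y].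
rewrite bern_true /distribution /pushforward => [->//|].
by rewrite invr_ge0 ler0n/= invf_le1 ?ler1n.
Qed.

Lemma E_eta t v z : EE (eta_ t v z) = (z \in nbr v)%:R / #|` nbr v|%:R.
Proof.
rewrite /eta_ (@E_bool (dEta t v) (fun y : G => y == z)) /=.
rewrite (_ : _ @^-1` _ = nvm_eta M t.+1 v @^-1` [set z]) ?nvm_eta_law//.
by apply/seteqP; split => w /= /eqP.
Qed.

Lemma deg_gt0 v : 0 < #|` nbr v|%:R :> R.
Proof. by rewrite ltr0n lt0n cardfs_eq0 nbr_n0. Qed.

Lemma sum_deg v (c : R) : \sum_(z <- nbr v) #|` nbr v|%:R^-1 * c = c.
Proof.
rewrite big_const_seq count_predT iter_addr_0 -[LHS]mulr_natl mulrA.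
by rewrite mulfV ?mul1r// lt0r_neq0// deg_gt0.
Qed.

Lemma E_step J t v z g : fv J g -> ~ J (dXi t v) -> ~ J (dEta t v) -> z \in nbr v ->
  EE (fun x => (1 - xi_ t v x) * (eta_ t v z x * g x)) =
  (1 - eps) * (#|` nbr v|%:R^-1 * EE g).
Proof.
move=> vg nxi neta zv.
have v1 : fv [set (dXi t v : D)] (fun x => 1 - xi_ t v x).
  by apply: fin_valuedB; [exact: fin_valued_cst | exact: fv_xi].
have v2 : fv [set (dEta t v : D)] (eta_ t v z) by exact: fv_eta.
rewrite (@E_mul _ _ _ P _ _ _ mZ iZ [set (dXi t v : D)] ([set (dEta t v : D)] `|` J))//.
- rewrite (@E_mul _ _ _ P _ _ _ mZ iZ [set (dEta t v : D)] J)//.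
    rewrite E_eta zv mul1r (@E_sub _ _ _ P _ _ _ mZ setT setT) ?E_cst ?E_xi//.
      exact: fin_valued_cst.
    exact: fv_xi.
  by apply/seteqP; split => // i [/= -> ].
- by apply/seteqP; split => // i [/= -> [|]].
- apply: fin_valuedM; first by apply: fv_eta; left.
  by apply: fin_valued_sub vg; right.
Qed.

Lemma E_refresh J t v g : fv J g -> ~ J (dXi t v) -> ~ J (dY t v) ->
  EE (fun x => xi_ t v x * Y_ t v x * g x) = eps * 2^-1 * EE g.
Proof.
move=> vg nxi nY.
rewrite (@E_mul _ _ _ P _ _ _ mZ iZ ([set (dXi t v : D)] `|` [set (dY t v : D)]) J)//.
- rewrite (@E_mul _ _ _ P _ _ _ mZ iZ [set (dXi t v : D)] [set (dY t v : D)])//.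
  + by rewrite E_xi E_Y.
  + by apply/seteqP; split => // i [/= -> ].
  + exact: fv_xi.
  + exact: fv_Y.
- by apply/seteqP; split => // i [/= [|] -> ].
- by apply: fin_valuedM; [apply: fv_xi; left | apply: fv_Y; right].
Qed.

Lemma E_survival s k v : EE (survival s k v) = (1 - eps) ^+ k.
Proof.
elim: k v => [|k IH] v; first exact: E_cst.
rewrite (_ : survival s k.+1 v = (fun x => \sum_(z <- nbr v)
    (1 - xi_ (s + k) v x) * (eta_ (s + k) v z x * survival s k z x))); last first.
  by apply/funext => x; rewrite /survival /= mul0r add0r mulr_sumr.
rewrite (@E_sum _ _ _ P _ _ _ mZ setT).
  rewrite big_seq (eq_bigr (fun=> (#|` nbr v|%:R^-1 * (1 - eps) ^+ k.+1))).
    by rewrite -big_seq sum_deg.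
  move=> z zv; rewrite (@E_step (window s (s + k)))//=; try by lia.
    by rewrite IH exprS mulrCA.
  exact: fv_survival.
move=> z; apply: fin_valuedM.
  by apply: fin_valuedB; [exact: fin_valued_cst | exact: fv_xi].
by apply: fin_valuedM; [exact: fv_eta | exact: fv_survival].
Qed.

(** Initial values stay in place: the shift is then an injective reindexing that preserves laws, so
    the shifted family is again independent and equal in law to the original one. *)
Definition shift_driver k (i : driver G) : driver G :=
  match i with
  | dX0 v => dX0 v
  | dXi t v => dXi (t + k) v
  | dY t v => dY (t + k) v
  | dEta t v => dEta (t + k) v
  end.

Definition shift_input k x : input := fun i =>
  match i return driver_val (i : driver G) with
  | dX0 v => x (dX0 v)
  | dXi t v => x (dXi (t + k) v)
  | dY t v => x (dY (t + k) v)
  | dEta t v => x (dEta (t + k) v)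
  end.

(** A cast: the value type of a driver is insensitive to its time, but this is visible to the type
    checker only after a case analysis on [i]. *)
Definition shift_set k (i : driver G) :
    set (driver_val i) -> set (driver_val (shift_driver k i)) :=
  match i with
  | dX0 v | dXi _ v | dY _ v | dEta _ v => fun A => A
  end.

Lemma shift_driver_inj k : injective (shift_driver k).
Proof.
by move=> [v|t v|t v|t v] [v'|t' v'|t' v'|t' v'] //=;
  [case=> /addIn -> -> | case=> /addIn -> -> | case=> /addIn -> ->].
Qed.

Lemma shift_setE k (i : D) (A : set (driver_val (i : driver G))) w :
  shift_set A (Z (shift_driver k i) w) = A (shift_input k (tup Z w) i).
Proof. by case: i A. Qed.

Lemma shift_setE_pre k (i : D) (A : set (driver_val (i : driver G))) :
  (fun w => shift_input k (tup Z w) i) @^-1` A =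
  Z (shift_driver k i) @^-1` shift_set A.
Proof. by case: i A. Qed.

Lemma indep_shift k :
  mutually_independent P (fun (i : D) w => shift_input k (tup Z w) i).
Proof.
move=> n i inj A.
have inj' : injective (fun j => shift_driver k (i j) : D).
  by move=> a b /shift_driver_inj /inj.
have := iZ inj' (fun j => shift_set (A j)).
under [X in _ = X -> _]eq_bigr do rewrite -shift_setE_pre.
move=> <-; congr (P _); apply/seteqP; split => w /= H j; have := H j;
  by rewrite shift_setE.
Qed.

Lemma E_eta_sum t v (A : set G) :
  EE (fun x => \sum_(z <- nbr v | `[< A z >]) eta_ t v z x) =
  \sum_(z <- nbr v | `[< A z >]) #|` nbr v|%:R^-1.
Proof.
rewrite (@E_sum _ _ _ P _ _ _ mZ setT); last by move=> z; exact: fv_eta.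
rewrite big_seq_cond [RHS]big_seq_cond; apply: eq_bigr => z /andP[zv _].
by rewrite E_eta zv mul1r.
Qed.

Lemma E_eta_total t v : EE (fun x => \sum_(z <- nbr v) eta_ t v z x) = 1.
Proof.
rewrite (@E_sum _ _ _ P _ _ _ mZ setT); last by move=> z; exact: fv_eta.
rewrite -[RHS](sum_deg v 1) big_seq [RHS]big_seq; apply: eq_bigr => z zv.
by rewrite E_eta zv mul1r mulr1.
Qed.

(** The law of [eta] is prescribed on singletons. The neighbours already carry mass 1, and the error
    of counting only them is dominated by [1 - \sum_(z <- nbr v) eta_ t v z x], which has mean 0.
    Equality of laws on all sets of values is what the time shift requires. *)
Lemma P_eta t v (A : set G) : P (nvm_eta M t.+1 v @^-1` A) =
  (\sum_(z <- nbr v | `[< A z >]) #|` nbr v|%:R^-1)%:E.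
Proof.
rewrite -[LHS]fineK; last first.
  by apply: fin_num_measure; exact: nvm_eta_measurable.
congr EFin.
have := @E_bool (dEta t v) (fun y => `[< A y >]).
rewrite /= (_ : [set y | `[< A y >]] = A); last first.
  by apply/seteqP; split => y /= /asboolP.
move=> <-.
have v1 : fv setT (fun x => (`[< A (x (dEta t v)) >])%:R).
  exact: (@fv_bool setT (dEta t v) (fun y => `[< A y >])).
have v2 : fv setT (fun x => \sum_(z <- nbr v | `[< A z >]) eta_ t v z x).
  by apply: fin_valued_sum => z; exact: fv_eta.
have v3 : fv setT (fun x => \sum_(z <- nbr v) eta_ t v z x).
  by apply: fin_valued_sum => z; exact: fv_eta.
have v0 : fv setT (fun=> 1) by exact: fin_valued_cst.
have v4 := fin_valuedB v1 v2; have v5 := fin_valuedB v0 v3.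
rewrite -(E_eta_sum t); apply/eqP; rewrite -subr_eq0 -(@E_sub _ _ _ P _ _ _ mZ setT setT)//.
rewrite -normr_le0; apply: (le_trans (E_norm P mZ v4)).
rewrite [leRHS](_ : 0 = EE (fun x => 1 - \sum_(z <- nbr v) eta_ t v z x)); last first.
  by rewrite (@E_sub _ _ _ P _ _ _ mZ setT setT)// E_eta_total E_cst subrr.
apply: (@E_le _ _ _ P _ _ _ mZ setT setT) => //.
  exact: (fin_valued_op1 (fun a => `|a|) v4).
move=> x.
have -> : \sum_(z <- nbr v | `[< A z >]) eta_ t v z x =
    \sum_(z <- nbr v) eta_ t v z x * (`[< A z >])%:R.
  by rewrite big_mkcond; apply: eq_bigr => z _; case: ifP => _; rewrite ?mulr1 ?mulr0.
have -> : \sum_(z <- nbr v) eta_ t v z x = \sum_(z <- nbr v) eta_ t v z x * 1.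
  by apply: eq_bigr => z _; rewrite mulr1.
rewrite !sum_eta_; case: ifP => _; first by rewrite !subrr normr0.
by rewrite !subr0; case: (`[< _ >]); rewrite ?normr1 ?normr0 ?ler01.
Qed.

Lemma law_shift k (i : D) (A : set (driver_val (i : driver G))) :
  P (Z i @^-1` A) = P ((fun w => shift_input k (tup Z w) i) @^-1` A).
Proof.
case: i A => [v|t v|t v|t v] A //.
- have := @nvm_xi_law _ _ _ _ _ _ M t.+1 v A isT.
  have := @nvm_xi_law _ _ _ _ _ _ M (t + k).+1 v A isT.
  by rewrite /distribution /pushforward => <- ->.
- have := @nvm_Y_law _ _ _ _ _ _ M t.+1 v A isT.
  have := @nvm_Y_law _ _ _ _ _ _ M (t + k).+1 v A isT.
  by rewrite /distribution /pushforward => <- ->.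
- by transitivity (P (nvm_eta M (t + k).+1 v @^-1` A)); rewrite ?P_eta.
Qed.

Lemma E_shift k J f : fv J f -> EE (fun x => f (shift_input k x)) = EE f.
Proof.
move=> vf; symmetry.
apply: (@E_same_law _ _ _ P D (fun i : D => driver_val (i : driver G)) Z
  (fun i w => shift_input k (tup Z w) i) mZ _ iZ (@indep_shift k) (@law_shift k) _ _ vf).
move=> i A; rewrite shift_setE_pre; exact: mZ.
Qed.

Lemma restart_shift c s k v x :
  restart s k v (shift_input c x) = restart (s + c) k v x.
Proof.
elim: k v => [//|k IH] v; rewrite /restart /=.
have xiE t : xi_ t v (shift_input c x) = xi_ (t + c) v x by [].
have YE t : Y_ t v (shift_input c x) = Y_ (t + c) v x by [].
have etaE t z : eta_ t v z (shift_input c x) = eta_ (t + c) v z x by [].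
rewrite !xiE YE (addnAC s k c); congr (_ + _ * _).
by apply: eq_bigr => z _; rewrite etaE (addnAC s k c); congr (_ * _); exact: IH.
Qed.

Section Agreement.
Variables (u : G) (d : nat).

Local Notation agree := (agree u d).
Local Notation agree_from := (agree_from u d).
Local Notation lost := (lost u d).
Local Notation fv_agree := (fv_agree u d).
Local Notation fv_agree_from := (fv_agree_from u d).
Local Notation fv_lost := (fv_lost u d).
Local Notation agree_bound := (agree_bound u d).
Local Notation agree_from_bound := (agree_from_bound u d).
Local Notation agree_from_near := (agree_from_near u d).

Local Notation rho := (1 - eps).

Lemma rho_ge0 : 0 <= rho. Proof. by case/andP: eps01; lra. Qed.
Lemma rho_lt1 : rho < 1. Proof. by case/andP: eps01; lra. Qed.
Lemma rho_gt0 : 0 < rho. Proof. by case/andP: eps01; lra. Qed.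

Lemma E_lost s t : (s <= t)%N -> EE (lost s t) <= 2 * rho ^+ (t - s).
Proof.
move=> st; rewrite (@E_add _ _ _ P _ _ _ mZ setT setT); try exact: fv_survival.
rewrite !E_survival [leRHS]mulr_natl mulr2n lerD2l ler_wiXn2l ?rho_ge0 ?(ltW rho_lt1)//.
by lia.
Qed.

Definition cov f g : R := EE (fun x => f x * g x) - EE f * EE g.

Let fvT J f : fv J f -> fv setT f. Proof. exact: fin_valued_sub. Qed.

Lemma E_01 J f : fv J f -> (forall x, 0 <= f x <= 1) -> 0 <= EE f <= 1.
Proof.
move=> vf f01; apply/andP; split.
  by apply: (E_ge0 P mZ vf) => x; case/andP: (f01 x).
rewrite -[leRHS](E_cst P Z); apply: (@E_le _ _ _ P _ _ _ mZ J J) => //.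
  exact: fin_valued_cst.
by move=> x; case/andP: (f01 x).
Qed.

Lemma E_prod_01 J f g : fv J f -> fv J g -> (forall x, 0 <= f x <= 1) ->
  (forall x, 0 <= g x <= 1) -> 0 <= EE (fun x => f x * g x) <= 1.
Proof.
move=> vf vg f01 g01; apply: (@E_01 J); first exact: fin_valuedM.
by move=> x; have := f01 x; have := g01 x; nra.
Qed.

Lemma E_close J f g h : fv J f -> fv J g -> fv J h ->
  (forall x, `|f x - g x| <= h x) -> `|EE f - EE g| <= EE h.
Proof.
move=> vf vg vh fgh; rewrite -(@E_sub _ _ _ P _ _ _ mZ J J)//.
have vd := fin_valuedB vf vg.
apply: (le_trans (E_norm P mZ vd)); apply: (@E_le _ _ _ P _ _ _ mZ J J) => //.
exact: (fin_valued_op1 (fun a => `|a|) vd).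
Qed.

Lemma cov_agree_le1 t t' : `|cov (agree t) (agree t')| <= 1.
Proof.
have v1 := fvT (fv_agree t); have v2 := fvT (fv_agree t').
have := E_prod_01 v1 v2 (agree_bound t) (agree_bound t').
have := E_01 v1 (agree_bound t); have := E_01 v2 (agree_bound t').
by rewrite /cov ler_norml; nra.
Qed.

(* The factor [2 m (1 - m) <= 1 / 2] of the mean deviation is what makes the
   bound sharp enough for the threshold on [kappa]. *)
Lemma cov_agree_decay t t' : (t + d <= t')%N ->
  `|cov (agree t) (agree t')| <= rho ^+ (t' - (t + d)).
Proof.
move=> tt; set s := (t + d)%N; set m := EE (agree t).
have v1 := fv_agree t; have v2 := fv_agree t'.
have v3 := fv_agree_from tt; have v4 := fv_lost tt.
have indep : past (t + d) `&` window s (t' + d) = set0 by exact: past_window.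
have vm : fv (past (t + d)) (fun x => agree t x - m).
  by apply: fin_valuedB => //; exact: fin_valued_cst.
have vabs := fin_valued_op1 (fun a => `|a|) vm.
have Em : EE (fun x => agree t x - m) = 0.
  by rewrite (@E_sub _ _ _ P _ _ _ mZ (past (t + d)) setT)// ?E_cst ?subrr//;
    exact: fin_valued_cst.
(* Subtracting the restarted indicator is free: it depends on inputs after time [s] and is therefore
   independent of the centred factor, whose mean is 0. *)
have -> : cov (agree t) (agree t') =
    EE (fun x => (agree t x - m) * (agree t' x - agree_from s t' x)).
  have -> : (fun x => (agree t x - m) * (agree t' x - agree_from s t' x)) =
      (fun x => (agree t x * agree t' x - m * agree t' x) -
          (agree t x - m) * agree_from s t' x).
    by apply/funext => x; rewrite mulrBr mulrBl.
  have w1 := fin_valuedM (fvT v1) (fvT v2).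
  have w2 : fv setT (fun x => m * agree t' x).
    by apply: fin_valuedM; [exact: fin_valued_cst | exact: fvT v2].
  rewrite (@E_sub _ _ _ P _ _ _ mZ setT setT); last 2 first.
  - exact: fin_valuedB.
  - by apply: fin_valuedM; [exact: fvT vm | exact: fvT v3].
  rewrite (E_mul mZ iZ indep vm v3) Em mul0r subr0.
  by rewrite (@E_sub _ _ _ P _ _ _ mZ setT setT)// (E_scale _ mZ _ v2).
have vprod : fv setT (fun x => (agree t x - m) * (agree t' x - agree_from s t' x)).
  apply: fin_valuedM; first exact: fvT vm.
  by apply: fin_valuedB; [exact: fvT v2 | exact: fvT v3].
apply: (le_trans (E_norm P mZ vprod)).
apply: (@le_trans _ _ (EE (fun x => `|agree t x - m| * lost s t' x))).
  apply: (@E_le _ _ _ P _ _ _ mZ setT setT).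
  - exact: (fin_valued_op1 (fun a => `|a|) vprod).
  - by apply: fin_valuedM; [exact: fvT vabs | exact: fvT v4].
  - move=> x; rewrite normrM; apply: ler_wpM2l => //.
    exact: agree_from_near.
rewrite (E_mul mZ iZ indep vabs v4).
have m01 : 0 <= m <= 1 by exact: E_01 v1 (agree_bound t).
have -> : EE (fun x => `|agree t x - m|) = 2 * m * (1 - m).
  (* On the values 0 and 1 the function |a - m| coincides with an affine one. *)
  have -> : (fun x => `|agree t x - m|) = (fun x => (1 - 2 * m) * agree t x + m).
    apply/funext => x; rewrite /agree; case/andP: m01 => m0 m1.
    case: (_ == _) => /=.
      by rewrite mulr1 ger0_norm ?subr_ge0//; ring.
    by rewrite mulr0n mulr0 !add0r normrN ger0_norm.
  rewrite (@E_add _ _ _ P _ _ _ mZ setT setT).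
  - by rewrite (E_scale _ mZ _ v1) E_cst -/m; ring.
  - by apply: fin_valuedM; [exact: fin_valued_cst | exact: fvT v1].
  - exact: fin_valued_cst.
have := E_lost tt; rewrite -/s.
have : 0 <= EE (lost s t') by exact: (E_ge0 P mZ v4 (lost_ge0 u d s t')).
have : 0 <= (1 - 2 * m) ^+ 2 by exact: sqr_ge0.
by nra.
Qed.

(** The versions restarted at [c] and at 0 have the same mean by shift invariance; each comparison
    with its restarted version costs 2 rho^t. *)
Lemma E_agree_stationary c t : `|EE (agree (t + c)) - EE (agree t)| <= 4 * rho ^+ t.
Proof.
have h1 : `|EE (agree (t + c)) - EE (agree_from c (t + c))| <= 2 * rho ^+ t.
  have := @E_lost c (t + c) (leq_addl _ _); rewrite addnK; apply: le_trans.
  apply: (@E_close setT); try exact: fvT (fv_agree _).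
  - exact: fvT (fv_agree_from (leq_addl _ _)).
  - exact: fvT (fv_lost (leq_addl _ _)).
  - by move=> x; apply: agree_from_near; exact: leq_addl.
have h2 : `|EE (agree t) - EE (agree_from 0 t)| <= 2 * rho ^+ t.
  have := @E_lost 0 t (leq0n _); rewrite subn0; apply: le_trans.
  apply: (@E_close setT); try exact: fvT (fv_agree _).
  - exact: fvT (fv_agree_from (leq0n _)).
  - exact: fvT (fv_lost (leq0n _)).
  - by move=> x; exact: agree_from_near.
have h3 : EE (agree_from c (t + c)) = EE (agree_from 0 t).
  rewrite -(E_shift c (fv_agree_from (leq0n t))); congr (EE _); apply/funext => x.
  by rewrite /agree_from !restart_shift add0n !subn0 addnK addnAC addnK.
by move: h1 h2; rewrite h3 !ler_norml; lra.
Qed.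

(** Same comparison for products. The constant 16 is 4 + 4 for the two mixed moments and 4 + 4 for
    replacing the two means in the product of means. *)
Lemma cov_agree_stationary c t t' : (t <= t')%N ->
  `|cov (agree (t + c)) (agree (t' + c)) - cov (agree t) (agree t')| <= 16 * rho ^+ t.
Proof.
move=> tt.
have close s a b : (s <= a <= b)%N ->
  `|EE (fun x => agree a x * agree b x) -
    EE (fun x => agree_from s a x * agree_from s b x)| <= 4 * rho ^+ (a - s).
  move=> /andP[sa ab]; have sb := leq_trans sa ab.
  have l1 := E_lost sa; have l2 := E_lost sb.
  have pw : rho ^+ (b - s) <= rho ^+ (a - s).
    by rewrite ler_wiXn2l ?rho_ge0 ?(ltW rho_lt1)// leq_sub2r.
  apply: (@le_trans _ _ (EE (fun x => lost s a x + lost s b x))).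
    apply: (@E_close setT).
    - by apply: fin_valuedM; exact: fvT (fv_agree _).
    - by apply: fin_valuedM; [exact: fvT (fv_agree_from sa) | exact: fvT (fv_agree_from sb)].
    - by apply: fin_valuedD; [exact: fvT (fv_lost sa) | exact: fvT (fv_lost sb)].
    - move=> x.
      have n1 := agree_from_near x sa; have n2 := agree_from_near x sb.
      have b1 := agree_bound b x; have b2 := agree_from_bound s a x.
      rewrite (_ : _ - _ = (agree a x - agree_from s a x) * agree b x +
        agree_from s a x * (agree b x - agree_from s b x)); last by ring.
      apply: (le_trans (ler_normD _ _)); apply: lerD; rewrite normrM.
        apply: le_trans n1; apply: ler_piMr => //.
        by case/andP: b1 => b0 b1; rewrite ger0_norm.
      apply: le_trans n2; apply: ler_piMl => //.
      by case/andP: b2 => b0 b2; rewrite ger0_norm.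
  rewrite (@E_add _ _ _ P _ _ _ mZ setT setT).
  - by lra.
  - exact: fvT (fv_lost sa).
  - exact: fvT (fv_lost sb).
have h1 := @close c (t + c)%N (t' + c)%N; rewrite addnK in h1.
have {h1} h1 := h1 (introT andP (conj (leq_addl t c) (leq_add tt (leqnn c)))).
have h2 := @close 0%N t t'; rewrite subn0 in h2.
have {h2} h2 := h2 (introT andP (conj (leq0n t) tt)).
have h3 : EE (fun x => agree_from c (t + c) x * agree_from c (t' + c) x) =
    EE (fun x => agree_from 0 t x * agree_from 0 t' x).
  have w := fin_valuedM (fvT (fv_agree_from (leq0n t))) (fvT (fv_agree_from (leq0n t'))).
  rewrite -(E_shift c w); congr (EE _); apply/funext => x.
  by rewrite /agree_from !restart_shift add0n !subn0 !addnK !(addnAC _ c d) !addnK.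
have e1 := E_agree_stationary c t; have e2 := E_agree_stationary c t'.
have pw : rho ^+ t' <= rho ^+ t by rewrite ler_wiXn2l ?rho_ge0 ?(ltW rho_lt1).
have p0 : 0 <= rho ^+ t by rewrite exprn_ge0 ?rho_ge0.
have m1 := E_01 (fv_agree (t + c)) (agree_bound (t + c)).
have m2 := E_01 (fv_agree t') (agree_bound t').
move: h1 h2 e1 e2 m1 m2; rewrite /cov h3.
move: (EE (agree (t + c))) (EE (agree (t' + c))) (EE (agree t)) (EE (agree t')).
move=> a b a' b'; move: (EE _) (EE _) (EE _) => r q p h1 h2 e1 e2 m1 m2.
have -> : p - a * b - (r - a' * b') =
  ((p - q) - (r - q)) - ((a - a') * b' + a * (b - b')) by ring.
have k1 : `|(a - a') * b'| <= 4 * rho ^+ t.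
  rewrite normrM; apply: (le_trans _ e1); apply: ler_piMr => //.
  by case/andP: m2 => ? ?; rewrite ger0_norm.
have k2 : `|a * (b - b')| <= 4 * rho ^+ t'.
  rewrite normrM; apply: (le_trans _ e2); apply: ler_piMl => //.
  by case/andP: m1 => ? ?; rewrite ger0_norm.
by move: h1 h2 k1 k2; rewrite !ler_norml; lra.
Qed.

End Agreement.

(** * Duality between sign correlations and coalescence of backward paths *)

Section Meeting.
Hypothesis countableG : countable [set: G].
Implicit Types (a b c : G * nat) (p q : seq (G * nat)).

Definition input_edge x : rel (G * nat) := fun a b =>
  match a.2 with
  | 0 => false
  | s.+1 => [&& s == b.2, ~~ (x (dXi s a.1) : bool) & (x (dEta s a.1) : G) == b.1]
  end.

Lemma dedgeE w : dedge M w =2 input_edge (tup Z w).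
Proof.
by move=> [v [|s]] [z t]; rewrite /dedge /input_edge //= eqSS; case: eqP => // ->.
Qed.

Definition maximal_path x a p : Prop :=
  path (input_edge x) a p /\
  forall q, path (input_edge x) a q -> (size q <= size p)%N.

Definition meeting a b : set input :=
  [set x | exists p q, [/\ maximal_path x a p, maximal_path x b q &
    exists c, c \in a :: p /\ c \in b :: q]].

Lemma paths_meetE u t d :
  paths_meet M u t d = tup Z @^-1` meeting (u, t) (u, (t + d)%N).
Proof.
have lp w a p : longest_path M w a p <-> maximal_path (tup Z w) a p.
  split=> -[h1 h2]; split.
  - by rewrite -(eq_path (dedgeE w)).
  - by move=> q; rewrite -(eq_path (dedgeE w)); exact: h2.
  - by rewrite (eq_path (dedgeE w)).
  - by move=> q; rewrite (eq_path (dedgeE w)); exact: h2.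
by apply/seteqP; split => w /= [p [q [/lp hp /lp hq hc]]]; exists p, q; split.
Qed.

Lemma maximal_path0 x v p : maximal_path x (v, 0%N) p <-> p = [::].
Proof.
split=> [[]|->]; first by case: p.
by split => // -[].
Qed.

Lemma maximal_path_stop x v s p : (x (dXi s v) : bool) ->
  maximal_path x (v, s.+1) p <-> p = [::].
Proof.
move=> xi; split=> [[]|->].
  by case: p => // a p /=; rewrite /input_edge /= xi andbF.
by split => // -[|a q] //=; rewrite /input_edge /= xi andbF.
Qed.

Lemma maximal_path_go x v s p : ~~ (x (dXi s v) : bool) ->
  maximal_path x (v, s.+1) p <->
  exists2 q, p = ((x (dEta s v) : G), s) :: q &
    maximal_path x ((x (dEta s v) : G), s) q.
Proof.
move=> xi; set z := (x (dEta s v) : G).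
have edge a : input_edge x (v, s.+1) a -> a = (z, s).
  by case: a => y t; rewrite /input_edge /= => /and3P[/eqP <- _ /eqP <-].
have edge' : input_edge x (v, s.+1) (z, s) by rewrite /input_edge /= !eqxx xi.
split=> [[hp max]|[q -> [hq max]]].
  case: p hp max => [|a p] /= => [_ max|/andP[/edge -> hp] max].
    by have := max [:: (z, s)]; rewrite /= edge' => /(_ isT).
  exists p => //; split => // q hq.
  by have := max ((z, s) :: q); rewrite /= edge' hq => /(_ isT).
split; first by rewrite /= edge'.
by move=> [|a q'] //= /andP[/edge -> /max].
Qed.

Lemma maximal_path_ex x a : exists p, maximal_path x a p.
Proof.
case: a => v t; elim: t v => [|t IH] v; first by exists [::]; apply/maximal_path0.
have [xi|xi] := boolP (x (dXi t v) : bool); first by exists [::]; apply/maximal_path_stop.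
have [p hp] := IH (x (dEta t v) : G).
by exists (((x (dEta t v) : G), t) :: p); apply/maximal_path_go => //; exists p.
Qed.

Lemma input_path_lt x a p c : path (input_edge x) a p -> c \in p -> (c.2 < a.2)%N.
Proof.
elim: p a => // b p IH [v [|s]] //= /andP[]; rewrite {1}/input_edge /=.
move=> /and3P[/eqP sb _ _] hp; rewrite inE => /orP[/eqP ->|/(IH _ hp)]; rewrite ?sb//.
by move=> /leq_trans; apply; rewrite -sb.
Qed.

Lemma meeting_refl a : meeting a a = setT.
Proof.
apply/seteqP; split => // x _; have [p hp] := maximal_path_ex x a.
by exists p, p; split => //; exists a; rewrite mem_head.
Qed.

Lemma meetingC a b : meeting a b = meeting b a.
Proof.
by apply/seteqP; split => x [p [q [hp hq [c [cp cq]]]]];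
  exists q, p; split => //; exists c.
Qed.

Lemma meeting0 v z : v != z -> meeting (v, 0%N) (z, 0%N) = set0.
Proof.
move=> vz; apply/seteqP; split => // x [p [q [/maximal_path0 -> /maximal_path0 ->]]].
by move=> [c []]; rewrite !inE => /eqP -> /eqP [e]; rewrite e eqxx in vz.
Qed.

(** Times strictly decrease along a path, so the path from [a] cannot visit (v, t+1), and any
    meeting takes place after the first step of the other path. *)
Lemma meetingS a v t x : (a.2 <= t.+1)%N -> a != (v, t.+1) ->
  meeting a (v, t.+1) x <->
  ~~ (x (dXi t v) : bool) /\ meeting a ((x (dEta t v) : G), t) x.
Proof.
move=> at1 av.
have notin p : maximal_path x a p -> (v, t.+1) \notin a :: p.
  move=> [hp _]; rewrite inE negb_or eq_sym av/=; apply/negP.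
  by move=> /(input_path_lt hp) /=; rewrite ltnNge at1.
split=> [[p [q [hp hq [c [cp cq]]]]]|[xi [p [q [hp hq [c [cp cq]]]]]]].
  have [xi|xi] := boolP (x (dXi t v) : bool).
    move: hq cq => /maximal_path_stop -> //; rewrite inE => /eqP cE.
    by rewrite cE (negbTE (notin _ hp)) in cp.
  have [q' qE hq'] : exists2 q', q = ((x (dEta t v) : G), t) :: q' &
      maximal_path x ((x (dEta t v) : G), t) q' by apply/maximal_path_go.
  split => //; move: cq; rewrite qE inE => /orP[/eqP cE|cq']; last by exists p, q'; split => //; exists c.
  by rewrite cE (negbTE (notin _ hp)) in cp.
exists p, (((x (dEta t v) : G), t) :: q); split => //.
  by apply/maximal_path_go => //; exists q.
by exists c; split => //; rewrite inE cq orbT.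
Qed.

(** Signs instead of bits: a refreshed sign has mean 0, just as a stopped path contributes no
    meeting. *)
Definition spin a x : R := 2 * state a.2 a.1 x - 1.

(** Finer than [past]: at the time of [a] only the inputs of its own vertex are included, so the
    inputs of a different vertex at the same time remain independent of [spin a]. *)
Definition cone a : set D :=
  match a.2 with
  | 0 => [set (dX0 a.1 : D)]
  | s.+1 => past s `|` [set i : D | i = dXi s a.1 \/ i = dY s a.1 \/ i = dEta s a.1]
  end.

Lemma cone_past a : cone a `<=` past a.2.
Proof.
case: a => v [|s]; first by move=> i /= ->.
move=> i [/=|]; first exact: past_sub.
by move=> /= [|[|]] -> /=.
Qed.

Lemma fv_spin a : fv (cone a) (spin a).
Proof.
apply: fin_valuedB; last exact: fin_valued_cst.
apply: fin_valuedM; first exact: fin_valued_cst.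
case: a => v [|s]; first exact: fv_X0.
rewrite /state /=.
have Jk (i : D) : i = dXi s v \/ i = dY s v \/ i = dEta s v -> cone (v, s.+1) i.
  by move=> Hi; right.
apply: fin_valuedD.
  apply: fin_valuedM; first exact: fin_valued_cst.
  by apply: fin_valuedM; [apply: fv_xi | apply: fv_Y]; apply: Jk; tauto.
apply: fin_valuedM.
  by apply: fin_valuedB; [exact: fin_valued_cst | apply: fv_xi; apply: Jk; tauto].
apply: fin_valued_sum => z; apply: fin_valuedM.
  by apply: fv_eta; apply: Jk; tauto.
by apply: fv_state => i pi; left.
Qed.

Lemma spin_sqr a x : spin a x * spin a x = 1.
Proof. by rewrite /spin; case: (state_01 a.2 a.1 x) => ->; ring. Qed.

(** The meeting event is a union over all values of [eta], including those outside the
    neighbourhood; countability of the graph makes it a sequential union. *)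
Lemma sig_bigcup_countable J (F : G -> set input) :
  (forall z, sig J (F z)) -> sig J (\bigcup_z F z).
Proof.
move=> sF; have [f inj] := countable_injP _ countableG.
rewrite (_ : \bigcup_z F z =
    \bigcup_n (\bigcup_(z in [set z | f z = n]) F z)); last first.
  apply/seteqP; split => x /=.
    by move=> [z _ Fz]; exists (f z) => //; exists z.
  by move=> [n _ [z _ Fz]]; exists z.
apply: sig_bigcup => n.
have [[z fz]|nz] := pselect (exists z, f z = n).
  rewrite (_ : [set z | _] = [set z]) ?bigcup_set1//.
  apply/seteqP; split => y /=; last by move=> ->.
  by move=> fy; apply: (inj y z); rewrite ?inE// fy.
rewrite (_ : [set z | _] = set0) ?bigcup_set0; first exact: sig0.
by apply/seteqP; split => y //= fy; apply: nz; exists y.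
Qed.

Let fvT J f : fv J f -> fv setT f. Proof. exact: fin_valued_sub. Qed.

Lemma E_spin_step a v t :
  ~ cone a (dXi t v) -> ~ cone a (dY t v) -> ~ cone a (dEta t v) ->
  (forall z, ~ cone (z, t) (dXi t v)) -> (forall z, ~ cone (z, t) (dEta t v)) ->
  EE (fun x => spin a x * spin (v, t.+1) x) =
  \sum_(z <- nbr v) (1 - eps) * (#|` nbr v|%:R^-1 * EE (fun x => spin a x * spin (z, t) x)).
Proof.
move=> axi aY aeta zxi zeta.
have va := fv_spin a; have vst z : fv setT (state t z) by exact: fv_state.
have vsum : fv setT (fun x => \sum_(z <- nbr v)
    2 * ((1 - xi_ t v x) * (eta_ t v z x * (state t z x * spin a x)))).
  apply: fin_valued_sum => z; apply: fin_valuedM; first exact: fin_valued_cst.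
  apply: fin_valuedM.
    by apply: fin_valuedB; [exact: fin_valued_cst | exact: fv_xi].
  apply: fin_valuedM; first exact: fv_eta.
  by apply: fin_valuedM => //; exact: fvT va.
have vref : fv setT (fun x => xi_ t v x * Y_ t v x * spin a x).
  apply: fin_valuedM; last exact: fvT va.
  by apply: fin_valuedM; [exact: fv_xi | exact: fv_Y].
have -> : (fun x => spin a x * spin (v, t.+1) x) =
   (fun x => (2 * (xi_ t v x * Y_ t v x * spin a x) + \sum_(z <- nbr v)
    2 * ((1 - xi_ t v x) * (eta_ t v z x * (state t z x * spin a x)))) - spin a x).
  apply/funext => x; rewrite {2}/spin /state /= -/state.
  rewrite -mulr_sumr -mulr_sumr mul1r.
  have -> : \sum_(z <- nbr v) eta_ t v z x * (state t z x * spin a x) =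
     (\sum_(z <- nbr v) eta_ t v z x * state t z x) * spin a x.
    by rewrite mulr_suml; apply: eq_bigr => z _; rewrite mulrA.
  by rewrite /state add0n; ring.
rewrite (@E_sub _ _ _ P _ _ _ mZ setT setT); last 2 first.
- apply: fin_valuedD => //.
  by apply: fin_valuedM => //; exact: fin_valued_cst.
- exact: fvT va.
rewrite (@E_add _ _ _ P _ _ _ mZ setT setT)//; last first.
  by apply: fin_valuedM => //; exact: fin_valued_cst.
rewrite (E_scale _ mZ _ vref) (E_refresh va)//.
rewrite (@E_sum _ _ _ P _ _ _ mZ setT); last first.
  move=> z; apply: fin_valuedM; first exact: fin_valued_cst.
  apply: fin_valuedM.
    by apply: fin_valuedB; [exact: fin_valued_cst | exact: fv_xi].
  apply: fin_valuedM; first exact: fv_eta.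
  by apply: fin_valuedM => //; exact: fvT va.
have vsz z : fv (cone (z, t) `|` cone a) (fun x => state t z x * spin a x).
  have -> : (fun x => state t z x * spin a x) =
      (fun x => 2^-1 * (spin (z, t) x + 1) * spin a x).
    by apply/funext => x; rewrite /spin /=; field.
  apply: fin_valuedM; last by apply: fin_valued_sub va; exact: subsetUr.
  apply: fin_valuedM; first exact: fin_valued_cst.
  apply: fin_valuedD; last exact: fin_valued_cst.
  by apply: fin_valued_sub (fv_spin _); exact: subsetUl.
have Ez z : EE (fun x => spin a x * spin (z, t) x) =
    2 * EE (fun x => state t z x * spin a x) - EE (spin a).
  rewrite -(E_scale _ mZ _ (vsz z)) -(@E_sub _ _ _ P _ _ _ mZ setT setT).
  - by congr (EE _); apply/funext => x; rewrite /spin /=; ring.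
  - by apply: fin_valuedM; [exact: fin_valued_cst | exact: fvT (vsz z)].
  - exact: fvT va.
have -> : \sum_(z <- nbr v) (1 - eps) *
    (#|` nbr v|%:R^-1 * EE (fun x => spin a x * spin (z, t) x)) =
   \sum_(z <- nbr v) 2 * ((1 - eps) * (#|` nbr v|%:R^-1 * EE (fun x => state t z x * spin a x)))
   - (1 - eps) * EE (spin a).
  rewrite -[X in _ - (1 - eps) * X](sum_deg v) mulr_sumr -sumrB.
  by apply: eq_bigr => z _; rewrite Ez; ring.
have -> : \sum_(z <- nbr v) EE (fun x => 2 * ((1 - xi_ t v x) *
      (eta_ t v z x * (state t z x * spin a x)))) =
   \sum_(z <- nbr v) 2 * ((1 - eps) * (#|` nbr v|%:R^-1 * EE (fun x => state t z x * spin a x))).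
  rewrite big_seq [RHS]big_seq; apply: eq_bigr => z zv.
  rewrite (@E_scale _ _ _ P _ _ _ mZ setT).
    by rewrite (E_step (vsz z))// => -[]; [exact: zxi|exact: axi|exact: zeta|exact: aeta].
  apply: fin_valuedM.
    by apply: fin_valuedB; [exact: fin_valued_cst | exact: fv_xi].
  by apply: fin_valuedM; [exact: fv_eta | exact: fvT (vsz z)].
by move: (\sum_(_ <- _) _) => S; field.
Qed.

Lemma E_meeting_step (K : set D) a v t :
  (a.2 <= t.+1)%N -> a != (v, t.+1) ->
  (forall z, sig K (meeting a (z, t))) -> ~ K (dXi t v) -> ~ K (dEta t v) ->
  sig (K `|` [set i : D | i = dXi t v \/ i = dEta t v]) (meeting a (v, t.+1)) /\
  EE (\1_(meeting a (v, t.+1))) =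
  \sum_(z <- nbr v) (1 - eps) * (#|` nbr v|%:R^-1 * EE (\1_(meeting a (z, t)))).
Proof.
move=> at1 av sK nxi neta.
have meetE x := meetingS x at1 av.
have sm : sig (K `|` [set i : D | i = dXi t v \/ i = dEta t v]) (meeting a (v, t.+1)).
  rewrite (_ : meeting a _ = [set x : input | ~~ (x (dXi t v) : bool)] `&`
     \bigcup_z ([set x : input | (x (dEta t v) : G) = z] `&` meeting a (z, t))); last first.
    apply/seteqP; split => x.
      by move=> /meetE[xi m]; split => //; exists (x (dEta t v) : G).
    by move=> [xi [z _ [<- m]]]; apply/meetE; split.
  apply: sigI.
    apply: (@sig_coord D (fun i : D => driver_val (i : driver G)) _ (dXi t v)
      [set b : bool | ~~ b]).
    by right; left.
  apply: sig_bigcup_countable => z; apply: sigI.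
    apply: (@sig_coord D (fun i : D => driver_val (i : driver G)) _ (dEta t v)
      [set y : G | y = z]).
    by right; right.
  by apply: sig_sub (sK z); exact: subsetUl.
split => //.
have vK z : fv K (\1_(meeting a (z, t)) : _ -> R) by exact: fin_valued_indic.
have vterm z : fv setT (fun x => (1 - xi_ t v x) * (eta_ t v z x * \1_(meeting a (z, t)) x)).
  apply: fin_valuedM.
    by apply: fin_valuedB; [exact: fin_valued_cst | exact: fv_xi].
  by apply: fin_valuedM; [exact: fv_eta | exact: fvT (vK z)].
have v1 : fv setT (\1_(meeting a (v, t.+1)) : _ -> R).
  by apply: fvT; exact: fin_valued_indic sm.
have v2 : fv setT (fun x => \sum_(z <- nbr v)
    (1 - xi_ t v x) * (eta_ t v z x * \1_(meeting a (z, t)) x)).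
  exact: fin_valued_sum.
have v3 : fv setT (fun x => 1 - \sum_(z <- nbr v) eta_ t v z x).
  apply: fin_valuedB; first exact: fin_valued_cst.
  by apply: fin_valued_sum => z; exact: fv_eta.
transitivity (EE (fun x => \sum_(z <- nbr v)
    (1 - xi_ t v x) * (eta_ t v z x * \1_(meeting a (z, t)) x))).
  apply/eqP; rewrite -subr_eq0 -normr_le0.
  have E0 : EE (fun x => 1 - \sum_(z <- nbr v) eta_ t v z x) = 0.
    rewrite (@E_sub _ _ _ P _ _ _ mZ setT setT) ?E_eta_total ?E_cst ?subrr//.
      exact: fin_valued_cst.
    by apply: fin_valued_sum => z; exact: fv_eta.
  (* The two functions can differ only where [eta] misses the neighbourhood, and the third one is
     the indicator of that null event. *)
  rewrite -[leRHS]E0; apply: (E_close v1 v2 v3) => x.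
  rewrite -mulr_sumr (sum_eta_ t v x (fun z => \1_(meeting a (z, t)) x)).
  have -> : \sum_(z <- nbr v) eta_ t v z x = \sum_(z <- nbr v) eta_ t v z x * 1.
    by apply: eq_bigr => z _; rewrite mulr1.
  rewrite (sum_eta_ t v x (fun=> 1)) !indicE.
  case: ifP => _; last first.
    by rewrite mulr0 !subr0; case: (_ \in _); rewrite ?normr1 ?normr0 ?ler01.
  rewrite subrr normr_le0 subr_eq0 /xi_; apply/eqP.
  have [xi|xi] := boolP (x (dXi t v) : bool).
    rewrite subrr mul0r memNset// => /meetE[].
    by rewrite xi.
  rewrite subr0 mul1r; congr ((nat_of_bool _)%:R).
  apply/idP/idP; rewrite !inE; first by move=> /meetE[].
  by move=> m; apply/meetE.
rewrite (@E_sum _ _ _ P _ _ _ mZ setT)// big_seq [RHS]big_seq; apply: eq_bigr => z zv.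
exact: E_step (vK z) nxi neta zv.
Qed.

Lemma E_X0_spin v : EE (spin (v, 0%N)) = 0.
Proof.
have v0 : fv setT (X0_ v) by exact: fv_X0.
rewrite [LHS](@E_sub _ _ _ P _ _ _ mZ setT setT) ?E_cst//.
- by rewrite (@E_scale _ _ _ P _ _ _ mZ setT)// E_X0; field.
- by apply: fin_valuedM => //; exact: fin_valued_cst.
- exact: fin_valued_cst.
Qed.

(** Induction on the sum of the times, expanding the later vertex. Both sides obey the same
    recursion, equal 1 when a = b, and equal 0 at two distinct vertices of time 0, whose signs are
    independent and centred. Measurability is proved along with the identity because the next step
    of the recursion uses it. *)
Lemma meeting_spin a b :
  sig (cone a `|` cone b) (meeting a b) /\
  EE (\1_(meeting a b)) = EE (fun x => spin a x * spin b x).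
Proof.
move: {2}(a.2 + b.2)%N (leqnn (a.2 + b.2)) => n; elim: n a b => [|n IH] a b abn.
  all: wlog ab : a b abn / (a.2 <= b.2)%N.
  1,3: move=> H; case: (leqP a.2 b.2) => [|/ltnW] ab; first exact: H.
  1,2: rewrite setUC meetingC (_ : (fun x => _) = fun x => spin b x * spin a x);
       [by apply: H; rewrite // addnC | by apply/funext => x; rewrite mulrC].
  all: have [<-|ne] := eqVneq a b.
  1,3: rewrite meeting_refl; split; first exact: sig_setT.
  1,2: rewrite (_ : (fun x => _) = \1_setT)//; apply/funext => x;
       by rewrite spin_sqr indicE mem_set.
  all: move: a b ab abn ne => [z s] [v [|t]] //= ab abn ne.
- have s0 : s = 0%N by lia.
  rewrite s0 in ne *; have zv : z != v by apply: contraNneq ne => ->.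
  rewrite meeting0//; split; first exact: sig0.
  rewrite (@E_mul _ _ _ P _ _ _ mZ iZ (cone (z, 0%N)) (cone (v, 0%N))).
  + rewrite E_X0_spin mul0r -[RHS](E_cst P Z); congr (EE _).
    by apply/funext => x; rewrite indicE in_set0.
  + apply/seteqP; split => // i [/= -> [e]]; by rewrite e eqxx in zv.
  + exact: fv_spin.
  + exact: fv_spin.
- by lia.
- have s0 : s = 0%N by lia.
  rewrite s0 in ne *; have zv : z != v by apply: contraNneq ne => ->.
  rewrite meeting0//; split; first exact: sig0.
  rewrite (@E_mul _ _ _ P _ _ _ mZ iZ (cone (z, 0%N)) (cone (v, 0%N))).
  + rewrite E_X0_spin mul0r -[RHS](E_cst P Z); congr (EE _).
    by apply/funext => x; rewrite indicE in_set0.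
  + apply/seteqP; split => // i [/= -> [e]]; by rewrite e eqxx in zv.
  + exact: fv_spin.
  + exact: fv_spin.
have IHz y : sig (cone (z, s) `|` past t) (meeting (z, s) (y, t)) /\
    EE (\1_(meeting (z, s) (y, t))) = EE (fun x => spin (z, s) x * spin (y, t) x).
  have [|h1 h2] := IH (z, s) (y, t); first by rewrite /=; lia.
  by split => //; apply: sig_sub h1; apply: setUS; exact: cone_past.
(* The inputs of (v, t+1) are fresh for both factors. For s = t + 1 this rests on z <> v, and is
   where [cone] must be finer than [past]. *)
have nc (i : D) : i = dXi t v \/ i = dY t v \/ i = dEta t v ->
    ~ cone (z, s) i /\ ~ past t i.
  move=> Hi; split; last by case: Hi => [|[|]] -> /=; lia.
  clear IHz; move: ab abn ne; case: s => [|s] ab abn ne.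
    by case: Hi => [|[|]] ->.
  case=> [|/=]; first by case: Hi => [|[|]] -> /=; lia.
  have zv : s = t -> z <> v by move=> st zv; rewrite st zv eqxx in ne.
  by case: Hi => [|[|]] -> [|[|]] // [] ts vz; exact: (zv (esym ts) (esym vz)).
have [] := @E_meeting_step (cone (z, s) `|` past t) (z, s) v t ab ne (fun y => (IHz y).1).
- by have [] := nc (dXi t v) (or_introl erefl) => h1 h2 [].
- by have [] := nc (dEta t v) (or_intror (or_intror erefl)) => h1 h2 [].
move=> sm Em; split.
  apply: sig_sub sm => i [[|]|] /=; first by left.
    by move=> pi; right; left.
  by move=> Hi; right; right; case: Hi => ->; [left | right; right].
rewrite Em E_spin_step.
- by apply: eq_bigr => y _; rewrite (IHz y).2.
- by have [] := nc (dXi t v) (or_introl erefl).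
- by have [] := nc (dY t v) (or_intror (or_introl erefl)).
- by have [] := nc (dEta t v) (or_intror (or_intror erefl)).
- move=> y /cone_past; exact: (nc (dXi t v) (or_introl erefl)).2.
- move=> y /cone_past; exact: (nc (dEta t v) (or_intror (or_intror erefl))).2.
Qed.

Lemma E_agree u d t : EE (agree u d t) = 2^-1 * (1 + p_td M u t d).
Proof.
have [sm Em] := meeting_spin (u, t) (u, (t + d)%N).
rewrite /p_td paths_meetE -(E_indic P mZ sm) Em.
have vs : fv setT (fun x => spin (u, t) x * spin (u, (t + d)%N) x).
  by apply: fin_valuedM; exact: fvT (fv_spin _).
rewrite -[X in X + _](E_cst P Z) -(@E_add _ _ _ P _ _ _ mZ setT setT)//; last first.
  exact: fin_valued_cst.
rewrite -(@E_scale _ _ _ P _ _ _ mZ setT).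
  congr (EE _); apply/funext => x; rewrite /agree /spin /=.
  case: (state_01 t u x) => ->; case: (state_01 (t + d) u x) => ->;
    rewrite ?eqxx ?[1 == 0]eq_sym ?(negbTE (oner_neq0 _)) /=;
    rewrite ?oner_eq0 ?[0 == 1]eq_sym ?oner_eq0 /=; by field.
by apply: fin_valuedD => //; exact: fin_valued_cst.
Qed.

End Meeting.
End Model.

(** * Variance asymptotics and Lindeberg's method *)

Section GeometricBounds.
Context {R : realType}.
Implicit Types (a : nat -> R) (c : nat -> nat -> R) (K q r rho C : R).

(** Nested intervals: with e the geometric tail, a - e increases and a + e decreases, so the infimum
    of a + e lies in every interval. Existence and rate come together. *)
Lemma geometric_increments a K q : 0 <= q < 1 ->
  (forall n, `|a n.+1 - a n| <= K * q ^+ n) ->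
  exists l, forall n, `|a n - l| <= K / (1 - q) * q ^+ n.
Proof.
move=> /andP[q0 q1] aK; have q10 : 0 < 1 - q by rewrite subr_gt0.
have K0 : 0 <= K by have := aK 0%N; rewrite expr0 mulr1; exact: le_trans.
pose e n := K / (1 - q) * q ^+ n.
have eS n : e n - e n.+1 = K * q ^+ n.
  by rewrite /e exprS; field; rewrite gt_eqF.
have e0 n : 0 <= e n by rewrite mulr_ge0 ?exprn_ge0// divr_ge0// ltW.
have inc m n : (m <= n)%N -> a m - e m <= a n - e n.
  move=> /subnKC <-; elim: (n - m)%N => [|k IH]; first by rewrite addn0.
  rewrite addnS (le_trans IH)//; have := aK (m + k)%N; rewrite -eS ler_norml; lra.
have dec m n : (m <= n)%N -> a n + e n <= a m + e m.
  move=> /subnKC <-; elim: (n - m)%N => [|k IH]; first by rewrite addn0.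
  rewrite addnS (le_trans _ IH)//; have := aK (m + k)%N; rewrite -eS ler_norml; lra.
have lb m n : a m - e m <= a n + e n.
  apply: (le_trans (inc m (maxn m n) (leq_maxl _ _))).
  apply: (le_trans _ (dec n (maxn m n) (leq_maxr _ _))).
  by have := e0 (maxn m n); lra.
pose B := [set a n + e n | n in [set: nat]].
exists (inf B) => n; rewrite -/(e n).
have h1 : inf B <= a n + e n.
  apply: ge_inf; last by exists n.
  by exists (a 0%N - e 0%N) => _ [m _ <-]; exact: lb.
have h2 : a n - e n <= inf B.
  apply: lb_le_inf; first by exists (a 0%N + e 0%N); exists 0%N.
  by move=> _ [m _ <-]; exact: lb.
by rewrite ler_norml; lra.
Qed.

(** Each of the n + 1 terms of 1 + r + ... + r^n is at least r^n. *)
Lemma linear_geometric_bound r n : 0 <= r < 1 ->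
  n.+1%:R * r ^+ n * (1 - r) <= 1 - r ^+ n.+1.
Proof.
move=> /andP[r0 r1]; elim: n => [|n IH]; first by rewrite expr0 mulr1 mul1r expr1.
have p0 : 0 <= r ^+ n.+1 by exact: exprn_ge0.
have p1 : r ^+ n.+1 <= 1 by rewrite exprn_ile1// ltW.
rewrite (_ : n.+2%:R = n.+1%:R + 1 :> R); last by rewrite -addn1 natrD.
rewrite (_ : (n.+1%:R + 1) * r ^+ n.+1 * (1 - r) =
  r * (n.+1%:R * r ^+ n * (1 - r)) + r ^+ n.+1 * (1 - r)); last by rewrite exprS; ring.
have := ler_wpM2l r0 IH; rewrite [r ^+ n.+2]exprS; nra.
Qed.

(** Take r = rho^(1/4): since 4 floor(n/2) >= 2n - 2, the power of rho is at most r^-2 r^n r^n. One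
    factor r^n absorbs n + 1, the other is the rate. *)
Lemma linear_geometric_half rho : 0 < rho < 1 -> exists K q, [/\ 0 <= K, 0 <= q < 1 &
  forall n, n.+1%:R * rho ^+ n./2 <= K * q ^+ n].
Proof.
move=> /andP[rho0 rho1]; pose r := Num.sqrt (Num.sqrt rho).
have r4 : r ^+ 4 = rho.
  by rewrite (_ : 4 = 2 * 2)%N// exprM !sqr_sqrtr ?sqrtr_ge0// ltW.
have r0 : 0 < r by rewrite !sqrtr_gt0.
have r1 : r < 1.
  by rewrite -(@ltr_pXn2r _ 4)// ?nnegrE ?(ltW r0)// r4 expr1n.
exists (r ^- 2 / (1 - r)), r; split.
- by rewrite divr_ge0 ?invr_ge0 ?exprn_ge0 ?subr_ge0 ?(ltW r0) ?(ltW r1).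
- by rewrite (ltW r0).
move=> n.
have h : rho ^+ n./2 <= r ^- 2 * (r ^+ n * r ^+ n).
  rewrite -r4 -exprM -exprD mulrC ler_pdivlMr ?exprn_gt0// -exprD.
  rewrite ler_wiXn2l ?(ltW r0) ?(ltW r1)//.
  by have := odd_double_half n; case: (odd n) => /=; rewrite -muln2; lia.
have lg : n.+1%:R * r ^+ n <= (1 - r)^-1.
  rewrite -[leRHS]mul1r ler_pdivlMr ?subr_gt0//.
  apply: (le_trans (linear_geometric_bound n _)); first by rewrite (ltW r0).
  by rewrite gerBl exprn_ge0 ?ltW.
have i2 : 0 <= r ^- 2 by rewrite invr_ge0 exprn_ge0 ?ltW.
have rn : 0 <= r ^+ n by rewrite exprn_ge0 ?ltW.
apply: (@le_trans _ _ (r ^- 2 * (n.+1%:R * r ^+ n) * r ^+ n)).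
  rewrite (_ : r ^- 2 * (n.+1%:R * r ^+ n) * r ^+ n =
    n.+1%:R * (r ^- 2 * (r ^+ n * r ^+ n))); last by ring.
  by apply: ler_wpM2l.
by apply: ler_wpM2r => //; apply: ler_wpM2l.
Qed.

Lemma sum_geometric_le rho n : 0 <= rho < 1 ->
  \sum_(0 <= i < n) rho ^+ i <= (1 - rho)^-1.
Proof.
move=> /andP[r0 r1]; have r10 : 0 < 1 - rho by rewrite subr_gt0.
rewrite -[leRHS]mul1r ler_pdivlMr//.
have -> : (\sum_(0 <= i < n) rho ^+ i) * (1 - rho) = 1 - rho ^+ n.
  elim: n => [|n IH]; first by rewrite big_geq// mul0r expr0 subrr.
  by rewrite big_nat_recr//= mulrDl IH exprS; ring.
by rewrite gerBl exprn_ge0.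
Qed.

Definition double_sum c n : R := \sum_(0 <= i < n) \sum_(0 <= j < n) c i j.

Lemma double_sumS c n : (forall i j, c i j = c j i) ->
  double_sum c n.+1 - double_sum c n = c n n + 2 * \sum_(0 <= i < n) c i n.
Proof.
move=> cC; rewrite /double_sum big_nat_recr//=.
under eq_bigr do rewrite big_nat_recr//=.
rewrite big_split/= big_nat_recr//=.
rewrite [X in _ + (X + _)](eq_bigr (fun i => c i n)) => [|i _]; last exact: cC.
by ring.
Qed.

(* Correlations decay geometrically both in the lag and in the distance to
   stationarity, so the increments of the variance converge geometrically. *)
Lemma double_sum_linear c C rho : 0 < rho < 1 -> 0 <= C ->
  (forall i j, c i j = c j i) ->
  (forall i j, (i <= j)%N -> `|c i j| <= C * rho ^+ (j - i)) ->
  (forall i j, (i <= j)%N -> `|c i.+1 j.+1 - c i j| <= C * rho ^+ i) ->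
  exists l B, [/\ forall n, `|double_sum c n - l * n%:R| <= B &
    (fun n => c n n + 2 * \sum_(0 <= i < n) c i n) @ \oo --> l].
Proof.
move=> rho01 C0 cC cdecay cstat; have /andP[rho0 rho1] := rho01.
have [K [q [K0 q01 Kq]]] := linear_geometric_half rho01.
have /andP[q0 q1] := q01.
pose a n := c n n + 2 * \sum_(0 <= i < n) c i n.
have ainc n : `|a n.+1 - a n| <= (7 * C * K) * q ^+ n.
  have -> : a n.+1 - a n = (c n.+1 n.+1 - c n n) + 2 * c 0%N n.+1 +
      2 * \sum_(0 <= i < n) (c i.+1 n.+1 - c i n).
    by rewrite /a big_nat_recl//= sumrB; ring.
  have rh m : (n./2 <= m)%N -> rho ^+ m <= rho ^+ n./2.
    by move=> nm; rewrite ler_wiXn2l// ltW.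
  have half : (n./2 <= n)%N by have := odd_double_half n; rewrite -muln2; lia.
  have h1 : `|c n.+1 n.+1 - c n n| <= C * rho ^+ n./2.
    by apply: (le_trans (cstat n n (leqnn _))); rewrite ler_wpM2l// rh.
  have h2 : `|2 * c 0%N n.+1| <= 2 * (C * rho ^+ n./2).
    rewrite normrM ger0_norm// ler_wpM2l//.
    by apply: (le_trans (cdecay _ _ (leq0n _))); rewrite ler_wpM2l// rh// subn0 ltnW.
  have h3 : `|2 * \sum_(0 <= i < n) (c i.+1 n.+1 - c i n)| <=
      2 * (n%:R * (2 * (C * rho ^+ n./2))).
    rewrite normrM ger0_norm// ler_wpM2l//.
    apply: (le_trans (ler_norm_sum _ _ _)).
    rewrite (_ : n%:R * _ = \sum_(0 <= i < n) (2 * (C * rho ^+ n./2))); last first.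
      by rewrite sumr_const_nat subn0 mulr_natl.
    rewrite big_nat_cond [leRHS]big_nat_cond; apply: ler_sum => i /andP[/andP[_ ni] _].
    (* Late rows are close to stationarity; early rows have a lag of order n. Either way the term is
       at most 2 C rho^(n/2), and the total 1 + 2 + 4n is below 7 (n + 1). *)
    have [hi|hi] := leqP n./2 i.
      apply: (le_trans (cstat _ _ (ltnW ni))).
      have := ler_wpM2l C0 (rh _ hi); have := mulr_ge0 C0 (exprn_ge0 n./2 (ltW rho0)).
      by lra.
    have hn : (n./2 <= n - i)%N.
      by have := odd_double_half n; rewrite -muln2; lia.
    apply: (le_trans (ler_normB _ _)); rewrite mulr_natl mulr2n; apply: lerD.
      by apply: (le_trans (cdecay i.+1 n.+1 (ltnW ni))); rewrite subSS ler_wpM2l// rh.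
    by apply: (le_trans (cdecay i n (ltnW ni))); rewrite ler_wpM2l// rh.
  apply: (@le_trans _ _ (7 * C * (n.+1%:R * rho ^+ n./2))); last first.
    by rewrite -!mulrA !ler_wpM2l.
  apply: (le_trans (ler_normD _ _)).
  apply: (@le_trans _ _ (C * rho ^+ n./2 + 2 * (C * rho ^+ n./2) +
      2 * (n%:R * (2 * (C * rho ^+ n./2))))).
    by apply: lerD => //; apply: (le_trans (ler_normD _ _)); exact: lerD.
  rewrite -[n.+1]addn1 natrD.
  have := mulr_ge0 C0 (exprn_ge0 n./2 (ltW rho0)); have : 0 <= n%:R :> R by [].
  nra.
have [l al] := geometric_increments q01 ainc.
set K' := (7 * C * K) / (1 - q) in al.
have K'0 : 0 <= K' by rewrite divr_ge0 ?subr_ge0 ?(ltW q1)// !mulr_ge0.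
exists l, (K' / (1 - q)); split.
  move=> n.
  have -> : double_sum c n - l * n%:R = \sum_(0 <= i < n) (a i - l).
    elim: n => [|n IH]; first by rewrite /double_sum !big_geq// mulr0 subrr.
    rewrite big_nat_recr//= -IH /a -double_sumS// -[n.+1]addn1 natrD; ring.
  apply: (le_trans (ler_norm_sum _ _ _)).
  apply: (@le_trans _ _ (\sum_(0 <= i < n) K' * q ^+ i)).
    by apply: ler_sum => i _; exact: al.
  by rewrite -mulr_sumr ler_wpM2l// sum_geometric_le.
apply: (@squeeze_cvgr _ _ _ _ (fun n => l - K' * q ^+ n) (fun n => l + K' * q ^+ n)).
- by apply: nearW => n; have := al n; rewrite /a ler_norml; lra.
- rewrite -[X in _ --> X]subr0 -(mulr0 K').
  apply: cvgB; first exact: cvg_cst.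
  by apply: cvgMr; apply: cvg_expr; rewrite ger0_norm.
- rewrite -[X in _ --> X]addr0 -(mulr0 K').
  apply: cvgD; first exact: cvg_cst.
  by apply: cvgMr; apply: cvg_expr; rewrite ger0_norm.
Qed.

(* Longer than the logarithmic gaps that separate the blocks, and shorter than
   any power of [N], as the third-moment error of Lindeberg's method requires. *)
Definition blk (N : nat) : nat := ((trunc_log 2 N).+1 ^ 2)%N.

Lemma cvg_trunc_log : trunc_log 2 n @[n --> \oo] --> \oo.
Proof.
apply/cvgnyPge => A; near=> n.
apply: trunc_log_max => //.
  near: n; exact: nbhs_infty_ge.
Unshelve. all: by end_near. Qed.

(** The ratio r = 16/17 satisfies r^-10 <= 2, so with k the binary logarithm of N, sqrt N >=
    r^(-5k). As (k + 1) r^k <= 1/(1 - r) = 17, the numerator (k + 1)^4 uses up four of the five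
    powers and r^k is left. *)
Lemma blk_sqrt_bound (N : nat) : (0 < N)%N ->
  (blk N)%:R ^+ 2 / Num.sqrt N%:R <= 17 ^+ 4 * (16 / 17) ^+ (trunc_log 2 N) :> R.
Proof.
move=> N0; set k := trunc_log 2 N; pose r : R := 16 / 17.
have r0 : 0 < r by rewrite divr_gt0.
have Nk : 2 ^+ k <= N%:R :> R.
  by rewrite -natrX ler_nat; apply: trunc_logP.
have sq : (r ^- 5) ^+ k <= Num.sqrt N%:R.
  rewrite -[leLHS]ger0_norm ?exprn_ge0 ?invr_ge0 ?exprn_ge0 ?(ltW r0)//.
  rewrite -sqrtr_sqr; apply: ler_wsqrtr; apply: le_trans Nk.
  rewrite -exprM mulnC exprM; apply: lerXn2r; rewrite ?nnegrE//.
    by rewrite exprn_ge0// invr_ge0 exprn_ge0// ltW.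
  by rewrite /r; lra.
have lb : k.+1%:R * r ^+ k <= 17.
  have := @linear_geometric_bound r k; rewrite (ltW r0) (_ : r < 1); last by rewrite /r; lra.
  move=> /(_ isT); have : 0 <= r ^+ k.+1 by rewrite exprn_ge0// ltW.
  by rewrite (_ : 1 - r = 1 / 17); [lra | rewrite /r; field].
have rk : 0 < r ^+ k by rewrite exprn_gt0.
rewrite ler_pdivrMr ?sqrtr_gt0 ?ltr0n//.
apply: (@le_trans _ _ (17 ^+ 4 * r ^+ k * (r ^- 5) ^+ k)); last first.
  by rewrite ler_wpM2l// mulr_ge0// ltW.
rewrite exprVn exprAC; set x := r ^+ k in lb rk *.
rewrite /blk natrX -/k -exprM -mulrA.
rewrite (_ : x / x ^+ 5 = x ^- 4); last by field; rewrite gt_eqF.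
rewrite ler_pdivlMr ?exprn_gt0// -exprMn lerXn2r ?nnegrE//.
by rewrite mulr_ge0// ltW.
Qed.

End GeometricBounds.

(** * Lindeberg replacement for independent centred bounded blocks *)

Section Lindeberg.
Context {R : realType} {disp : measure_display} {Omega : measurableType disp}.
Variable P : probability Omega R.
Variables (I : choiceType) (T : I -> Type) (Z : forall i : I, Omega -> T i).
Hypothesis mZ : forall i (A : set (T i)), measurable (Z i @^-1` A).
Hypothesis iZ : mutually_independent P Z.
Implicit Types (f g : (forall i, T i) -> R).

Local Notation EE := (E P Z).

Let fvT J f : fin_valued J f -> fin_valued setT f.
Proof. exact: fin_valued_sub. Qed.

(** Adding [g] to the point and adding its variance to the Gaussian have the same expansion: the
    linear term vanishes with the mean, and the heat equation identifies the second-order terms,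
    both equal to [- q * v]. Only the two remainders are left. *)
Lemma lindeberg_step J g (delta b y x : R) : 0 < delta -> fin_valued J g ->
  EE g = 0 -> (forall w, `|g w| <= b) ->
  `|EE (fun w => gauss_below delta y (x + g w)) -
     gauss_below (delta + EE (fun w => g w ^+ 2)) y x|
  <= 16 / Num.sqrt delta ^+ 3 * b ^+ 3 + 12 * (b ^+ 2 / delta) ^+ 2.
Proof.
move=> d0 vg g0 gb; set v := EE (fun w => g w ^+ 2).
have vg2 : fin_valued J (fun w => g w ^+ 2) by exact: (fin_valued_op1 (fun a => a ^+ 2)).
have b0 : 0 <= b.
  rewrite -(E_cst P Z b) -[leLHS](E_cst P Z).
  apply: (@E_le _ _ _ P _ _ _ mZ J J); try exact: fin_valued_cst.
  by move=> w; exact: le_trans (gb w).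
have v0 : 0 <= v by apply: (E_ge0 P mZ vg2) => w; exact: sqr_ge0.
have vb : v <= b ^+ 2.
  rewrite -[leRHS](E_cst P Z); apply: (@E_le _ _ _ P _ _ _ mZ J J) => //.
    exact: fin_valued_cst.
  by move=> w; rewrite -real_normK ?num_real// lerXn2r ?nnegrE.
have d3 : 0 <= 16 / Num.sqrt delta ^+ 3.
  by rewrite divr_ge0// exprn_ge0// sqrtr_ge0.
set z := (y - x) / Num.sqrt delta.
pose p := stdphi z / Num.sqrt delta; pose q := 2^-1 * (z * stdphi z) / delta.
have vF : fin_valued J (fun w => gauss_below delta y (x + g w)).
  exact: (fin_valued_op1 (fun a => gauss_below delta y (x + a))).
have vQ : fin_valued J (fun w => gauss_below delta y x - p * g w - q * g w ^+ 2).
  exact: (fin_valued_op1 (fun a => gauss_below delta y x - p * a - q * a ^+ 2)).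
have EQ : EE (fun w => gauss_below delta y x - p * g w - q * g w ^+ 2) =
    gauss_below delta y x - q * v.
  have vp : fin_valued J (fun w => p * g w) by exact: (fin_valued_op1 (fun a => p * a)).
  have vq : fin_valued J (fun w => q * g w ^+ 2).
    exact: (fin_valued_op1 (fun a => q * a ^+ 2)).
  have vc : fin_valued J (fun _ : (forall i, T i) => gauss_below delta y x) by exact: fin_valued_cst.
  rewrite (@E_sub _ _ _ P _ _ _ mZ J J)//; last exact: fin_valuedB.
  rewrite (@E_sub _ _ _ P _ _ _ mZ J J)// E_cst (E_scale _ mZ _ vg) g0 mulr0 subr0.
  by rewrite (E_scale _ mZ _ vg2).
have h1 : `|EE (fun w => gauss_below delta y (x + g w)) - (gauss_below delta y x - q * v)|
    <= 16 / Num.sqrt delta ^+ 3 * b ^+ 3.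
  rewrite -EQ -(@E_sub _ _ _ P _ _ _ mZ J J)//.
  have vd := fin_valuedB vF vQ.
  apply: (le_trans (E_norm P mZ vd)); rewrite -[leRHS](E_cst P Z).
  apply: (@E_le _ _ _ P _ _ _ mZ J J).
  - exact: (fin_valued_op1 (fun a => `|a|) vd).
  - exact: fin_valued_cst.
  - move=> w; have := @gauss_below_taylor R delta y x (g w) d0 z erefl.
    rewrite -/p -/q => H; apply: (le_trans _ (le_trans H _)).
      by rewrite le_eqVlt; apply/orP; left; apply/eqP; congr `|_|; ring.
    by rewrite ler_wpM2l// lerXn2r ?nnegrE.
have h2 := @gauss_below_heat R delta v y x d0 v0 z erefl.
rewrite -/q in h2.
have h3 : 12 * (v / delta) ^+ 2 <= 12 * (b ^+ 2 / delta) ^+ 2.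
  rewrite ler_wpM2l// lerXn2r ?nnegrE ?divr_ge0 ?sqr_ge0 ?(ltW d0)//.
  by rewrite ler_pM2r// invr_gt0.
rewrite (_ : _ - _ = (EE (fun w => gauss_below delta y (x + g w)) -
    (gauss_below delta y x - q * v)) -
    (gauss_below (delta + v) y x - gauss_below delta y x + q * v)); last by ring.
apply: (le_trans (ler_normB _ _)); apply: lerD => //.
exact: le_trans h2 h3.
Qed.

Variables (J K : nat -> set I) (B : nat -> (forall i, T i) -> R) (b : R).
Hypothesis JK : forall k, J k `&` K k = set0.
Hypothesis JS : forall k, J k `<=` J k.+1.
Hypothesis KJ : forall k, K k `<=` J k.+1.
Hypothesis vB : forall k, fin_valued (K k) (B k).
Hypothesis B0 : forall k, EE (B k) = 0.
Hypothesis Bb : forall k x, `|B k x| <= b.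

Definition partial_sum k x : R := \sum_(0 <= j < k) B j x.

Lemma fv_partial_sum k : fin_valued (J k) (partial_sum k).
Proof.
elim: k => [|k IH].
  rewrite (_ : partial_sum 0 = fun=> 0); first exact: fin_valued_cst.
  by apply/funext => x; rewrite /partial_sum big_geq.
rewrite (_ : partial_sum k.+1 = fun x => partial_sum k x + B k x); last first.
  by apply/funext => x; rewrite /partial_sum big_nat_recr.
by apply: fin_valuedD; [exact: fin_valued_sub IH | exact: fin_valued_sub (vB k)].
Qed.

Lemma E_partial_sum_sqr k : EE (fun x => partial_sum k.+1 x ^+ 2) =
  EE (fun x => partial_sum k x ^+ 2) + EE (fun x => B k x ^+ 2).
Proof.
have vU := fv_partial_sum k.
have vU2 := fin_valued_op1 (fun a => a ^+ 2) vU.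
have vB2 := fin_valued_op1 (fun a => a ^+ 2) (vB k).
have vUB : fin_valued setT (fun x => partial_sum k x * B k x).
  by apply: fin_valuedM; [exact: fvT vU | exact: fvT (vB k)].
rewrite (_ : (fun x => partial_sum k.+1 x ^+ 2) = (fun x =>
  (partial_sum k x ^+ 2 + B k x ^+ 2) + 2 * (partial_sum k x * B k x))); last first.
  by apply/funext => x; rewrite /partial_sum big_nat_recr//=; ring.
rewrite (@E_add _ _ _ P _ _ _ mZ setT setT).
- rewrite (E_scale _ mZ _ vUB) (E_mul mZ iZ (JK k) vU (vB k)) B0 !mulr0 addr0.
  by rewrite (E_add P mZ vU2 vB2).
- by apply: fin_valuedD; [exact: fvT vU2 | exact: fvT vB2].
- by apply: fin_valuedM => //; exact: fin_valued_cst.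
Qed.

(** Each step converts the last block into Gaussian variance, so the induction must hold for every
    [delta]. *)
Lemma lindeberg k (delta y : R) : 0 < delta ->
  `|EE (fun x => gauss_below delta y (partial_sum k x)) -
    gauss_below (delta + EE (fun x => partial_sum k x ^+ 2)) y 0| <=
  k%:R * (16 / Num.sqrt delta ^+ 3 * b ^+ 3 + 12 * (b ^+ 2 / delta) ^+ 2).
Proof.
have b0 : 0 <= b.
  rewrite -(E_cst P Z b) -[leLHS](E_cst P Z).
  apply: (@E_le _ _ _ P _ _ _ mZ setT setT); try exact: fin_valued_cst.
  by move=> w; exact: le_trans (Bb 0 w).
elim: k delta => [|k IH] delta d0.
  have -> : partial_sum 0 = fun=> 0.
    by apply/funext => x; rewrite /partial_sum big_geq.
  by rewrite !E_cst expr0n/= addr0 subrr normr0 mul0r.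
set v := EE (fun x => B k x ^+ 2).
have v0 : 0 <= v.
  apply: (E_ge0 P mZ (fin_valued_op1 (fun a => a ^+ 2) (vB k))) => w; exact: sqr_ge0.
have step : `|EE (fun x => gauss_below delta y (partial_sum k x + B k x)) -
    EE (fun x => gauss_below (delta + v) y (partial_sum k x))| <=
    16 / Num.sqrt delta ^+ 3 * b ^+ 3 + 12 * (b ^+ 2 / delta) ^+ 2.
  apply: (E_replace mZ iZ (h := fun a c => gauss_below delta y (a + c))
    (k := fun a => gauss_below (delta + v) y a) (JK k) (fv_partial_sum k) (vB k)).
  by move=> a; apply: (lindeberg_step _ _ d0 (vB k)).
have dv : 0 < delta + v by rewrite ltr_wpDr.
have := IH (delta + v) dv.
rewrite E_partial_sum_sqr -/v -addrA [v + _]addrC => IHk.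
(* The accumulated variance only improves the error, so every step is charged at the initial
   [delta]. *)
have mono : 16 / Num.sqrt (delta + v) ^+ 3 * b ^+ 3 + 12 * (b ^+ 2 / (delta + v)) ^+ 2 <=
    16 / Num.sqrt delta ^+ 3 * b ^+ 3 + 12 * (b ^+ 2 / delta) ^+ 2.
  have inv : (delta + v)^-1 <= delta^-1 by rewrite lef_pV2 ?posrE// lerDl.
  have sd : 0 < Num.sqrt delta by rewrite sqrtr_gt0.
  have sdv : 0 < Num.sqrt (delta + v) by rewrite sqrtr_gt0.
  apply: lerD.
    apply: ler_wpM2r; first exact: exprn_ge0.
    rewrite ler_wpM2l// lef_pV2 ?posrE ?exprn_gt0//.
    by rewrite lerXn2r ?nnegrE ?(ltW sd) ?(ltW sdv)// ler_wsqrtr// lerDl.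
  rewrite ler_wpM2l// lerXn2r ?nnegrE ?divr_ge0 ?sqr_ge0 ?(ltW d0) ?(ltW dv)//.
  by rewrite ler_wpM2l// sqr_ge0.
rewrite (_ : (fun x => gauss_below delta y (partial_sum k.+1 x)) =
  (fun x => gauss_below delta y (partial_sum k x + B k x))); last first.
  by apply/funext => x; rewrite /partial_sum big_nat_recr.
rewrite -[k.+1]addn1 natrD mulrDl mul1r [leRHS]addrC.
rewrite -[X in `|X|](subrKA (EE (fun x => gauss_below (delta + v) y (partial_sum k x)))).
apply: (le_trans (ler_normD _ _)); apply: lerD => //.
by apply: (le_trans IHk); rewrite ler_wpM2l.
Qed.

End Lindeberg.

(** * Block decomposition of the repetition statistic *)

Section Blocks.
Context {R : realType} {disp : measure_display} {Omega : measurableType disp}.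
Context {P : probability Omega R} {G : lfgraph} {eps : R}.
Variable M : nvm_input P G eps.
Hypothesis eps01 : 0 < eps < 1.
Hypothesis nbr_n0 : forall v : G, nbr v != fset0.
Variables (u : G) (d kappa : nat).
Hypothesis kappa_gt0 : (0 < kappa)%N.

Local Notation D := {classic (driver G)}.
Local Notation input := (forall i : D, driver_val (i : driver G)).
Local Notation fv := (@fin_valued R D (fun i : D => driver_val (i : driver G))).
Local Notation EE := (E P (nvm_rv M)).
Local Notation mZ := (measurable_nvm_rv M).
Local Notation iZ := (indep_nvm_rv M).
Local Notation rho := (1 - eps).

Let rho0 : 0 < rho. Proof. exact: rho_gt0. Qed.
Let rho1 : rho < 1. Proof. exact: rho_lt1. Qed.

Let fvT J f : fv J f -> fv setT f. Proof. exact: fin_valued_sub. Qed.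

(* Summation indices are shifted by one: index [i] stands for [i.+1]. *)
Definition rep i : input -> R := agree u d (kappa * i.+1).
Definition crep i x : R := rep i x - EE (rep i).
Definition rep_cov i j : R := cov M (rep i) (rep j).

Lemma fv_rep i : fv setT (rep i).
Proof. exact: fvT (fv_agree u d _). Qed.

Lemma fv_crep i : fv setT (crep i).
Proof. by apply: fin_valuedB; [exact: fv_rep | exact: fin_valued_cst]. Qed.

Lemma E_center f : fv setT f -> EE (fun x => f x - EE f) = 0.
Proof.
move=> vf; rewrite (@E_sub _ _ _ P _ _ _ mZ setT setT)//; last exact: fin_valued_cst.
by rewrite E_cst subrr.
Qed.

Lemma E_crepM i j : EE (fun x => crep i x * crep j x) = rep_cov i j.
Proof.
have vi := fv_rep i; have vj := fv_rep j.
rewrite (_ : (fun x => crep i x * crep j x) = (fun x =>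
  (rep i x * rep j x - EE (rep j) * rep i x) - EE (rep i) * crep j x)); last first.
  by apply/funext => x; rewrite /crep; ring.
have vij := fin_valuedM vi vj.
have v1 : fv setT (fun x => EE (rep j) * rep i x).
  by apply: fin_valuedM => //; exact: fin_valued_cst.
have v2 : fv setT (fun x => EE (rep i) * crep j x).
  by apply: fin_valuedM; [exact: fin_valued_cst | exact: fv_crep].
rewrite (@E_sub _ _ _ P _ _ _ mZ setT setT)//; last exact: fin_valuedB.
rewrite (@E_sub _ _ _ P _ _ _ mZ setT setT)// (E_scale _ mZ _ vi).
by rewrite (E_scale _ mZ _ (fv_crep j)) E_center// mulr0 subr0 mulrC.
Qed.

Lemma rep_covC i j : rep_cov i j = rep_cov j i.
Proof.
rewrite /rep_cov /cov; congr (_ - _); last by rewrite mulrC.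
by congr (EE _); apply/funext => x; rewrite mulrC.
Qed.

(** The 16 comes from stationarity. The factor 1/rho^d pays for an indicator extending [d] steps
    further: decay is counted from t + d, and overlapping pairs have only the bound 1. *)
Definition cov_const : R := 16 / rho ^+ d.

Lemma cov_const_ge16 : 16 <= cov_const.
Proof.
rewrite /cov_const ler_pdivlMr ?exprn_gt0// ler_piMr//.
by rewrite exprn_ile1// ltW.
Qed.

Lemma cov_const_ge0 : 0 <= cov_const.
Proof. exact: le_trans cov_const_ge16. Qed.

Lemma rep_cov_decay i j : (i <= j)%N ->
  `|rep_cov i j| <= cov_const * rho ^+ (j - i).
Proof.
move=> ij; have rd : 0 < rho ^+ d by rewrite exprn_gt0.
suff h : `|rep_cov i j| * rho ^+ d <= rho ^+ (j - i).
  rewrite /cov_const mulrAC ler_pdivlMr//; apply: (le_trans h).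
  by rewrite ler_peMl ?exprn_ge0 ?(ltW rho0)// ler1n.
have [h|h] := leqP (kappa * i.+1 + d) (kappa * j.+1).
  apply: (@le_trans _ _ (rho ^+ (kappa * j.+1 - (kappa * i.+1 + d)) * rho ^+ d)).
    by rewrite ler_pM2r//; exact: cov_agree_decay.
  rewrite -exprD ler_wiXn2l ?(ltW rho0) ?(ltW rho1)//.
  have : (kappa * (j - i) >= j - i)%N by rewrite leq_pmull.
  by rewrite mulnBr !mulnS in h *; lia.
apply: (@le_trans _ _ (1 * rho ^+ d)).
  by rewrite ler_pM2r//; exact: cov_agree_le1.
rewrite mul1r ler_wiXn2l ?(ltW rho0) ?(ltW rho1)//.
have : (kappa * (j - i) >= j - i)%N by rewrite leq_pmull.
by rewrite mulnBr !mulnS in h *; lia.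
Qed.

Lemma rep_cov_stationary i j : (i <= j)%N ->
  `|rep_cov i.+1 j.+1 - rep_cov i j| <= cov_const * rho ^+ i.
Proof.
move=> ij; rewrite /rep_cov /rep ![(kappa * _.+2)%N]mulnS ![(kappa + _)%N]addnC.
apply: (le_trans (cov_agree_stationary M eps01 nbr_n0 u d kappa _)).
  by rewrite leq_mul2l ltnS ij orbT.
apply: ler_pM; rewrite ?exprn_ge0 ?(ltW rho0) ?cov_const_ge16//.
rewrite ler_wiXn2l ?(ltW rho0) ?(ltW rho1)//.
by rewrite (leq_trans (leqnSn i))// leq_pmull.
Qed.

Definition csum N x : R := \sum_(0 <= i < N) crep i x.

Lemma E_sum_crep_sqr N (p : pred nat) :
  EE (fun x => (\sum_(0 <= i < N | p i) crep i x) ^+ 2) =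
  \sum_(0 <= i < N | p i) \sum_(0 <= j < N | p j) rep_cov i j.
Proof.
rewrite (_ : (fun x => _) = (fun x => \sum_(0 <= i < N | p i)
    \sum_(0 <= j < N | p j) (crep i x * crep j x))); last first.
  apply/funext => x; rewrite expr2 mulr_suml; apply: eq_bigr => i _.
  by rewrite mulr_sumr.
have vij i j : fv setT (fun x => crep i x * crep j x).
  by apply: fin_valuedM; exact: fv_crep.
rewrite (@E_sum _ _ _ P _ _ _ mZ setT); last by move=> i; exact: fin_valued_sum.
apply: eq_bigr => i _; rewrite (@E_sum _ _ _ P _ _ _ mZ setT)//.
by apply: eq_bigr => j _; exact: E_crepM.
Qed.

Lemma E_csum_sqr N : EE (fun x => csum N x ^+ 2) = double_sum rep_cov N.
Proof. exact: (E_sum_crep_sqr N xpredT). Qed.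

Lemma fv_csum N : fv setT (csum N).
Proof. by apply: fin_valued_sum => i; exact: fv_crep. Qed.

Definition row_const : R := 2 * cov_const / (1 - rho).

Lemma row_sum_le N i : (i < N)%N ->
  \sum_(0 <= j < N) `|rep_cov i j| <= row_const.
Proof.
move=> iN; rewrite (@big_cat_nat _ _ _ i)//= ?(ltnW iN)//.
have r01 : 0 <= rho < 1 by rewrite rho1 ltW.
have half : cov_const / (1 - rho) + cov_const / (1 - rho) = row_const.
  by rewrite /row_const; ring.
rewrite -half; apply: lerD.
  rewrite big_nat_rev/= add0n.
  apply: (@le_trans _ _ (\sum_(0 <= j < i) cov_const * rho ^+ j)).
    rewrite big_nat_cond [leRHS]big_nat_cond; apply: ler_sum => j /andP[/andP[_ ji] _].
    rewrite rep_covC; apply: (le_trans (rep_cov_decay _)); first by lia.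
    rewrite ler_wpM2l ?cov_const_ge0// ler_wiXn2l ?(ltW rho0) ?(ltW rho1)//; lia.
  by rewrite -mulr_sumr ler_wpM2l ?cov_const_ge0// sum_geometric_le.
rewrite -{1}[i]add0n big_addn.
apply: (@le_trans _ _ (\sum_(0 <= j < N - i) cov_const * rho ^+ j)).
  apply: ler_sum => j _; apply: (le_trans (rep_cov_decay _)); first by lia.
  by rewrite addnK.
by rewrite -mulr_sumr ler_wpM2l ?cov_const_ge0// sum_geometric_le.
Qed.

Lemma row_const_ge0 : 0 <= row_const.
Proof.
have h := cov_const_ge0.
by rewrite /row_const divr_ge0 ?subr_ge0 ?(ltW rho1)// mulr_ge0.
Qed.

(** Stated for an arbitrary subset of indices, so that the indices dropped from the blocks cost only
    in proportion to their number. *)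
Lemma E_sum_crep_sqr_le N (p : pred nat) :
  EE (fun x => (\sum_(0 <= i < N | p i) crep i x) ^+ 2) <=
  row_const * (\sum_(0 <= i < N) p i)%N%:R.
Proof.
rewrite E_sum_crep_sqr natr_sum mulr_sumr big_mkcond/=.
rewrite big_nat_cond [leRHS]big_nat_cond; apply: ler_sum => i /andP[/andP[_ iN] _].
case: (p i); last by rewrite mulr0.
rewrite mulr1; apply: le_trans (row_sum_le iN).
rewrite big_mkcond/=; apply: ler_sum => j _.
by case: (p j) => //; exact: ler_norm.
Qed.

Section Truncation.
Variables (g L : nat).
Hypothesis dg : (d <= g)%N.
Hypothesis L0 : (0 < L)%N.

(** The last time read by the indicators with index below j L; the windows of successive blocks are
    therefore disjoint. *)
Definition block_start j : nat := (kappa * (j * L) + d)%N.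

(** Meaningful once the block start is at most the time of the indicator; before that the
    subtractions in [agree_from] truncate. The sums retain only indices with [g <= i %% L], for
    which [block_start_le] applies. *)
Definition trep i : input -> R :=
  agree_from u d (block_start (i %/ L)) (kappa * i.+1).
Definition ctrep i x : R := trep i x - EE (trep i).

Lemma fv_trep_all i : fv setT (trep i).
Proof. by apply: fv_eqb; exact: fv_restart. Qed.

Lemma fv_ctrep_all i : fv setT (ctrep i).
Proof. by apply: fin_valuedB; [exact: fv_trep_all | exact: fin_valued_cst]. Qed.

Lemma block_start_le i : (g <= i %% L)%N ->
  (block_start (i %/ L) + (g - d) <= kappa * i.+1)%N.
Proof.
move=> gi; rewrite /block_start.
have h : (kappa * (i %/ L * L) + kappa * (i %% L).+1 = kappa * i.+1)%N.
  by rewrite -mulnDr addnS -divn_eq.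
have : ((i %% L).+1 <= kappa * (i %% L).+1)%N by rewrite leq_pmull.
by lia.
Qed.

Lemma block_end_le i j : (i < j.+1 * L)%N -> (kappa * i.+1 + d <= block_start j.+1)%N.
Proof. by move=> ij; rewrite /block_start leq_add2r leq_mul2l ij orbT. Qed.

Lemma E_trep_near i : (g <= i %% L)%N ->
  EE (fun x => `|crep i x - ctrep i x|) <= 4 * rho ^+ (g - d).
Proof.
move=> gi; have h := block_start_le gi.
set s := block_start (i %/ L) in h *; have st : (s <= kappa * i.+1)%N by lia.
have vl : fv setT (lost u d s (kappa * i.+1)) by exact: fvT (fv_lost u d st).
have El : EE (lost u d s (kappa * i.+1)) <= 2 * rho ^+ (g - d).
  apply: (le_trans (E_lost M eps01 nbr_n0 u d st)).
  by rewrite ler_wpM2l// ler_wiXn2l ?(ltW rho0) ?(ltW rho1)//; lia.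
have near x : `|rep i x - trep i x| <= lost u d s (kappa * i.+1) x.
  exact: agree_from_near.
have Em := E_close M (fv_rep i) (fv_trep_all i) vl near.
apply: (@le_trans _ _ (EE (fun x => lost u d s (kappa * i.+1) x + 2 * rho ^+ (g - d)))).
  apply: (@E_le _ _ _ P _ _ _ mZ setT setT).
  - apply: (fin_valued_op1 (fun a => `|a|)).
    by apply: fin_valuedB; [exact: fv_crep | exact: fv_ctrep_all].
  - by apply: fin_valuedD => //; exact: fin_valued_cst.
  - move=> x; rewrite (_ : crep i x - ctrep i x =
      (rep i x - trep i x) - (EE (rep i) - EE (trep i))); last first.
      by rewrite /crep /ctrep; ring.
    apply: (le_trans (ler_normB _ _)); apply: lerD; first exact: near.
    exact: le_trans Em El.
rewrite (@E_add _ _ _ P _ _ _ mZ setT setT)// ?E_cst; last exact: fin_valued_cst.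
by lra.
Qed.

Definition kept N i := (i < N %/ L * L)%N && (g <= i %% L)%N.

Definition tsum N x : R := \sum_(0 <= i < N | kept N i) ctrep i x.

Lemma count_lost N : (\sum_(0 <= i < N) (~~ kept N i) <= N %/ L * g + L)%N.
Proof.
have blk1 J : (\sum_(0 <= i < J * L) (i %% L < g) <= J * g)%N.
  elim: J => [|J IH]; first by rewrite mul0n big_geq.
  rewrite mulSnr (@big_cat_nat _ _ _ (J * L))//= ?leq_addr//.
  rewrite mulSnr leq_add// -{1}[(J * L)%N]add0n big_addn addKn.
  apply: (@leq_trans (\sum_(0 <= i < L) (i < g))%N).
    rewrite big_nat_cond [leqRHS]big_nat_cond; apply: leq_sum => i /andP[/andP[_ iL] _].
    by rewrite addnC modnMDl modn_small.
  elim: L => [|l IHl]; first by rewrite big_geq.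
  case: (leqP l.+1 g) => lg.
    rewrite (@leq_trans (\sum_(0 <= i < l.+1) 1)%N)//.
      by apply: leq_sum => i _; case: (_ < _)%N.
    by rewrite sum_nat_const_nat subn0 muln1.
  by rewrite big_nat_recr//= (_ : (l < g)%N = false) ?addn0//; lia.
have JN : (N %/ L * L <= N)%N by exact: leq_trunc_div.
rewrite (@big_cat_nat _ _ _ (N %/ L * L))//=; apply: leq_add.
  apply: leq_trans (blk1 _).
  rewrite big_nat_cond [leqRHS]big_nat_cond; apply: leq_sum => i /andP[/andP[_ iJ] _].
  by rewrite /kept iJ/= -ltnNge.
apply: (@leq_trans (\sum_(N %/ L * L <= i < N) 1)%N).
  by apply: leq_sum => i _; case: (kept _ _).
rewrite sum_nat_const_nat muln1 leq_subLR {1}(divn_eq N L) leq_add2l ltnW//.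
exact: ltn_pmod.
Qed.

Lemma ctrep_bound i x : `|ctrep i x| <= 1.
Proof.
have b x0 : 0 <= trep i x0 <= 1 by exact: agree_from_bound.
have := b x; have := E_01 M (fv_trep_all i) b.
by rewrite /ctrep ler_norml; lra.
Qed.

Lemma crep_bound i x : `|crep i x| <= 1.
Proof.
have b x0 : 0 <= rep i x0 <= 1 by exact: agree_bound.
have := b x; have := E_01 M (fv_rep i) b.
by rewrite /crep ler_norml; lra.
Qed.

Lemma fv_tsum N : fv setT (tsum N).
Proof. by apply: fin_valued_sum => i; exact: fv_ctrep_all. Qed.

(** Dropped indices are controlled by covariances. For restarted ones the square is at most the sup
    bound 2N times the sum of the N mean errors 4 rho^(g-d); with the 2 from (a + b)^2 <= 2 a^2 + 2
    b^2 this makes 16. *)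
Lemma E_truncation_error N : EE (fun x => (csum N x - tsum N x) ^+ 2) <=
  2 * row_const * (N %/ L * g + L)%N%:R + 16 * N%:R ^+ 2 * rho ^+ (g - d).
Proof.
pose q i := ~~ kept N i.
pose a x := \sum_(0 <= i < N | q i) crep i x.
pose b x := \sum_(0 <= i < N | kept N i) (crep i x - ctrep i x).
have vdiff i : fv setT (fun x => crep i x - ctrep i x).
  by apply: fin_valuedB; [exact: fv_crep | exact: fv_ctrep_all].
have va : fv setT a by apply: fin_valued_sum => i; exact: fv_crep.
have vb : fv setT b by exact: fin_valued_sum.
have ab x : csum N x - tsum N x = a x + b x.
  rewrite /csum /tsum /a /b (bigID (kept N) xpredT)/= [X in _ = _ + X]sumrB.
  by rewrite addrAC addrC.
have va2 := fin_valued_op1 (fun t => 2 * t ^+ 2) va.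
have vb2 := fin_valued_op1 (fun t => 2 * t ^+ 2) vb.
have va3 := fin_valued_op1 (fun t => t ^+ 2) va.
have vb3 := fin_valued_op1 (fun t => t ^+ 2) vb.
apply: (@le_trans _ _ (EE (fun x => 2 * a x ^+ 2 + 2 * b x ^+ 2))).
  apply: (@E_le _ _ _ P _ _ _ mZ setT setT).
  - apply: (fin_valued_op1 (fun t => t ^+ 2)).
    by apply: fin_valuedB; [exact: fv_csum | exact: fv_tsum].
  - exact: fin_valuedD.
  - by move=> x; rewrite ab; have := sqr_ge0 (a x - b x); nra.
rewrite (@E_add _ _ _ P _ _ _ mZ setT setT)//.
rewrite (E_scale _ mZ _ va3) (E_scale _ mZ _ vb3); apply: lerD.
  rewrite -mulrA ler_wpM2l//; apply: (le_trans (E_sum_crep_sqr_le N q)).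
  by rewrite ler_wpM2l ?row_const_ge0// ler_nat count_lost.
have dif2 i x : `|crep i x - ctrep i x| <= 2.
  apply: (le_trans (ler_normB _ _)).
  by have := crep_bound i x; have := ctrep_bound i x; lra.
have vabs i : fv setT (fun x => `|crep i x - ctrep i x|).
  exact: (fin_valued_op1 (fun t => `|t|) (vdiff i)).
have vsum : fv setT (fun x => \sum_(0 <= i < N | kept N i) `|crep i x - ctrep i x|).
  exact: fin_valued_sum.
have bN x : `|b x| <= 2 * N%:R.
  apply: (le_trans (ler_norm_sum _ _ _)).
  apply: (@le_trans _ _ (\sum_(0 <= i < N) 2)).
    by rewrite big_mkcond/=; apply: ler_sum => i _; case: ifP => _; rewrite ?dif2.
  by rewrite sumr_const_nat subn0 [leRHS]mulr_natr.
have : EE (fun x => b x ^+ 2) <= EE (fun x => 2 * N%:R *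
    \sum_(0 <= i < N | kept N i) `|crep i x - ctrep i x|).
  apply: (@E_le _ _ _ P _ _ _ mZ setT setT) => //.
    by apply: fin_valuedM => //; exact: fin_valued_cst.
  move=> x; rewrite -real_normK ?num_real// expr2.
  by apply: ler_pM => //; exact: ler_norm_sum.
rewrite (E_scale _ mZ _ vsum) (@E_sum _ _ _ P _ _ _ mZ setT)// => h.
have h2 : \sum_(0 <= i < N | kept N i) EE (fun x => `|crep i x - ctrep i x|) <=
    N%:R * (4 * rho ^+ (g - d)).
  rewrite (_ : N%:R * _ = \sum_(0 <= i < N) (4 * rho ^+ (g - d))); last first.
    by rewrite sumr_const_nat subn0 mulr_natl.
  rewrite big_mkcond/=; apply: ler_sum => i _; case: ifP => [/andP[_ gi]|_].
    exact: E_trep_near.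
  by rewrite mulr_ge0// exprn_ge0// ltW.
have N0 : 0 <= 2 * N%:R :> R by [].
have := ler_wpM2l N0 h2; set X := \sum_(0 <= i < N | _) _ in h h2 *.
rewrite (_ : 16 * N%:R ^+ 2 * rho ^+ (g - d) =
  2 * (2 * N%:R * (N%:R * (4 * rho ^+ (g - d))))); last by ring.
by lra.
Qed.

Definition bsum j x : R := \sum_(j * L <= i < j.+1 * L | (g <= i %% L)%N) ctrep i x.

Lemma tsum_blocks N x : tsum N x = partial_sum bsum (N %/ L) x.
Proof.
rewrite /tsum /partial_sum; have JN : (N %/ L * L <= N)%N by exact: leq_trunc_div.
rewrite (@big_cat_nat _ _ _ (N %/ L * L))//= [X in _ + X]big_nat_cond.
rewrite [X in _ + X]big1 ?addr0; last first.
  by move=> i /andP[/andP[h _] /andP[]]; rewrite ltnNge h.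
transitivity (\sum_(0 <= i < N %/ L * L | (g <= i %% L)%N) ctrep i x).
  rewrite big_nat_cond [RHS]big_nat_cond; apply: eq_bigl => i.
  by rewrite /kept; case: (i < _)%N.
elim: (N %/ L)%N => [|J IH]; first by rewrite mul0n !big_geq.
rewrite big_nat_recr//= -IH mulSnr (@big_cat_nat _ _ _ (J * L))//= ?leq_addr//.
by rewrite /bsum mulSnr.
Qed.

Lemma fv_bsum j : fv (window (block_start j) (block_start j.+1)) (bsum j).
Proof.
set K := window _ _.
(* [fin_valued_sum] asks for measurability at every index, while [trep i] depends on this window
   only for the indices kept in block [j]; the others are padded by 0. *)
rewrite (_ : bsum j = fun x => \sum_(j * L <= i < j.+1 * L)
  (if (j * L <= i < j.+1 * L)%N && (g <= i %% L)%N then ctrep i x else 0)).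
  apply: fin_valued_sum => i; case: (boolP (_ && _)) => [/andP[/andP[ji ij] gi]|_]; last first.
    exact: fin_valued_cst.
  apply: fin_valuedB; last exact: fin_valued_cst.
  have iL : (i %/ L = j)%N by apply/eqP; rewrite eqn_leq leq_divRL// ji -ltnS ltn_divLR// ij.
  have h := block_start_le gi; rewrite iL in h.
  have st : (block_start j <= kappa * i.+1)%N by lia.
  rewrite /trep iL; apply: fin_valued_sub (fv_agree_from u d st).
  by apply: window_sub => //; exact: block_end_le.
apply/funext => x; rewrite /bsum big_mkcond/=.
rewrite big_nat_cond [RHS]big_nat_cond; apply: eq_bigr => i /andP[-> _] /=.
by [].
Qed.

Lemma bsum_bound j x : `|bsum j x| <= L%:R.
Proof.
apply: (le_trans (ler_norm_sum _ _ _)).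
apply: (@le_trans _ _ (\sum_(j * L <= i < j.+1 * L) 1)).
  by rewrite big_mkcond/=; apply: ler_sum => i _; case: ifP => _; rewrite ?ctrep_bound.
by rewrite sumr_const_nat mulSnr addKn.
Qed.

Lemma E_bsum j : EE (bsum j) = 0.
Proof.
rewrite (@E_sum _ _ _ P _ _ _ mZ setT); last exact: fv_ctrep_all.
by rewrite big1// => i _; rewrite E_center//; exact: fv_trep_all.
Qed.

Lemma tsum_lindeberg N (sigma delta y : R) : 0 < sigma -> 0 < delta ->
  `|EE (fun x => gauss_below delta y (tsum N x / sigma)) -
    gauss_below (delta + EE (fun x => (tsum N x / sigma) ^+ 2)) y 0| <=
  (N %/ L)%:R * (16 / Num.sqrt delta ^+ 3 * (L%:R / sigma) ^+ 3 +
                 12 * ((L%:R / sigma) ^+ 2 / delta) ^+ 2).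
Proof.
move=> s0 d0.
have tE x : tsum N x / sigma = partial_sum (fun j x => bsum j x / sigma) (N %/ L) x.
  by rewrite tsum_blocks /partial_sum mulr_suml.
rewrite (_ : (fun x => gauss_below _ _ _) = (fun x => gauss_below delta y
  (partial_sum (fun j x => bsum j x / sigma) (N %/ L) x))); last first.
  by apply/funext => x; rewrite tE.
rewrite (_ : (fun x => (tsum N x / sigma) ^+ 2) = (fun x =>
  partial_sum (fun j x => bsum j x / sigma) (N %/ L) x ^+ 2)); last first.
  by apply/funext => x; rewrite tE.
have start_mono j : (block_start j <= block_start j.+1)%N.
  by rewrite /block_start leq_add2r leq_mul2l leq_mul2r leqnSn !orbT.
apply: (@lindeberg _ _ _ P _ _ _ mZ iZ (fun j => window 0 (block_start j))
  (fun j => window (block_start j) (block_start j.+1))) => //.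
- by move=> j; exact: window_window.
- by move=> j; apply: window_sub.
- by move=> j; apply: window_sub.
- by move=> j; apply: fin_valuedM; [exact: fv_bsum | exact: fin_valued_cst].
- move=> j; rewrite (_ : (fun x => _) = (fun x => sigma^-1 * bsum j x)); last first.
    by apply/funext => x; rewrite mulrC.
  by rewrite (E_scale _ mZ _ (fv_bsum j)) E_bsum mulr0.
- move=> j x; rewrite normrM normfV (gtr0_norm s0) ler_pM2r ?invr_gt0//.
  exact: bsum_bound.
Qed.

End Truncation.
End Blocks.

(** * Choice of gaps and block lengths *)

Section BlockRates.
Context {R : realType}.
Implicit Types (rho : R) (m d N : nat).

Definition gap m d N : nat := (m * trunc_log 2 N + d)%N.

(** Truncation error relative to N: the fraction dropped at the block starts, the incomplete last
    block, and the restart error N^2 rho^(g-d) divided by N. *)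
Definition rate rho m d N : R := (gap m d N)%:R / (blk N)%:R +
  (blk N)%:R / N%:R + N%:R * rho ^+ (gap m d N - d).

Lemma blk_gt0 N : (0 < blk N)%N.
Proof. by rewrite /blk expn_gt0. Qed.

Lemma cvg_trunc_log_comp (f : nat -> R) : f @ \oo --> 0 ->
  f (trunc_log 2 N) @[N --> \oo] --> 0.
Proof. by move=> f0; apply: cvg_comp f0; exact: cvg_trunc_log. Qed.

Lemma cvg_blk_sqrt : (blk N)%:R ^+ 2 / Num.sqrt N%:R @[N --> \oo] --> (0 : R).
Proof.
apply: (@squeeze_cvgr _ _ _ _ (fun=> 0)
  (fun N => 17 ^+ 4 * (16 / 17) ^+ (trunc_log 2 N))).
- near=> N; rewrite divr_ge0 ?sqr_ge0 ?sqrtr_ge0//=.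
  by apply: blk_sqrt_bound; near: N; exact: nbhs_infty_gt.
- exact: cvg_cst.
- rewrite -[X in _ --> X](mulr0 (17 ^+ 4)).
  apply: cvgMr; apply: (cvg_trunc_log_comp (f := fun k => (16 / 17) ^+ k)).
  by apply: cvg_expr; rewrite ger0_norm; lra.
Unshelve. all: by end_near. Qed.

(** With rho^m <= 1/4 the restart error decays like N^-2 along the logarithmic gap, which beats the
    factor N. *)
Lemma cvg_rate rho m d : 0 <= rho -> rho ^+ m <= 4^-1 ->
  rate rho m d N @[N --> \oo] --> 0.
Proof.
move=> r0 rm.
rewrite -[X in _ --> X]addr0 -[X in _ --> X + _]addr0.
apply: cvgD; first apply: cvgD.
- apply: (@squeeze_cvgr _ _ _ _ (fun=> 0)
    (fun N => (m + d)%:R * (trunc_log 2 N).+1%:R^-1)).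
  + apply: nearW => N; rewrite divr_ge0//=.
    rewrite ler_pdivrMr ?ltr0n ?blk_gt0// /blk natrX expr2 mulrA divfK ?pnatr_eq0//.
    by rewrite -natrM ler_nat /gap; nia.
  + exact: cvg_cst.
  + rewrite -[X in _ --> X](mulr0 (m + d)%:R); apply: cvgMr.
    apply: (cvg_trunc_log_comp (f := fun k => k.+1%:R^-1)); exact: cvg_harmonic.
- apply: (@squeeze_cvgr _ _ _ _ (fun=> 0)
    (fun N => (blk N)%:R ^+ 2 / Num.sqrt N%:R)).
  + near=> N; rewrite divr_ge0//=.
    have N0 : (0 < N)%N by near: N; exact: nbhs_infty_gt.
    have N1 : 1 <= N%:R :> R by rewrite ler1n.
    apply: ler_pM => //.
      by rewrite -natrX ler_nat leq_pmulr// blk_gt0.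
    rewrite lef_pV2 ?posrE ?ltr0n ?sqrtr_gt0 ?ltr0n//.
    rewrite -[leRHS]ger0_norm ?ler0n// -sqrtr_sqr ler_wsqrtr//.
    by rewrite expr2 ler_peMl.
  + exact: cvg_cst.
  + exact: cvg_blk_sqrt.
- apply: (@squeeze_cvgr _ _ _ _ (fun=> 0)
    (fun N => 2 * 2^-1 ^+ (trunc_log 2 N))).
  + near=> N; rewrite mulr_ge0 ?exprn_ge0//=.
    set k := trunc_log 2 N.
    have Nk : N%:R <= 2 * 2 ^+ k :> R.
      rewrite -natrX -natrM ler_nat -expnS ltnW// trunc_log_ltn//.
    rewrite /gap addnK exprM -/k.
    have rk : (rho ^+ m) ^+ k <= 4^-1 ^+ k.
      by rewrite lerXn2r ?nnegrE ?exprn_ge0.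
    apply: (@le_trans _ _ (2 * 2 ^+ k * 4^-1 ^+ k)).
      by rewrite ler_pM ?exprn_ge0 ?exprn_ge0.
    rewrite -mulrA -exprMn ler_wpM2l//.
    by rewrite (_ : 2 / 4 = 2^-1 :> R)//; field.
  + exact: cvg_cst.
  + rewrite -[X in _ --> X](mulr0 2); apply: cvgMr.
    apply: (cvg_trunc_log_comp (f := fun k => 2^-1 ^+ k)).
    by apply: cvg_expr; rewrite ger0_norm; lra.
Unshelve. all: by end_near. Qed.

Lemma gauss_below_variance (V W a y x : R) : 0 < a -> a <= V -> a <= W ->
  `|gauss_below V y x - gauss_below W y x| <=
  8 * (`|V - W| / a) + 12 * (`|V - W| / a) ^+ 2.
Proof.
move=> a0; wlog VW : V W / V <= W.
  move=> H aV aW; have [VW|/ltW WV] := leP V W; first exact: H.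
  by rewrite distrC (distrC V); exact: H.
move=> aV aW; have V0 := lt_le_trans a0 aV.
set v := W - V; have v0 : 0 <= v by rewrite subr_ge0.
have WE : W = V + v by rewrite /v addrC subrK.
rewrite (distrC V) -/v (ger0_norm v0).
have := gauss_below_heat V0 v0 (erefl ((y - x) / Num.sqrt V)); rewrite -WE => H.
set z := (y - x) / _ in H.
have zb : `|z * stdphi z| <= 16.
  apply: (poly_stdphi_bound (p := id)).
  have h : 0 <= (z ^+ 2 - 1) ^+ 2 by exact: sqr_ge0.
  have h3 : 0 <= (z - 1) ^+ 2 by exact: sqr_ge0.
  have h4 : 0 <= (z + 1) ^+ 2 by exact: sqr_ge0.
  by rewrite ler_norml; apply/andP; split; nra.
have vV : v / V <= v / a by rewrite ler_wpM2l// lef_pV2 ?posrE.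
have vV0 : 0 <= v / V by rewrite divr_ge0// ltW.
rewrite distrC.
rewrite (_ : _ - _ = (gauss_below W y x - gauss_below V y x +
  2^-1 * (z * stdphi z) / V * v) - 2^-1 * (z * stdphi z) * (v / V)); last by ring.
apply: (le_trans (ler_normB _ _)); rewrite addrC; apply: lerD.
  rewrite normrM (ger0_norm vV0) normrM ger0_norm//; nra.
apply: (le_trans H); rewrite ler_wpM2l// lerXn2r// nnegrE//.
exact: le_trans vV.
Qed.

End BlockRates.

(** * Gaussian limit of the normalized sums *)

Section CentralLimit.
Context {R : realType} {disp : measure_display} {Omega : measurableType disp}.
Context {P : probability Omega R} {G : lfgraph} {eps : R}.
Variable M : nvm_input P G eps.
Hypothesis eps01 : 0 < eps < 1.
Hypothesis nbr_n0 : forall v : G, nbr v != fset0.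
Variables (u : G) (d kappa : nat).
Hypothesis kappa_gt0 : (0 < kappa)%N.

Local Notation D := {classic (driver G)}.
Local Notation fv := (@fin_valued R D (fun i : D => driver_val (i : driver G))).
Local Notation EE := (E P (nvm_rv M)).
Local Notation mZ := (measurable_nvm_rv M).
Local Notation rho := (1 - eps).
Local Notation csum := (csum M u d kappa).
Local Notation tsum := (tsum M u d kappa).
Local Notation rep_cov := (rep_cov M u d kappa).
Local Notation rep := (@rep R G u d kappa).

Let rho0 : 0 < rho. Proof. exact: rho_gt0. Qed.
Let rho1 : rho < 1. Proof. exact: rho_lt1. Qed.

Let vS N : fv setT (csum N). Proof. exact: fv_csum. Qed.
Let vU g L N : fv setT (tsum g L N). Proof. exact: fv_tsum. Qed.

(** Three comparisons: full sum with truncated sum (32 / sqrt delta), truncated sum with a Gaussian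
    of the same variance (1), and that variance, within 3 eta of 1, with 1 (24 = 8 * 3 and 108 = 12
    * 9). *)
Lemma clt_bound N g L (sigma delta y eta : R) :
  0 < delta -> 0 < sigma -> 0 < eta <= 1 -> sigma ^+ 2 = double_sum rep_cov N ->
  (d <= g)%N -> (0 < L)%N ->
  EE (fun x => (csum N x - tsum g L N x) ^+ 2) <= eta ^+ 2 * sigma ^+ 2 ->
  (N %/ L)%:R * (16 / Num.sqrt delta ^+ 3 * (L%:R / sigma) ^+ 3 +
                 12 * ((L%:R / sigma) ^+ 2 / delta) ^+ 2) <= eta ->
  `|EE (fun x => gauss_below delta y (csum N x / sigma)) -
    gauss_below (delta + 1) y 0| <=
  eta * (32 / Num.sqrt delta + 1 + 24 / delta + 108 / delta ^+ 2).
Proof.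
move=> d0 s0 /andP[e0 e1] sE dg L0 err lin.
have sd : 0 < Num.sqrt delta by rewrite sqrtr_gt0.
have s20 : 0 < sigma ^+ 2 by rewrite exprn_gt0.
pose X x := csum N x / sigma; pose U x := tsum g L N x / sigma.
have vX : fv setT X by exact: (fin_valued_op1 (fun a => a / sigma)).
have vU' : fv setT U by exact: (fin_valued_op1 (fun a => a / sigma)).
have vD2 : fv setT (fun x => (csum N x - tsum g L N x) ^+ 2).
  apply: (fin_valued_op1 (fun a => a ^+ 2)); exact: fin_valuedB.
have vX2 : fv setT (fun x => X x ^+ 2) by exact: (fin_valued_op1 (fun a => a ^+ 2)).
have vU2 : fv setT (fun x => U x ^+ 2) by exact: (fin_valued_op1 (fun a => a ^+ 2)).
have vXU : fv setT (fun x => (X x - U x) ^+ 2).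
  by apply: (fin_valued_op1 (fun a => a ^+ 2)); exact: fin_valuedB.
have EXU : EE (fun x => (X x - U x) ^+ 2) <= eta ^+ 2.
  rewrite (_ : (fun x => _) = (fun x => sigma ^- 2 * (csum N x - tsum g L N x) ^+ 2)).
    by rewrite (E_scale _ mZ _ vD2) mulrC ler_pdivrMr.
  by apply/funext => x; rewrite /X /U; field; rewrite gt_eqF.
have EX : EE (fun x => X x ^+ 2) = 1.
  have vS2 : fv setT (fun x => csum N x ^+ 2) by exact: (fin_valued_op1 (fun a => a ^+ 2)).
  rewrite (_ : (fun x => _) = (fun x => sigma ^- 2 * csum N x ^+ 2)).
    by rewrite (E_scale _ mZ _ vS2) E_csum_sqr -sE mulVf// gt_eqF.
  by apply/funext => x; rewrite /X; field; rewrite gt_eqF.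
(* Takes the place of Cauchy-Schwarz: a second moment at most eta^2 gives a first absolute moment at
   most 2 eta. *)
have amgm (t : R) : 0 <= t -> t <= eta + eta^-1 * t ^+ 2.
  move=> t0; rewrite -subr_ge0 (_ : _ - _ = ((eta - t) ^+ 2 + eta * t) / eta).
    by rewrite divr_ge0 ?(ltW e0)// addr_ge0 ?sqr_ge0// mulr_ge0// ltW.
  by field; rewrite gt_eqF.
have h1 : `|EE (fun x => gauss_below delta y (X x)) -
    EE (fun x => gauss_below delta y (U x))| <= eta * (32 / Num.sqrt delta).
  pose h x := 16 / Num.sqrt delta * (eta + eta^-1 * (X x - U x) ^+ 2).
  have vh0 : fv setT (fun x => eta^-1 * (X x - U x) ^+ 2).
    exact: (fin_valued_op1 (fun a => eta^-1 * a) vXU).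
  have vh1 : fv setT (fun x => eta + eta^-1 * (X x - U x) ^+ 2).
    exact: (fin_valued_op1 (fun a => eta + eta^-1 * a) vXU).
  have vh : fv setT h by exact: (fin_valued_op1 (fun a => 16 / Num.sqrt delta * a)).
  apply: (@le_trans _ _ (EE h)).
    apply: (@E_close _ _ _ P _ _ M setT) => //.
    - exact: (fin_valued_op1 (fun a => gauss_below delta y a)).
    - exact: (fin_valued_op1 (fun a => gauss_below delta y a)).
    - move=> x; apply: (le_trans (stdPhi_lipschitz _ _)).
      rewrite (_ : _ - _ = (U x - X x) / Num.sqrt delta); last by ring.
      rewrite normrM normfV (gtr0_norm sd) /h mulrA mulrAC ler_wpM2l ?divr_ge0 ?(ltW sd)//.
      by rewrite distrC; have := amgm `|X x - U x| (normr_ge0 _); rewrite real_normK ?num_real.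
  rewrite (E_scale _ mZ _ vh1) (@E_add _ _ _ P _ _ _ mZ setT setT)//; last first.
    exact: fin_valued_cst.
  rewrite E_cst (E_scale _ mZ _ vXU).
  rewrite (_ : eta * (32 / Num.sqrt delta) = 16 / Num.sqrt delta * (eta + eta^-1 * eta ^+ 2)).
    by rewrite ler_wpM2l ?divr_ge0 ?(ltW sd)// lerD2l ler_wpM2l// invr_ge0 ltW.
  by field; rewrite !gt_eqF.
have h2 := le_trans (tsum_lindeberg M eps01 u kappa_gt0 dg L0 N y s0 d0) lin.
have V0 : 0 <= EE (fun x => U x ^+ 2).
  by apply: (E_ge0 P mZ vU2) => x; exact: sqr_ge0.
have h3 : `|EE (fun x => U x ^+ 2) - 1| <= 3 * eta.
  (* From U^2 - X^2 = (X - U)^2 - 2 X (X - U) with the cross term bounded by eta X^2 + (X - U)^2 /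
     eta; the mean is at most 2 eta + eta^2. *)
  pose h x := eta * X x ^+ 2 + (eta^-1 + 1) * (X x - U x) ^+ 2.
  have vh : fv setT h.
    exact: (fin_valued_op2 (fun a b => eta * a + (eta^-1 + 1) * b)).
  rewrite -[X in _ - X]EX; apply: (@le_trans _ _ (EE h)).
    apply: (@E_close _ _ _ P _ _ M setT) => // x.
    rewrite /h; move: (X x) (U x) => a b.
    have key (sg : R) : sg ^+ 2 = 1 ->
        0 <= eta * a ^+ 2 + eta^-1 * (a - b) ^+ 2 + 2 * sg * (a * (a - b)).
      move=> sg2; rewrite (_ : _ + _ = (eta * a + sg * (a - b)) ^+ 2 / eta +
        (1 - sg ^+ 2) * (a - b) ^+ 2 / eta); last by field; rewrite gt_eqF.
      by rewrite sg2 subrr !mul0r addr0 divr_ge0 ?sqr_ge0// ltW.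
    have k1 := key 1 (expr1n _ _); have k2 := key (-1) (etrans (sqrrN 1) (expr1n _ 2)).
    have sq := sqr_ge0 (a - b).
    rewrite mulrDl mul1r; set q := eta^-1 * _ in k1 k2 *.
    by rewrite ler_norml; apply/andP; split; nra.
  have vh1 : fv setT (fun x => eta * X x ^+ 2).
    exact: (fin_valued_op1 (fun a => eta * a) vX2).
  have vh2 : fv setT (fun x => (eta^-1 + 1) * (X x - U x) ^+ 2).
    exact: (fin_valued_op1 (fun a => (eta^-1 + 1) * a) vXU).
  rewrite (@E_add _ _ _ P _ _ _ mZ setT setT)//.
  rewrite (E_scale _ mZ _ vX2) (E_scale _ mZ _ vXU) EX mulr1.
  apply: (@le_trans _ _ (eta + (eta^-1 + 1) * eta ^+ 2)).
    by rewrite lerD2l ler_wpM2l// addr_ge0// invr_ge0 ltW.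
  rewrite mulrDl mul1r expr2 mulrA mulVf ?gt_eqF// mul1r.
  have : eta * eta <= eta by rewrite ler_piMl// ltW.
  by lra.
have h4 := @gauss_below_variance R (delta + EE (fun x => U x ^+ 2)) (delta + 1) delta y 0 d0.
have {h4} h4 : `|gauss_below (delta + EE (fun x => U x ^+ 2)) y 0 -
    gauss_below (delta + 1) y 0| <= eta * (24 / delta + 108 / delta ^+ 2).
  apply: (le_trans (h4 _ _)); [by rewrite lerDl | by rewrite lerDl |].
  rewrite opprD addrACA subrr add0r.
  set t := `|_| in h3 *; have t0 : 0 <= t by exact: normr_ge0.
  have id0 : 0 < delta^-1 by rewrite invr_gt0.
  have a1 : t / delta <= 3 * eta / delta by rewrite ler_pM2r.
  have a0 : 0 <= t / delta by rewrite mulr_ge0// ltW.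
  have a2 : (t / delta) ^+ 2 <= (3 * eta / delta) ^+ 2.
    by rewrite lerXn2r// nnegrE; apply: le_trans a1.
  have a3 : (3 * eta / delta) ^+ 2 <= 9 * eta / delta ^+ 2.
    rewrite (_ : _ ^+ 2 = 9 * (eta * eta) / delta ^+ 2); last by field; rewrite gt_eqF.
    rewrite ler_pM2r ?invr_gt0 ?exprn_gt0// ler_wpM2l// ler_piMl// ltW//.
  rewrite mulrDr (_ : eta * (24 / delta) = 8 * (3 * eta / delta)); last by field; rewrite gt_eqF.
  rewrite (_ : eta * (108 / delta ^+ 2) = 12 * (9 * eta / delta ^+ 2)); last by field; rewrite gt_eqF.
  by lra.
rewrite -[X in `|X|](subrKA (EE (fun x => gauss_below delta y (U x)))).
apply: (le_trans (ler_normD _ _)).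
rewrite -!addrA mulrDr; apply: lerD => //.
rewrite -[X in `|X|](subrKA (gauss_below (delta + EE (fun x => U x ^+ 2)) y 0)).
apply: (le_trans (ler_normD _ _)).
by rewrite mulrDr mulr1; apply: lerD.
Qed.

Variables (l B : R).
Hypothesis l_gt0 : 0 < l.
Hypothesis var_linear : forall n, `|double_sum rep_cov n - l * n%:R| <= B.

Lemma cvg_smoothed (delta y : R) : 0 < delta ->
  EE (fun x => gauss_below delta y (csum N x / Num.sqrt (double_sum rep_cov N)))
    @[N --> \oo] --> gauss_below (delta + 1) y 0.
Proof.
move=> d0; have sd : 0 < Num.sqrt delta by rewrite sqrtr_gt0.
have [m rm] : exists m, rho ^+ m <= 4^-1.
  have : rho ^+ n @[n --> \oo] --> 0 by apply: cvg_expr; rewrite ger0_norm// ltW.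
  move=> /cvgrPdist_le /(_ 4^-1); rewrite invr_gt0 ltr0n => /(_ isT) [m _ Hm].
  exists m; have := Hm m (leqnn m).
  by rewrite /= sub0r normrN ger0_norm// exprn_ge0// ltW.
pose g := gap m d; pose L := blk.
pose A := @row_const R eps d; have A0 : 0 <= A by exact: row_const_ge0.
(* Once B <= (l/2) N, the variance is at least (l/2) N, so that sigma >= a sqrt N. *)
pose a := Num.sqrt (l / 2); have a0 : 0 < a by rewrite sqrtr_gt0 divr_gt0.
(* N/L blocks with cubic error (L / sqrt N)^3 give exactly [nu]; the quartic errors give L^3 / N,
   which is at most [nu] squared. *)
pose nu N : R := (L N)%:R ^+ 2 / Num.sqrt N%:R.
pose c3 := 16 / Num.sqrt delta ^+ 3 / a ^+ 3; pose c4 := 12 / delta ^+ 2 / a ^+ 4.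
have c30 : 0 <= c3 by rewrite !divr_ge0// exprn_ge0// ltW.
have c40 : 0 <= c4 by rewrite !divr_ge0// exprn_ge0// ltW.
have lin_cvg : c3 * nu N + c4 * nu N ^+ 2 @[N --> \oo] --> (0 : R).
  rewrite -[X in _ --> X](_ : c3 * 0 + c4 * (0 * 0) = 0); last by rewrite !mulr0 addr0.
  apply: cvgD; apply: cvgMr; first exact: cvg_blk_sqrt.
  by apply: cvgM; exact: cvg_blk_sqrt.
have err_cvg : (2 * A + 16) / (l / 2) * rate rho m d N @[N --> \oo] --> (0 : R).
  rewrite -[X in _ --> X](mulr0 ((2 * A + 16) / (l / 2))).
  by apply: cvgMr; apply: cvg_rate rm; exact: ltW.
set C := 32 / Num.sqrt delta + 1 + 24 / delta + 108 / delta ^+ 2.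
have C0 : 0 < C.
  by rewrite /C !addr_gt0// divr_gt0// exprn_gt0.
apply/cvgrPdist_le => e e0.
pose eta := Num.min 1 (e / C).
have eta0 : 0 < eta by rewrite lt_min ltr01 divr_gt0.
have eta1 : eta <= 1 by rewrite ge_min lexx.
have etaC : eta * C <= e by rewrite -ler_pdivlMr// ge_min lexx orbT.
have eta20 : 0 < eta ^+ 2 by rewrite exprn_gt0.
near=> N.
have N0 : (0 < N)%N by near: N; exact: nbhs_infty_gt.
have NR : 0 < N%:R :> R by rewrite ltr0n.
have L0 : (0 < L N)%N by exact: blk_gt0.
have LR : 0 < (L N)%:R :> R by rewrite ltr0n.
have err1 : (2 * A + 16) / (l / 2) * rate rho m d N <= eta ^+ 2.
  near: N; have /cvgrPdist_le /(_ _ eta20) := err_cvg; apply: filterS => N.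
  by rewrite sub0r normrN => /ler_normlW.
have lin1 : c3 * nu N + c4 * nu N ^+ 2 <= eta.
  near: N; have /cvgrPdist_le /(_ _ eta0) := lin_cvg; apply: filterS => N.
  by rewrite sub0r normrN => /ler_normlW.
have N2B : B / (l / 2) <= N%:R by near: N; exact: nbhs_infty_ger.
have s2 : l / 2 * N%:R <= double_sum rep_cov N.
  have := var_linear N; rewrite ler_norml => /andP[h _].
  move: N2B; rewrite ler_pdivrMr ?divr_gt0// => h2.
  by lra.
have s20 : 0 < double_sum rep_cov N by apply: lt_le_trans s2; rewrite mulr_gt0 ?divr_gt0.
set sigma := Num.sqrt (double_sum rep_cov N).
have sig0 : 0 < sigma by rewrite sqrtr_gt0.
have sigE : sigma ^+ 2 = double_sum rep_cov N by rewrite sqr_sqrtr// ltW.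
have sqN : 0 < Num.sqrt N%:R :> R by rewrite sqrtr_gt0.
have asig : a * Num.sqrt N%:R <= sigma.
  by rewrite -sqrtrM ?divr_ge0 ?(ltW l_gt0)// ler_wsqrtr.
have JN : (N %/ L N)%:R <= N%:R / (L N)%:R :> R.
  by rewrite ler_pdivlMr// -natrM ler_nat leq_trunc_div.
have J0 : 0 <= (N %/ L N)%:R :> R by [].
rewrite distrC; apply: le_trans etaC.
apply: (@clt_bound N (g N) (L N)) => //.
- by rewrite eta0.
- by rewrite /g /gap leq_addl.
- apply: (le_trans (E_truncation_error M eps01 nbr_n0 u kappa_gt0 _ L0 N)).
    by rewrite /g /gap leq_addl.
  rewrite sigE; apply: (@le_trans _ _ (eta ^+ 2 * (l / 2 * N%:R))); last first.
    by rewrite ler_pM2l.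
  apply: (@le_trans _ _ ((2 * A + 16) * rate rho m d N * N%:R)); last first.
    rewrite [leRHS]mulrA ler_pM2r// -ler_pdivrMr ?divr_gt0//.
    by rewrite mulrAC in err1.
  rewrite /rate -/(g N) -/(L N); set p := rho ^+ _.
  have p0 : 0 <= p by rewrite exprn_ge0// ltW.
  have f1 : (N %/ L N * g N + L N)%:R <= ((g N)%:R / (L N)%:R + (L N)%:R / N%:R) * N%:R :> R.
    rewrite mulrDl divfK ?gt_eqF// natrD natrM lerD2r mulrAC.
    rewrite [_%:R * N%:R]mulrC mulrAC [X in _ <= X]mulrC [X in X <= _]mulrC.
    by rewrite ler_wpM2l.
  set q := _ + _ in f1 *; have q0 : 0 <= q by rewrite addr_ge0// divr_ge0.
  have := ler_wpM2l A0 f1; rewrite expr2; have := ltW NR; have := mulr_ge0 q0 (ltW NR).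
  have : 0 <= N%:R * p by rewrite mulr_ge0.
  rewrite -/A; move: (N %/ L N * g N + L N)%:R => K h1 h2 h3 h4.
  have h5 : 0 <= A * (N%:R * p * N%:R) by exact: mulr_ge0 A0 (mulr_ge0 h1 h3).
  rewrite (_ : (2 * A + 16) * (q + N%:R * p) * N%:R =
    2 * (A * (q * N%:R)) + 16 * (q * N%:R) + 2 * (A * (N%:R * p * N%:R)) +
    16 * (N%:R * N%:R) * p); last by ring.
  by rewrite -[2 * A * K]mulrA; lra.
- apply: le_trans lin1.
  set x := (L N)%:R / sigma.
  have x0 : 0 <= x by rewrite divr_ge0// ltW.
  have xb : x <= (L N)%:R / (a * Num.sqrt N%:R).
    by rewrite ler_wpM2l// lef_pV2 ?posrE// mulr_gt0.
  have NE : N%:R = Num.sqrt N%:R ^+ 2 :> R by rewrite sqr_sqrtr.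
  have j3 : (N %/ L N)%:R * x ^+ 3 <= nu N / a ^+ 3.
    apply: (@le_trans _ _ (N%:R / (L N)%:R * ((L N)%:R / (a * Num.sqrt N%:R)) ^+ 3)).
      by rewrite ler_pM ?exprn_ge0// lerXn2r// nnegrE// (le_trans x0).
    rewrite le_eqVlt; apply/orP; left; apply/eqP; rewrite /nu {1}NE.
    by field; rewrite !gt_eqF.
  have j4 : (N %/ L N)%:R * x ^+ 4 <= nu N ^+ 2 / a ^+ 4.
    apply: (@le_trans _ _ (N%:R / (L N)%:R * ((L N)%:R / (a * Num.sqrt N%:R)) ^+ 4)).
      by rewrite ler_pM ?exprn_ge0// lerXn2r// nnegrE// (le_trans x0).
    rewrite (_ : _ * _ ^+ 4 = nu N ^+ 2 / a ^+ 4 * (L N)%:R^-1).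
      rewrite ler_piMr ?invf_le1 ?ler1n//.
      by rewrite divr_ge0 ?sqr_ge0// exprn_ge0// ltW.
    by rewrite /nu {1}NE; field; rewrite !gt_eqF.
  rewrite (_ : _ * (_ + _) = 16 / Num.sqrt delta ^+ 3 * ((N %/ L N)%:R * x ^+ 3) +
    12 / delta ^+ 2 * ((N %/ L N)%:R * x ^+ 4)); last by field; rewrite !gt_eqF.
  rewrite (_ : c3 * nu N = 16 / Num.sqrt delta ^+ 3 * (nu N / a ^+ 3)); last first.
    by rewrite /c3; field; rewrite !gt_eqF.
  rewrite (_ : c4 * nu N ^+ 2 = 12 / delta ^+ 2 * (nu N ^+ 2 / a ^+ 4)); last first.
    by rewrite /c4; field; rewrite !gt_eqF.
  by apply: lerD; apply: ler_wpM2l => //; rewrite divr_ge0// exprn_ge0// ltW.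
Unshelve. all: by end_near. Qed.

Lemma cvg_cdf_csum (x : R) :
  P [set w | csum N (tup (nvm_rv M) w) / Num.sqrt (double_sum rep_cov N) <= x]
    @[N --> \oo] --> @normal_prob R 0 1 `]-oo, x].
Proof.
apply: (cvg_cdf_of_smoothed (P := P)
  (W := fun N w => csum N (tup (nvm_rv M) w) / Num.sqrt (double_sum rep_cov N))).
  move=> N; have v : fv setT (fun x => csum N x / Num.sqrt (double_sum rep_cov N)).
    exact: (fin_valued_op1 (fun a => a / Num.sqrt (double_sum rep_cov N))).
  by have [] := fin_valued_bounded mZ v.
move=> y s s0; have := @cvg_smoothed (s ^+ 2) y (exprn_gt0 2 s0).
rewrite /gauss_below subr0 addrC sqrtr_sqr (gtr0_norm s0).
exact.
Qed.

End CentralLimit.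

(** * The two statistics *)

Section RepetitionStatistic.
Context {R : realType} {disp : measure_display} {Omega : measurableType disp}.
Context {P : probability Omega R} {G : lfgraph} {eps : R}.
Variable M : nvm_input P G eps.
Hypothesis eps01 : 0 < eps < 1.
Hypothesis nbr_n0 : forall v : G, nbr v != fset0.
Variables (u : G) (d kappa : nat).
Hypothesis kappa_gt0 : (0 < kappa)%N.

Local Notation D := {classic (driver G)}.
Local Notation fv := (@fin_valued R D (fun i : D => driver_val (i : driver G))).
Local Notation EE := (E P (nvm_rv M)).
Local Notation mZ := (measurable_nvm_rv M).
Local Notation rho := (1 - eps).
Local Notation csum := (csum M u d kappa).
Local Notation rep_cov := (rep_cov M u d kappa).
Local Notation rep := (@rep R G u d kappa).
Local Notation stat := (mod_rep_stat M u kappa d).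

Let rho0 : 0 < rho. Proof. exact: rho_gt0. Qed.
Let rho1 : rho < 1. Proof. exact: rho_lt1. Qed.

Lemma mod_rep_statE t w : stat t w =
  (t - d)%:R^-1 * \sum_(0 <= i < t - d) rep i (tup (nvm_rv M) w).
Proof.
rewrite /mod_rep_stat big_add1/=; congr (_ * _).
by apply: eq_bigr => i _; rewrite !nvm_state.
Qed.

Lemma mod_rep_stat_centered t w : stat t w - mean P (stat t) =
  (t - d)%:R^-1 * csum (t - d) (tup (nvm_rv M) w).
Proof.
have vs : fv setT (fun x => \sum_(0 <= i < t - d) rep i x).
  by apply: fin_valued_sum => i; exact: fv_rep.
have -> : mean P (stat t) = (t - d)%:R^-1 * \sum_(0 <= i < t - d) EE (rep i).
  rewrite -(@E_sum _ _ _ P _ _ _ mZ setT); last by move=> i; exact: fv_rep.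
  rewrite -(E_scale _ mZ _ vs) /E; congr (mean P _).
  by apply/funext => w'; exact: mod_rep_statE.
by rewrite mod_rep_statE -mulrBr -sumrB.
Qed.

Lemma var_mod_rep_stat t :
  var P (stat t) = (t - d)%:R^-1 ^+ 2 * double_sum rep_cov (t - d).
Proof.
have v : fv setT (fun x => csum (t - d) x ^+ 2).
  by apply: (fin_valued_op1 (fun a => a ^+ 2)); exact: fv_csum.
rewrite varE -E_csum_sqr -(E_scale _ mZ _ v) /E; congr (mean P _).
by apply/funext => w; rewrite mod_rep_stat_centered exprMn.
Qed.

Lemma standardized_mod_rep_stat t w : (d < t)%N ->
  standardized P (stat t) w =
  csum (t - d) (tup (nvm_rv M) w) / Num.sqrt (double_sum rep_cov (t - d)).
Proof.
move=> dt; rewrite /standardized mod_rep_stat_centered var_mod_rep_stat.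
have N0 : 0 < (t - d)%:R :> R by rewrite ltr0n subn_gt0.
rewrite sqrtrM ?sqr_ge0// sqrtr_sqr ger0_norm ?invr_ge0 ?(ltW N0)//.
by rewrite invfM invrK mulrACA mulVf ?mul1r// gt_eqF.
Qed.

Lemma double_sum_rep_cov_ge0 N : 0 <= double_sum rep_cov N.
Proof.
have v : fv setT (fun x => csum N x ^+ 2).
  by apply: (fin_valued_op1 (fun a => a ^+ 2)); exact: fv_csum.
by rewrite -E_csum_sqr; apply: (E_ge0 P mZ v) => x; exact: sqr_ge0.
Qed.

Lemma rep_cov_linear : exists l B : R,
  (forall n, `|double_sum rep_cov n - l * n%:R| <= B) /\
  rep_cov n n + 2 * \sum_(0 <= i < n) rep_cov i n @[n --> \oo] --> l.
Proof.
apply: (@double_sum_linear _ _ (@cov_const R eps d) rho).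
- by rewrite rho0 rho1.
- exact: cov_const_ge0.
- exact: rep_covC.
- exact: rep_cov_decay.
- exact: rep_cov_stationary.
Qed.

Section Limit.
Variables (l B : R).
Hypothesis var_linear : forall n, `|double_sum rep_cov n - l * n%:R| <= B.

Lemma cvg_scaled_var : t%:R * var P (stat t) @[t --> \oo] --> l.
Proof.
have Vl : double_sum rep_cov n.+1 / n.+1%:R @[n --> \oo] --> l.
  have b0 (c : R) : c * n.+1%:R^-1 @[n --> \oo] --> 0.
    by rewrite -[X in _ --> X](mulr0 c); apply: cvgMr; exact: cvg_harmonic.
  rewrite (_ : (fun n => _) = (fun n => l +
    (double_sum rep_cov n.+1 - l * n.+1%:R) / n.+1%:R)); last first.
    apply/funext => n; have : n.+1%:R != 0 :> R by [].
    by move: n.+1%:R => y y0; field.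
  rewrite -[X in _ --> X]addr0; apply: cvgD; first exact: cvg_cst.
  apply: (@squeeze_cvgr _ _ _ _ (fun n => - B * n.+1%:R^-1) (fun n => B * n.+1%:R^-1)) => //.
  apply: nearW => n; have := var_linear n.+1; rewrite ler_norml => /andP[h1 h2].
  by rewrite !ler_pM2r ?invr_gt0 ?ltr0n// h1 h2.
(* For t = n + 1 + d the first factor is t / (t - d); starting at d + 1 keeps t - d away from 0. *)
have prod : (1 + d%:R * n.+1%:R^-1) * (double_sum rep_cov n.+1 / n.+1%:R)
    @[n --> \oo] --> l.
  rewrite -[X in _ --> X]mul1r; apply: cvgM => //.
  rewrite -[X in _ --> X]addr0; apply: cvgD; first exact: cvg_cst.
  by rewrite -[X in _ --> X](mulr0 d%:R); apply: cvgMr; exact: cvg_harmonic.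
rewrite -(cvg_shiftn d.+1); apply: cvg_trans prod.
apply: near_eq_cvg; apply: nearW => n /=.
rewrite var_mod_rep_stat addnS subSn ?leq_addl// addnK.
rewrite -addSn natrD; have : n.+1%:R != 0 :> R by [].
by move: n.+1%:R => y y0; field.
Qed.

Lemma cvg_standardized : 0 < l ->
  cvg_in_distribution P (fun t => standardized P (stat t)) (@normal_prob R 0 1).
Proof.
move=> l0 x _; rewrite -(cvg_shiftn d.+1) /=.
have := cvg_cdf_csum eps01 nbr_n0 kappa_gt0 l0 var_linear (x := x).
rewrite -(cvg_shiftn 1) /=; apply: cvg_trans; apply: near_eq_cvg; apply: nearW => n.
congr (P _); apply/seteqP; split => w /=;
  by rewrite standardized_mod_rep_stat ?addnS ?ltnS ?leq_addl// subSn ?leq_addl// addnK addn0.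
Qed.

End Limit.

Lemma limit_ge0 (l : R) : t%:R * var P (stat t) @[t --> \oo] --> l -> 0 <= l.
Proof.
move=> h; apply: (cvgr_to_ge h); apply: nearW => t.
by rewrite var_mod_rep_stat mulr_ge0// mulr_ge0 ?sqr_ge0// double_sum_rep_cov_ge0.
Qed.

Lemma bounded_double_sum_not_littleo (B : R) :
  (forall n, double_sum rep_cov n <= B) ->
  ~ (fun t : nat => ln t%:R / t%:R ^+ 2 : R) =o_\oo (fun t : nat => var P (stat t)).
Proof.
move=> VB /eqoP /(_ 1 ltr01) o.
have B0 : 0 <= B := le_trans (double_sum_rep_cov_ge0 0) (VB 0%N).
(* For t > 2d a bound B on N^2 Var gives Var <= 4B / t^2, contradicted as soon as ln t >= 4B + 1. *)
have half (t : nat) : (d.*2 < t)%N -> (d < t)%N /\ (t <= 2 * (t - d))%N by lia.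
have scale (x : R) : x != 0 -> (2 / x) ^+ 2 * B = 4 * B / x ^+ 2 by move=> ?; field.
have : \forall t \near \oo, False.
  near=> t.
  have ot : `|ln t%:R / t%:R ^+ 2 : R| <= 1 * `|var P (stat t)| by near: t.
  have dt : (d.*2 < t)%N by near: t; exact: nbhs_infty_gt.
  have tE : expR (4 * B + 1) <= t%:R by near: t; exact: nbhs_infty_ger.
  have t0 : 0 < t%:R :> R by rewrite ltr0n (leq_ltn_trans _ dt).
  have lnt : 4 * B + 1 <= ln t%:R by rewrite -(expRK (4 * B + 1)) ler_ln ?posrE ?expR_gt0.
  have : ln t%:R / t%:R ^+ 2 <= 4 * B / t%:R ^+ 2.
    apply: (le_trans (ler_norm _)); apply: (le_trans ot); rewrite mul1r.
    have [td t2] := half t dt.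
    have N0 : 0 < (t - d)%:R :> R by rewrite ltr0n subn_gt0.
    rewrite var_mod_rep_stat ger0_norm; last first.
      by rewrite mulr_ge0 ?sqr_ge0// double_sum_rep_cov_ge0.
    apply: (@le_trans _ _ ((2 / t%:R) ^+ 2 * B)); last by rewrite scale// gt_eqF.
    apply: ler_pM; rewrite ?sqr_ge0 ?double_sum_rep_cov_ge0//.
    rewrite lerXn2r ?nnegrE ?divr_ge0 ?invr_ge0 ?(ltW N0) ?(ltW t0)//.
    by rewrite -[leLHS]mul1r ler_pdivrMr// mulrAC ler_pdivlMr// mul1r -natrM ler_nat.
  rewrite ler_pM2r ?invr_gt0 ?exprn_gt0// => h.
  by have := le_trans lnt h; lra.
by move=> /filter_ex [].
Unshelve. all: by end_near. Qed.

End RepetitionStatistic.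

(** * Positivity of the limiting variance for admissible spacings *)

Section AdmissibleSpacing.
Context {R : realType} {disp : measure_display} {Omega : measurableType disp}.
Context {P : probability Omega R} {G : lfgraph} {eps : R}.
Variable M : nvm_input P G eps.
Hypothesis eps01 : 0 < eps < 1.
Hypothesis nbr_n0 : forall v : G, nbr v != fset0.
Hypothesis countableG : countable [set: G].
Variables (u : G) (d kappa : nat).

Local Notation EE := (E P (nvm_rv M)).
Local Notation rho := (1 - eps).
Local Notation rep_cov := (rep_cov M u d kappa).

Let rho0 : 0 < rho. Proof. exact: rho_gt0. Qed.
Let rho1 : rho < 1. Proof. exact: rho_lt1. Qed.

Lemma E_agree_limit : exists e : R, [/\ 0 <= e <= 1,
  EE (agree u d t) @[t --> \oo] --> e & p_d M u d = 2 * e - 1].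
Proof.
have r01 : 0 <= rho < 1 by rewrite rho1 ltW.
have inc t : `|EE (agree u d t.+1) - EE (agree u d t)| <= 4 * rho ^+ t.
  by rewrite -addn1; exact: E_agree_stationary.
have [e He] := geometric_increments r01 inc.
have ce : EE (agree u d t) @[t --> \oo] --> e.
  apply/cvgrPdist_le => x x0.
  have : 4 / (1 - rho) * rho ^+ t @[t --> \oo] --> 0.
    rewrite -[X in _ --> X](mulr0 (4 / (1 - rho))); apply: cvgMr.
    by apply: cvg_expr; rewrite ger0_norm// ltW.
  move=> /cvgr_le /(_ _ x0); apply: filterS => t h.
  by rewrite distrC; exact: le_trans (He t) h.
have e01 t : 0 <= EE (agree u d t) <= 1.
  exact: E_01 (fv_agree u d t) (agree_bound u d t).
exists e; split => //.
  apply/andP; split; [apply: (cvgr_to_ge ce)|apply: (cvgr_to_le ce)].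
    by apply: nearW => t; case/andP: (e01 t).
  by apply: nearW => t; case/andP: (e01 t).
rewrite /p_d; apply: cvg_lim => //.
rewrite (_ : p_td M u ^~ d = (fun t => 2 * EE (agree u d t) - 1)); last first.
  by apply/funext => t; rewrite (E_agree M eps01 nbr_n0 countableG); field.
by apply: cvgB; [exact: cvgMr | exact: cvg_cst].
Qed.

(** For kappa <= d the exponent is nonpositive and the left side is at least 4, while the right side
    is at most 2 e (1 - e). Past this point the integer exponent is a natural one. *)
Lemma admissible_gt : admissible_kappa M u kappa d -> (d < kappa)%N.
Proof.
have [e [/andP[e0 e1] _ pE]] := E_agree_limit; rewrite /admissible_kappa pE.
apply: contraPT; rewrite -leqNgt => kd.
rewrite -[kappa%:Z - _]opprB subzn// -exprnN.
have : 1 <= rho ^- (d - kappa).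
  by rewrite invf_ge1 ?exprn_gt0// exprn_ile1 ?(ltW rho0) ?(ltW rho1).
have ee : 0 <= e * (1 - e) <= 1 by apply/andP; split; nra.
have : 0 <= rho ^+ kappa <= 1 by rewrite exprn_ge0 ?exprn_ile1 ?(ltW rho0) ?(ltW rho1).
by nra.
Qed.

Lemma rep_cov_diag N : rep_cov N N =
  EE (agree u d (kappa * N.+1)) * (1 - EE (agree u d (kappa * N.+1))).
Proof.
rewrite mulrBr mulr1; congr (_ - _); congr (EE _); apply/funext => x.
by rewrite /rep /agree; case: (_ == _); rewrite ?mulr1 ?mulr0.
Qed.

(** Indices m apart are separated by kappa m - d time steps after the earlier indicator ends, which
    gives a geometric series of ratio rho^kappa starting at rho^(kappa-d). *)
Lemma off_diag_le N : (0 < kappa)%N -> (d <= kappa)%N ->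
  `|\sum_(0 <= i < N) rep_cov i N| <= rho ^+ (kappa - d) / (1 - rho ^+ kappa).
Proof.
move=> k0 dk; apply: (le_trans (ler_norm_sum _ _ _)).
rewrite big_nat_rev/= add0n.
apply: (@le_trans _ _ (\sum_(0 <= i < N) rho ^+ (kappa - d) * (rho ^+ kappa) ^+ i)).
  rewrite big_nat_cond [leRHS]big_nat_cond; apply: ler_sum => i /andP[/andP[_ iN] _].
  have h : (kappa * (N - i.+1).+1 + d + (kappa - d + kappa * i) = kappa * N.+1)%N.
    have -> : N.+1 = ((N - i.+1).+1 + i.+1)%N by lia.
    by rewrite mulnDr mulnS mulnS; lia.
  apply: (le_trans (cov_agree_decay M eps01 nbr_n0 u _)); first by rewrite -h leq_addr.
  by rewrite -{1}h addKn exprD exprM.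
rewrite -mulr_sumr ler_wpM2l ?exprn_ge0 ?(ltW rho0)//.
by apply: sum_geometric_le; rewrite exprn_ge0 ?(ltW rho0)// exprn_ilt1 ?(ltW rho0)// -lt0n.
Qed.

Lemma admissible_limit_gt0 (l : R) : admissible_kappa M u kappa d ->
  rep_cov n n + 2 * \sum_(0 <= i < n) rep_cov i n @[n --> \oo] --> l -> 0 < l.
Proof.
move=> adm cl; have dk := admissible_gt adm.
have k0 : (0 < kappa)%N := leq_ltn_trans (leq0n d) dk.
have [e [/andP[e0 e1] ce pE]] := E_agree_limit.
move: adm; rewrite /admissible_kappa pE subzn ?(ltnW dk)// -exprnP => adm.
have rk1 : rho ^+ kappa < 1 by rewrite exprn_ilt1 ?(ltW rho0)// -lt0n.
have ck : EE (agree u d (kappa * n.+1)) @[n --> \oo] --> e.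
  apply: cvg_comp ce; apply/cvgnyPge => A; near=> n.
  apply: (@leq_trans n); first by near: n; exact: nbhs_infty_ge.
  by rewrite (leq_trans (leqnSn n))// leq_pmull.
set S := rho ^+ (kappa - d) / (1 - rho ^+ kappa).
apply: (@lt_le_trans _ _ (e * (1 - e) - 2 * S)).
  (* Since (1 + p_d)(1 - (1 + p_d)/2) = 2 e (1 - e), what remains is half of the admissibility
     inequality. *)
  rewrite subr_gt0 /S mulrA ltr_pdivrMr ?subr_gt0//.
  by lra.
apply: (@ler_cvg_to _ _ _ _ (fun n => EE (agree u d (kappa * n.+1)) *
  (1 - EE (agree u d (kappa * n.+1))) - 2 * S) _ _ _ _ cl).
  apply: cvgB; last exact: cvg_cst.
  by apply: cvgM => //; apply: cvgB => //; exact: cvg_cst.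
apply: nearW => n; rewrite rep_cov_diag lerD2l -mulrN ler_wpM2l//.
have := off_diag_le n k0 (ltnW dk); rewrite ler_norml => /andP[+ _].
by [].
Unshelve. all: by end_near. Qed.

End AdmissibleSpacing.

Lemma connected_nbr_neq0 (G : lfgraph) : connected_graph G ->
  (exists v w : G, v != w) -> forall v : G, nbr v != fset0.
Proof.
move=> conn [a [b ab]] v.
have [w vw] : exists w : G, v != w.
  have [va|va] := eqVneq v a; last by exists a.
  by exists b; rewrite va.
have [[|x p] /= pth lst] := conn v w; first by rewrite lst eqxx in vw.
by case/andP: pth => xv _; apply/negP => /eqP n0; rewrite n0 inE in xv.
Qed.

(** By local finiteness the walks of length n from [u] end in a finite list of vertices, and
    connectedness makes these lists exhaust the graph. *)
Lemma connected_countable (G : lfgraph) (u : G) :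
  connected_graph G -> countable [set: G].
Proof.
move=> conn.
pose step (s : seq G) : seq G := flatten [seq enum_fset (nbr x) | x <- s].
rewrite (_ : [set: G] = \bigcup_n [set` iter n step [:: u]]).
  apply: bigcup_countable => // n _; apply: finite_set_countable; exact: finite_seq.
apply/seteqP; split => // v _; have [p pth <-] := conn u v.
exists (size p) => //=; rewrite /mkset.
elim/last_ind: p pth => [|p x IH]; first by rewrite /= inE.
rewrite rcons_path last_rcons size_rcons /= => /andP[/IH h xe].
by apply/flatten_mapP; exists (last u p).
Qed.

Theorem theorem2p7 (R : realType) (disp : measure_display)
    (Omega : measurableType disp) (P : probability Omega R)
    (eps : R) (G : lfgraph) (u : G) (M : nvm_input P G eps) (d : nat) :
  0 < eps < 1 ->
  connected_graph G ->
  (exists v w : G, v != w) ->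
  ((fun t : nat => ln t%:R / t%:R ^+ 2 : R) =o_\oo
     (fun t : nat => var P (rep_stat M u d t)) ->
   (exists l : R, t%:R * var P (rep_stat M u d t) @[t --> \oo] --> l) /\
   cvg_in_distribution P (fun t => standardized P (rep_stat M u d t))
     (@normal_prob R 0 1))
  /\
  (forall kappa : nat, admissible_kappa M u kappa d ->
   (exists l : R,
      t%:R * var P (mod_rep_stat M u kappa d t) @[t --> \oo] --> l) /\
   cvg_in_distribution P (fun t => standardized P (mod_rep_stat M u kappa d t))
     (@normal_prob R 0 1)).
Proof.
move=> eps01 conn nontriv.
have nbr_n0 := connected_nbr_neq0 conn nontriv.
split=> [small|kappa adm].
  (* The plain statistic is the spaced one at kappa = 1, so both parts share the variance
     asymptotics and the limit theorem and differ only in why l > 0. *)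
  have stat1 t : rep_stat M u d t = mod_rep_stat M u 1 d t.
    apply/funext => w; rewrite /rep_stat /mod_rep_stat; congr (_ * _).
    by apply: eq_bigr => i _; rewrite mul1n.
  have varE1 : (fun t => var P (rep_stat M u d t)) =
               (fun t => var P (mod_rep_stat M u 1 d t)).
    by apply/funext => t; rewrite stat1.
  rewrite varE1 in small.
  have [l [B [Vl _]]] := rep_cov_linear M eps01 nbr_n0 u d (ltn0Sn 0).
  have scaled := cvg_scaled_var Vl.
  have l0 : 0 < l.
    rewrite lt_neqAle (limit_ge0 scaled) andbT eq_sym; apply/eqP => l0.
    have bounded n : double_sum (rep_cov M u d 1) n <= B.
      by have := Vl n; rewrite l0 mul0r subr0 => /ler_normlW.
    exact: bounded_double_sum_not_littleo bounded small.
  split.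
    by exists l; under eq_fun do rewrite stat1.
  under eq_fun do rewrite stat1.
  exact: cvg_standardized Vl l0.
have countableG := connected_countable u conn.
have k0 : (0 < kappa)%N.
  by apply: leq_ltn_trans (admissible_gt eps01 nbr_n0 countableG adm).
have [l [B [Vl cl]]] := rep_cov_linear M eps01 nbr_n0 u d k0.
have l0 := admissible_limit_gt0 eps01 nbr_n0 countableG adm cl.
split; first by exists l; exact: cvg_scaled_var Vl.
exact: cvg_standardized Vl l0.
Qed.
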